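(* Let $\sigma^\Pi(t)$, $t\ge0$, be a non-homogeneous subordinator with drift function $b(t)$ and measures $\nu(ds,t)$, $t\ge0$, satisfying in addition $\int_0^\infty(x\wedge1)\,\nu(dx,t)<\infty$ for all $t\ge0$, and for $0\le s\le t$ let $\mu_{s,t}$ be the distribution of $\sigma^\Pi(t)-\sigma^\Pi(s)$. Let $(A,\mathrm{Dom}(A))$ be a self-adjoint, dissipative operator on a Hilbert space $(\mathfrak H,\langle\cdot,\cdot\rangle)$ which generates a $C_0$-semigroup $T_t$, $t\ge0$ (so $\|T_tu\|_{\mathfrak H}\le\|u\|_{\mathfrak H}$). For $0\le s\le t$ and $u\in\mathfrak H$ define the Bochner integral $$\mathcal T_{s,t}u=\int_0^\infty T_w u\,\mu_{s,t}(dw).$$ Then the family $\mathcal T_{s,t}$ is a bounded propagator on $\mathfrak H$, and for every $u\in\mathrm{Dom}(A)$ the map $t\mapsto\mathcal T_{s,t}u$ solves $$\begin{cases}\dfrac{d}{dt}q(t)=-f(-A,t)\,q(t),& 0\le s\le t,\\ q(s)=u\in\mathrm{Dom}(A),\end{cases}$$ where the family of generators $\{-f(-A,t)\}_{t\ge0}$ can be defined as $$-f(-A,t)\,q:=b'(t)\,Aq+\int_0^\infty(T_sq-q)\,\nu(ds,t),$$ a Bochner integral on $\mathrm{Dom}(A)$.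
   Context: A non-homogeneous subordinator is a càdlàg process with non-decreasing sample paths of the form $\sigma^\Pi(t)=b(t)+\sum_{0\le s\le t}e(s)$, $t\ge0$, where $b:[0,\infty)\to[0,\infty)$ is differentiable, non-decreasing, with $b(0)=0$, and $e(s)$ is a Poisson point process on $(0,\infty)$ (a Poisson random measure on $(0,\infty)\times[0,\infty)$ of points $(e(s),s)$, with $e(s)=0$ when there is no point at time $s$) with intensity measure $\nu(dx,dt)$. Standing assumptions: (A1) $\nu(dx,dt)=\nu(dx,t)\,dt$ for a family of measures $\{\nu(dx,t)\}_{t\ge0}$ on $(0,\infty)$ that depends continuously on $t$; (A2) $\int_0^t\int_{(0,\infty)}(x\wedge1)\,\nu(dx,s)\,ds<\infty$ for all $t\ge0$. Set $f(\lambda,t)=\lambda b'(t)+\int_0^\infty(1-e^{-\lambda s})\,\nu(ds,t)$, a Bernstein function of $\lambda$ for each $t$; then $\int_{[0,\infty)} e^{-\lambda w}\mu_{s,t}(dw)=e^{-\int_s^tf(\lambda,\tau)\,d\tau}$. A propagator (two-parameter semigroup) on a Banach space $\mathfrak B$ is a family of maps $\mathcal T_{s,t}:\mathfrak B\to\mathfrak B$, $0\le s\le t$, such that for each $u\in\mathfrak B$: (1) $\mathcal T_{t,t}u=u$ for each $t\ge0$; (2) $\mathcal T_{s,t}\mathcal T_{r,s}u=\mathcal T_{r,t}u$ for $r\le s\le t$; (3) $\lim_{\delta\to0}\|\mathcal T_{s+\delta,t}u-\mathcal T_{s,t}u\|=\lim_{\delta\to0}\|\mathcal T_{s,t+\delta}u-\mathcal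 T_{s,t}u\|=0$. Dissipative means $\langle Au,u\rangle\le0$ for all $u\in\mathrm{Dom}(A)$. *)

(* Defs.v *)
From HB Require Import structures.
From mathcomp Require Import all_boot all_order all_algebra.
From mathcomp Require Import all_classical all_reals all_analysis.
From mathcomp Require Import measurable_realfun complex.

Set Implicit Arguments.
Unset Strict Implicit.
Unset Printing Implicit Defensive.

Import Order.TTheory GRing.Theory Num.Theory.
Import numFieldNormedType.Exports.

Local Open Scope classical_set_scope.
Local Open Scope ring_scope.

(* A Hilbert space may be real or complex: its field of scalars is
   [scalars R k], i.e. R itself or R[i]. *)
Inductive scalar_kind := RealScalars | ComplexScalars.

Definition scalars (R : realType) (k : scalar_kind) : numFieldType :=
  match k with RealScalars => R | ComplexScalars => R[i] end.

Definition of_real (R : realType) (k : scalar_kind) : R -> scalars R k :=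
  match k with
  | RealScalars => fun x => x
  | ComplexScalars => fun x => real_complex R x
  end.

Definition re_part (R : realType) (k : scalar_kind) : scalars R k -> R :=
  match k with
  | RealScalars => fun x => x
  | ComplexScalars => fun z => complex.Re z
  end.

Definition scalar_conj (R : realType) (k : scalar_kind) :
    scalars R k -> scalars R k :=
  match k with
  | RealScalars => fun x => x
  | ComplexScalars => fun z => conjc z
  end.

Section vector_valued.
Context (R : realType) (k : scalar_kind).
Local Notation K := (scalars R k).
Context (H : completeNormedModType K).

(* The norm of H takes its values in K; this is the same number, in R. *)
Definition rnorm (u : H) : R := re_part `|u|.

Definition is_derivative_within (I : set R) (q : R -> H) (t : R) (v : H) :=
  of_real k (r - t)^-1 *: (q r - q t) @[r --> within I t^'] --> v.

Section bochner.
Context (d : measure_display) (X : measurableType d).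
Context (mu : {measure set X -> \bar R}) (D : set X).

Definition is_simple (g : {fimfun X >-> H}) :=
  forall v, v != 0 ->
    measurable (D `&` g @^-1` [set v]) /\ (mu (D `&` g @^-1` [set v]) < +oo)%E.

Definition simple_integral (g : {fimfun X >-> H}) : H :=
  \sum_(v \in range g) of_real k (fine (mu (D `&` g @^-1` [set v]))) *: v.

Definition is_bochner_integral (f : X -> H) (I : H) :=
  exists g : nat -> {fimfun X >-> H},
    [/\ forall n, is_simple (g n),
        \forall x \ae mu, D x -> g n x @[n --> \oo] --> f x,
        (\int[mu]_(x in D) (rnorm (f x - g n x))%:E)%E @[n --> \oo] --> 0%E
      & simple_integral (g n) @[n --> \oo] --> I].

Definition bochner_integrable (f : X -> H) :=
  exists I, is_bochner_integral f I.

(* The value is 0 when f is not Bochner integrable. *)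
Definition bochner_integral (f : X -> H) : H :=
  xget 0 [set I | is_bochner_integral f I].

End bochner.

(* An unbounded operator is a pair (D, A); the values of A outside its domain D
   are irrelevant. *)
Definition linear_operator (D : set H) (A : H -> H) :=
  D 0 /\ forall a u v, D u -> D v ->
    D (a *: u + v) /\ A (a *: u + v) = a *: A u + A v.

Definition in_adjoint_graph (ip : H -> H -> K) (D : set H) (A : H -> H)
    (v w : H) :=
  forall u, D u -> ip (A u) v = ip u w.

Definition self_adjoint (ip : H -> H -> K) (D : set H) (A : H -> H) :=
  [/\ linear_operator D A, dense D
    & forall v w, (D v /\ A v = w) <-> in_adjoint_graph ip D A v w].

Definition dissipative (ip : H -> H -> K) (D : set H) (A : H -> H) :=
  forall u, D u -> ip (A u) u <= 0.

Definition bounded_linear (S : H -> H) :=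
  linear S /\ exists M : R, forall u, rnorm (S u) <= M * rnorm u.

Record C0_semigroup (T : R -> H -> H) : Prop := {
  C0_bounded : forall t : R, 0 <= t -> bounded_linear (T t) ;
  C0_0 : forall u, T 0 u = u ;
  C0_add : forall (s t : R) u, 0 <= s -> 0 <= t -> T (s + t) u = T s (T t u) ;
  C0_continuous : forall u, T t u @[t --> 0^'+] --> u }.

Definition is_generator (T : R -> H -> H) (D : set H) (A : H -> H) :=
  forall u v, (D u /\ A u = v) <->
    of_real k t^-1 *: (T t u - u) @[t --> 0^'+] --> v.

Record propagator (S : R -> R -> H -> H) : Prop := {
  propagator_id : forall (t : R) u, 0 <= t -> S t t u = u ;
  propagator_comp : forall (r s t : R) u, 0 <= r -> r <= s -> s <= t ->
    S s t (S r s u) = S r t u ;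
  propagator_cvgl : forall (s t : R) u, 0 <= s -> s <= t ->
    rnorm (S (s + delta) t u - S s t u)
      @[delta --> within [set x | 0 <= s + x <= t] 0^'] --> 0 ;
  propagator_cvgr : forall (s t : R) u, 0 <= s -> s <= t ->
    rnorm (S s (t + delta) u - S s t u)
      @[delta --> within [set x | s <= t + x] 0^'] --> 0 }.

(* The bound is uniform in (s, t). *)
Definition bounded_propagator (S : R -> R -> H -> H) :=
  [/\ propagator S, forall s t : R, 0 <= s -> s <= t -> linear (S s t)
    & exists M : R, forall (s t : R) u, 0 <= s -> s <= t ->
        rnorm (S s t u) <= M * rnorm u].

End vector_valued.

Section poisson_point_process.
Context (R : realType) (d : measure_display) (Omega : measurableType d).
Context (P : probability Omega R).

(* A point process on (0, +oo) is given by its values e t at the times t >= 0,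
   where e t w = 0 when there is no point at time t. *)
Definition point_count (e : R -> Omega -> R) (B : set (R * R)) (w : Omega) :
    \bar R :=
  counting [set p : R * R |
              [/\ 0 <= p.2, p.1 = e p.2 w, 0 < p.1 & B p]].

(* The second argument of the library's [poisson_prob] is a dummy.  It is used
   rather than [poisson_pmf] because it is also correct at rate 0. *)
Record poisson_point_process (Lambda : set (R * R) -> \bar R)
    (e : R -> Omega -> R) : Prop := {
  ppp_ge0 : forall (t : R) w, 0 <= t -> 0 <= e t w ;
  ppp_measurable : forall B : set (R * R), measurable B ->
    measurable_fun [set: Omega] (point_count e B) ;
  ppp_poisson : forall (B : set (R * R)) (n : nat), measurable B -> (Lambda B < +oo)%E ->
    P [set w | point_count e B w = n%:R%:E] =
    poisson_prob (fine (Lambda B)) 0%N [set n] ;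
  ppp_infinite : forall B : set (R * R), measurable B -> Lambda B = +oo%E ->
    P [set w | point_count e B w = +oo%E] = 1%E ;
  ppp_independent : forall (n : nat) (B : 'I_n -> set (R * R))
      (C : 'I_n -> set (\bar R)),
    (forall i, measurable (B i)) -> (forall i, measurable (C i)) ->
    trivIset [set: 'I_n] B ->
    P [set w | forall i, C i (point_count e (B i) w)] =
    (\prod_(i < n) P [set w | C i (point_count e (B i) w)])%E }.

End poisson_point_process.

Section subordinator.
Context (R : realType).
(* Only the restrictions of the measures nu t to (0, +oo), for t >= 0, are
   used. *)
Context (nu : R -> {measure set R -> \bar R}).

(* nu(dx, t) dt, as a measure on (0, +oo) x [0, +oo) *)
Definition intensity (B : set (R * R)) : \bar R :=
  (\int[lebesgue_measure]_(t in `[0%R, +oo[)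
     nu t [set x : R | (0 < x)%R /\ B (x, (t : R))])%E.

(* Continuity of t |-> nu t: weak continuity of (x /\ 1) nu(dx, t) on
   (0, +oo).  Vague continuity would not do: f(lambda, t) need not be continuous
   in t when mass may escape to +oo or accumulate at 0. *)
Definition levy_continuous :=
  forall phi : R -> R,
    {within `]0, +oo[, continuous phi} ->
    (exists C : R, forall x, 0 < x -> `|phi x| <= C * Num.min x 1) ->
    {within `[0, +oo[, continuous
       (fun t => \int[nu t]_(x in `]0%R, +oo[) phi x)}.

Definition cadlag (x : R -> R) :=
  (forall t : R, 0 <= t -> x r @[r --> t^'+] --> x t) /\
  (forall t : R, 0 < t -> cvg (x r @[r --> t^'-])).

Definition nondecreasing_path (x : R -> R) :=
  forall s t : R, 0 <= s -> s <= t -> x s <= x t.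

Record nonhomogeneous_subordinator (d : measure_display)
    (Omega : measurableType d) (P : probability Omega R)
    (b db : R -> R) (sigma : R -> {RV P >-> R}) : Prop := {
  drift_0 : b 0 = 0 ;
  drift_nondecreasing : nondecreasing_path b ;
  drift_derivative : forall t : R, 0 <= t ->
    (b r - b t) / (r - t) @[r --> within `[0, +oo[ t^'] --> db t ;
  levy_family_continuous : levy_continuous ;
  levy_locally_integrable : forall t : R, 0 <= t ->
    (\int[lebesgue_measure]_(s in `[0%R, t])
       \int[nu s]_(x in `]0%R, +oo[) (Num.min x 1)%:E < +oo)%E ;
  path_cadlag : forall w, cadlag (fun t => sigma t w) ;
  path_nondecreasing : forall w, nondecreasing_path (fun t => sigma t w) ;
  path_representation : exists e : R -> Omega -> R,
    poisson_point_process P intensity e /\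
    (\forall w \ae P, forall t : R, 0 <= t ->
       (sigma t w)%:E = ((b t)%:E + \esum_(s in `[0%R, t]%classic) (e s w)%:E)%E) }.

End subordinator.

Section subordination.
Context (R : realType) (k : scalar_kind).
Context (H : completeNormedModType (scalars R k)).

(* the distribution of sigma t - sigma s *)
Definition increment_law (d : measure_display) (Omega : measurableType d)
    (P : probability Omega R) (sigma : R -> {RV P >-> R}) (s t : R) :
    probability R R :=
  distribution P (sigma t - sigma s : {mfun Omega >-> R}).

Definition subordinate (d : measure_display) (Omega : measurableType d)
    (P : probability Omega R) (sigma : R -> {RV P >-> R}) (T : R -> H -> H)
    (s t : R) (u : H) : H :=
  bochner_integral (increment_law sigma s t) `[0, +oo[ (fun w => T w u).

(* - f(- A, t) *)
Definition subordinate_generator (db : R -> R)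
    (nu : R -> {measure set R -> \bar R}) (A : H -> H) (T : R -> H -> H)
    (t : R) (q : H) : H :=
  of_real k (db t) *: A q +
  bochner_integral (nu t) `]0, +oo[ (fun s => T s q - q).

End subordination.

(* Main.v *)
(* With x = exp(-w), the map w |-> T_w u becomes continuous on 0 <= x <= 1, since
   T_w u has a limit as w -> +oo: <T_w u, u> = |T_{w/2} u|^2 decreases.  Bernstein
   polynomials thus approximate T_w u uniformly in w by sums of exp(-j w) c_j, and
   the averages of T_w u over a probability measure are controlled by its Laplace
   transform at the integers j; this replaces the spectral theorem.  For the law
   of sigma(t) - sigma(s) that transform is the exponential of minus the integral
   of f(j, _) over (s, t], found by discretizing the jump sizes of the Poisson
   process.  It is multiplicative in (s, t], hence the propagator property.  For
   the equation, T_w q - q = (1 - exp(-w)) F(w) with F continuous and F(0) = A q;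
   approximating F reduces the convergence of (T_{a,c} q - q) / (c - a) to that of
   (1 - exp(-integral of f(j, _) over (a, c])) / (c - a), for each integer j. *)
Require Import Defs.
From HB Require Import structures.
From mathcomp Require Import all_boot all_order all_algebra.
From mathcomp Require Import finmap.
From mathcomp Require Import all_classical all_reals all_analysis.
From mathcomp Require Import measurable_realfun complex sesquilinear ring lra.
Import Order.TTheory GRing.Theory Num.Theory.
Import numFieldNormedType.Exports.
Set Implicit Arguments.
Unset Strict Implicit.
Unset Printing Implicit Defensive.
Local Open Scope classical_set_scope.
Local Open Scope ring_scope.

(** * Real and complex Hilbert spaces *)

(** A [C0_semigroup] is only a family of bounded operators, continuous at time 0, so contraction and
    symmetry must be derived: nested balls give a bound on compact time intervals, then time is cut
    into steps of length [h], over which dissipativity controls |T_t u|^2 and symmetry of [A]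
    controls <T_s u, T_t v>. Vectors are identified by the real inner product [rip]: a Bochner
    integral is known once its scalar integrals are, and real and complex spaces are treated alike.
    A measure [nu t] may be infinite near 0, hence the polynomials in x = exp(-w) integrated against
    it are multiples of 1 - x, and errors are kept relative to 1 - exp(-w), which is integrable and
    whose mean under the increment law, divided by the length of the interval, stays bounded. The
    drift term b'(t) A q comes out of the same approximation: among the polynomials (1 - x)
    B_{N,j}(x) only j = N has a nonzero derivative at x = 1, and its coefficient is F(0) = A q. The
    left derivative needs more than the right one, since the operator S_{s,r} factored out there
    moves with r; strong continuity compensates. *)

Section scalar_field.
Context (R : realType) (k : scalar_kind).
Local Notation K := (scalars R k).
Implicit Types (a b : R) (z : K).

Lemma of_real_is_zmod_morphism : zmod_morphism (@of_real R k).
Proof. by case: k => x y //=; rewrite rmorphB. Qed.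

Lemma of_real_is_monoid_morphism : monoid_morphism (@of_real R k).
Proof. by case: k; split => [|x y] //=; rewrite ?rmorph1 ?rmorphM. Qed.

HB.instance Definition _ :=
  GRing.isZmodMorphism.Build R K (@of_real R k) of_real_is_zmod_morphism.
HB.instance Definition _ :=
  GRing.isMonoidMorphism.Build R K (@of_real R k) of_real_is_monoid_morphism.

Lemma re_part_is_zmod_morphism : zmod_morphism (@re_part R k).
Proof. by case: k => x y //=; rewrite raddfB. Qed.

HB.instance Definition _ :=
  GRing.isZmodMorphism.Build K R (@re_part R k) re_part_is_zmod_morphism.

Lemma re_partZ a z : re_part (of_real k a * z) = a * re_part z.
Proof. by move: z; case: k => //= -[x y]; rewrite /= mul0r subr0. Qed.

Lemma of_realK a : re_part (of_real k a) = a.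
Proof. by case: k. Qed.

Lemma re_part_conj z : re_part (scalar_conj z) = re_part z.
Proof. by move: z; case: k => //= -[]. Qed.

Lemma ler_of_real a b : (of_real k a <= of_real k b) = (a <= b).
Proof. by case: k => //=; rewrite lecR. Qed.

Lemma ltr_of_real a b : (of_real k a < of_real k b) = (a < b).
Proof. by case: k => //=; rewrite ltcR. Qed.

Lemma norm_of_real a : `|of_real k a| = of_real k `|a|.
Proof. by case: k => //=; rewrite normc_def /= expr0n addr0 sqrtr_sqr. Qed.

Lemma ge0_of_real z : 0 <= z -> z = of_real k (re_part z).
Proof.
by move: z; case: k => //= -[x y]; rewrite lecE /= => /andP[/eqP-> _].
Qed.

Lemma re_part_ge0 z : 0 <= z -> 0 <= re_part z.
Proof. by move=> z0; rewrite -ler_of_real rmorph0 -ge0_of_real. Qed.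

Lemma gt0_of_real z : 0 < z -> 0 < re_part z.
Proof.
by move=> z0; rewrite -ltr_of_real rmorph0 -ge0_of_real// ltW.
Qed.

(* In the complex case the imaginary part is recovered from ['i * z]. *)
Lemma eq_of_re_part (z z' : K) :
  (forall c : K, re_part (c * z) = re_part (c * z')) -> z = z'.
Proof.
move: z z'; case: k => /= z z' h; first by move: (h 1); rewrite !mul1r.
have h1 := h 1; have hi := h (Complex 0 (-1)); rewrite !mul1r in h1.
move: z z' h1 hi {h} => [x y] [x' y'] /= -> /eqP.
by rewrite !mul0r !mulN1r !sub0r !opprK => /eqP ->.
Qed.

End scalar_field.

Section real_structure.
Context (R : realType) (k : scalar_kind).
Local Notation K := (scalars R k).
Context (H : completeNormedModType K).
Implicit Types (u v w : H) (a b : R).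

(** Real scalars suffice for all estimates, so that [H] is handled as a real space whatever [k]
    is. *)
Definition rscale a u : H := of_real k a *: u.

Lemma norm_rnorm u : `|u| = of_real k (rnorm u).
Proof. exact: ge0_of_real. Qed.

Lemma rnorm_ge0 u : 0 <= rnorm u.
Proof. exact: re_part_ge0. Qed.

Lemma rnorm0 : rnorm (0 : H) = 0.
Proof. by rewrite /rnorm normr0 raddf0. Qed.

Lemma rnorm_eq0 u : (rnorm u == 0) = (u == 0).
Proof.
by rewrite -(normr_eq0 u) norm_rnorm -(rmorph0 (@of_real R k)) (inj_eq (can_inj (@of_realK R k))).
Qed.

Lemma rnormN u : rnorm (- u) = rnorm u.
Proof. by rewrite /rnorm normrN. Qed.

Lemma rnormB u v : rnorm (u - v) = rnorm (v - u).
Proof. by rewrite -rnormN opprB. Qed.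

Lemma ler_rnormD u v : rnorm (u + v) <= rnorm u + rnorm v.
Proof.
by have := @ler_normD _ H u v; rewrite !norm_rnorm -rmorphD ler_of_real.
Qed.

Lemma ler_rnormB u v : rnorm (u - v) <= rnorm u + rnorm v.
Proof. by rewrite -(rnormN v) ler_rnormD. Qed.

Lemma ler_rnorm_dist v u w : rnorm (u - w) <= rnorm (u - v) + rnorm (v - w).
Proof. by rewrite -(subrKA v u (- w)); exact: ler_rnormD. Qed.

Lemma ler_dist_rnorm u v : `|rnorm u - rnorm v| <= rnorm (u - v).
Proof.
rewrite ler_norml; apply/andP; split.
  rewrite lerNl opprB lerBlDr rnormB.
  by have := ler_rnormD (v - u) u; rewrite subrK.
by rewrite lerBlDr; have := ler_rnormD (u - v) v; rewrite subrK.
Qed.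

Lemma ler_rnorm_sum I (r : seq I) (F : I -> H) :
  rnorm (\sum_(i <- r) F i) <= \sum_(i <- r) rnorm (F i).
Proof.
elim/big_rec2: _ => [|i y x _ le]; first by rewrite rnorm0.
by apply: le_trans (ler_rnormD _ _) _; rewrite lerD2l.
Qed.

Lemma rnorm_scale a u : rnorm (rscale a u) = `|a| * rnorm u.
Proof. by rewrite /rnorm normrZ norm_of_real re_partZ. Qed.

Lemma rscaleBr a u v : rscale a (u - v) = rscale a u - rscale a v.
Proof. exact: scalerBr. Qed.

Lemma rscaleBl a b u : rscale (a - b) u = rscale a u - rscale b u.
Proof. by rewrite /rscale rmorphB scalerBl. Qed.

Lemma rscaleA a b u : rscale a (rscale b u) = rscale (a * b) u.
Proof. by rewrite /rscale scalerA rmorphM. Qed.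

Lemma rscale1 u : rscale 1 u = u.
Proof. by rewrite /rscale rmorph1 scale1r. Qed.

Lemma rscaleN1 u : rscale (-1) u = - u.
Proof. by rewrite /rscale rmorphN1 scaleN1r. Qed.

(** Balls of [H] have radii in [K]; a positive element of [K] is real, so real radii generate the
    same neighbourhoods. *)
Lemma cvg_rnormP (I : Type) (F : set_system I) (FF : Filter F) (f : I -> H)
    (l : H) :
  f x @[x --> F] --> l <-> rnorm (f x - l) @[x --> F] --> 0.
Proof.
split=> [/cvgrPdist_lt cf|/cvgr0Pnorm_lt cf].
  apply/cvgr0Pnorm_lt => e e0.
  have : 0 < of_real k e by rewrite -(rmorph0 (@of_real R k)) ltr_of_real.
  move=> /cf; apply: filterS => x.
  by rewrite norm_rnorm ltr_of_real rnormB ger0_norm// rnorm_ge0.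
apply/cvgrPdist_lt => e e0; move: (gt0_of_real e0) => /cf.
apply: filterS => x; rewrite ger0_norm ?rnorm_ge0// => h.
by rewrite norm_rnorm (ge0_of_real (ltW e0)) ltr_of_real rnormB.
Qed.

Lemma cvg_rnormP_lt (I : Type) (F : set_system I) (FF : Filter F) (f : I -> H)
    (l : H) :
  f x @[x --> F] --> l <->
  forall e : R, 0 < e -> \forall x \near F, rnorm (f x - l) < e.
Proof.
rewrite cvg_rnormP; split=> [/cvgr0Pnorm_lt h e /h|h].
  by apply: filterS => x; rewrite ger0_norm// rnorm_ge0.
apply/cvgr0Pnorm_lt => e /h.
by apply: filterS => x; rewrite ger0_norm// rnorm_ge0.
Qed.

Lemma cvg_rnorm (I : Type) (F : set_system I) (FF : Filter F) (f : I -> H)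
    (l : H) :
  f x @[x --> F] --> l -> rnorm (f x) @[x --> F] --> rnorm l.
Proof.
move=> /cvg_rnormP_lt h; apply/cvgrPdist_lt => e /h.
by apply: filterS => x; apply: le_lt_trans; rewrite distrC ler_dist_rnorm.
Qed.

Lemma cauchy_rnorm_cvg (f : nat -> H) :
  (forall e : R, 0 < e -> exists N : nat, forall m n : nat, (N <= m)%N -> (N <= n)%N ->
     rnorm (f m - f n) < e) ->
  exists l : H, f n @[n --> \oo] --> l.
Proof.
move=> h; suff /cvg_ex : cvg (f n @[n --> \oo]) by [].
apply/cauchy_cvgP/cauchy_ballP => e e0.
have /h[N hN] := gt0_of_real e0.
exists (f @` [set n | (N <= n)%N], f @` [set n | (N <= n)%N]) => /=.
  by split; exists N => // n /= Nn; exists n.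
move=> [_ _] /= [[m Nm <-] [n Nn <-]]; rewrite -ball_normE /ball_ /=.
by rewrite norm_rnorm (ge0_of_real (ltW e0)) ltr_of_real hN.
Qed.

End real_structure.

Section real_inner_product.
Context (R : realType) (k : scalar_kind).
Local Notation K := (scalars R k).
Context (H : completeNormedModType K) (ip : {dot H for @scalar_conj R k}).
Hypothesis ip_norm : forall u : H, ip u u = `|u| ^+ 2.
Implicit Types (u v w : H) (a b : R).

(** A symmetric real bilinear form with the norm of [H], over both scalar fields. It separates
    vectors, and it takes values where Lebesgue integration is available. *)
Definition rip u v : R := re_part (ip u v).

Lemma ip_conj u v : ip u v = scalar_conj (ip v u).
Proof. by rewrite hermitian_subproof expr0 mul1r. Qed.

Lemma ripC u v : rip u v = rip v u.
Proof. by rewrite /rip ip_conj re_part_conj. Qed.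

Lemma ripDl u v w : rip (u + v) w = rip u w + rip v w.
Proof. by rewrite /rip linearDl raddfD. Qed.

Lemma ripDr u v w : rip w (u + v) = rip w u + rip w v.
Proof. by rewrite ripC ripDl !(ripC w). Qed.

Lemma ripZl a u v : rip (rscale a u) v = a * rip u v.
Proof. by rewrite /rip linearZl_LR re_partZ. Qed.

Lemma ripZr a u v : rip v (rscale a u) = a * rip v u.
Proof. by rewrite ripC ripZl ripC. Qed.

Lemma ripNl u v : rip (- u) v = - rip u v.
Proof. by rewrite -rscaleN1 ripZl mulN1r. Qed.

Lemma ripNr u v : rip u (- v) = - rip u v.
Proof. by rewrite ripC ripNl ripC. Qed.

Lemma ripBl u v w : rip (u - v) w = rip u w - rip v w.
Proof. by rewrite ripDl ripNl. Qed.

Lemma ripBr u v w : rip w (u - v) = rip w u - rip w v.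
Proof. by rewrite ripDr ripNr. Qed.

Lemma rip0r u : rip u 0 = 0.
Proof. by rewrite -(subrr 0) ripBr subrr. Qed.

Lemma rip_sumr I (r : seq I) (F : I -> H) u :
  rip u (\sum_(i <- r) F i) = \sum_(i <- r) rip u (F i).
Proof.
elim/big_rec2: _ => [|i y x _ <-]; first by rewrite rip0r.
by rewrite ripDr.
Qed.

Lemma rip_rnorm u : rip u u = rnorm u ^+ 2.
Proof. by rewrite /rip ip_norm norm_rnorm -rmorphXn of_realK. Qed.

Lemma rip_ge0 u : 0 <= rip u u.
Proof. by rewrite rip_rnorm sqr_ge0. Qed.

Lemma rip_cauchy_schwarz u v : `|rip u v| <= rnorm u * rnorm v.
Proof.
have [->|v0] := eqVneq v 0; first by rewrite rip0r rnorm0 mulr0 normr0.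
have nv : 0 < rnorm v by rewrite lt_def rnorm_eq0 v0 rnorm_ge0.
rewrite -ler_sqr ?nnegrE ?mulr_ge0 ?rnorm_ge0// real_normK ?num_real//.
(* This is |v|^2 times the component of [u] orthogonal to [v], which avoids a division. *)
have := rip_ge0 (rscale (rnorm v ^+ 2) u - rscale (rip u v) v).
rewrite ripBl !ripBr !ripZl !ripZr !rip_rnorm (ripC v u).
set x := rip u v; set p := rnorm u; set q := rnorm v.
have -> : q ^+ 2 * (q ^+ 2 * p ^+ 2) - q ^+ 2 * (x * x) -
  (x * (q ^+ 2 * x) - x * (x * q ^+ 2)) = q ^+ 2 * ((p * q) ^+ 2 - x ^+ 2) by ring.
by rewrite pmulr_rge0 ?exprn_gt0// subr_ge0.
Qed.

Lemma ler_rip u v : rip u v <= rnorm u * rnorm v.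
Proof. exact: le_trans (ler_norm _) (rip_cauchy_schwarz u v). Qed.

Lemma rip_inj u v : (forall w, rip w u = rip w v) -> u = v.
Proof.
move=> h; apply/eqP; rewrite -subr_eq0 -rnorm_eq0 -sqrf_eq0 -rip_rnorm.
by rewrite ripBr h subrr.
Qed.

(* Testing against [v] itself. *)
Lemma rnorm_le_rip v c : 0 <= c -> (forall w, rip w v <= c * rnorm w) ->
  rnorm v <= c.
Proof.
move=> c0 /(_ v); rewrite rip_rnorm expr2.
have [->//|v0] := eqVneq (rnorm v) 0.
by rewrite ler_pM2r// lt_def v0 rnorm_ge0.
Qed.

Lemma cvg_rip (I : Type) (F : set_system I) (FF : Filter F) (f : I -> H) v l :
  f x @[x --> F] --> l -> rip v (f x) @[x --> F] --> rip v l.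
Proof.
move=> /cvg_rnormP h; apply/subr_cvg0/norm_cvg0P.
apply: (@squeeze_cvgr _ _ _ _ (cst 0) (fun x => rnorm v * rnorm (f x - l))).
- by apply: nearW => x; rewrite normr_ge0 /= -ripBr rip_cauchy_schwarz.
- exact: cvg_cst.
- by rewrite -(mulr0 (rnorm v)); apply: cvgMr.
Qed.

Lemma ip_scale_re (c : K) u v : re_part (c * ip u v) = rip (c *: u) v.
Proof. by rewrite /rip linearZl_LR. Qed.

End real_inner_product.

(** * Weak characterization of Bochner integrals *)

Section bochner.
Context (R : realType) (k : scalar_kind).
Local Notation K := (scalars R k).
Context (H : completeNormedModType K) (ip : {dot H for @scalar_conj R k}).
Hypothesis ip_norm : forall u : H, ip u u = `|u| ^+ 2.
Context (d : measure_display) (X : measurableType d).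
Context (mu : {measure set X -> \bar R}) (D : set X).
Hypothesis mD : measurable D.
Local Notation rip := (rip ip).

Section simple.
Context (g : {fimfun X >-> H}).

Lemma simple_decomposition (th : H -> R) x : D x ->
  th (g x) = \sum_(v <- fset_set (range g)) th v * \1_(D `&` g @^-1` [set v]) x.
Proof.
move=> Dx; have gx : g x \in fset_set (range g).
  by rewrite in_fset_set// inE; exists x.
rewrite (bigD1_seq (g x)) ?fset_uniq//= big1 ?addr0 => [|v vg].
  by rewrite indicE mem_set ?mulr1.
by rewrite indicE memNset ?mulr0// => -[_ /= /esym/eqP]; apply/negP.
Qed.

Hypothesis gs : is_simple mu D g.

Lemma measurable_simple_level v : measurable (D `&` g @^-1` [set v]).
Proof.
have [->|v0] := eqVneq v 0; last by have [] := gs v0.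
(* [is_simple] says nothing about the level of 0; it is the complement of the finitely many other
   levels. *)
rewrite (_ : _ `&` _ = D `\` \bigcup_(w in range g `\ 0) (D `&` g @^-1` [set w])).
  apply: measurableD => //; apply: fin_bigcup_measurable => [|w [_ /eqP w0]].
    exact: sub_finite_set (@subDsetl _ _ _) _.
  by have [] := gs w0.
apply/seteqP; split => x /= [Dx gx]; split => //.
- by case=> w [_ /= w0] [_ gw]; apply: w0; rewrite -gw.
- by apply: contrapT => g0; apply: gx; exists (g x) => //; split => //; exists x.
Qed.

Lemma measurable_simple (th : H -> R) : measurable_fun D (th \o g).
Proof.
apply: (eq_measurable_fun (fun x => \sum_(v <- fset_set (range g))
    th v * \1_(D `&` g @^-1` [set v]) x)).
  by move=> x /[!inE] Dx; rewrite /= -simple_decomposition.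
apply: measurable_sum => v; apply: measurable_funM => //.
apply: measurable_funTS; exact/measurable_indicP/measurable_simple_level.
Qed.

(** The level of 0 may have infinite measure; [th 0 = 0] removes its term. *)
Lemma integrable_simple (th : H -> R) : th 0 = 0 ->
  mu.-integrable D (EFin \o (th \o g)) /\
  \int[mu]_(x in D) th (g x) =
  \sum_(v <- fset_set (range g)) fine (mu (D `&` g @^-1` [set v])) * th v.
Proof.
move=> th0; pose F v x := (th v * \1_(D `&` g @^-1` [set v]) x)%:E.
have i1 v : v != 0 ->
    mu.-integrable D (fun x => (\1_(D `&` g @^-1` [set v]) x)%:E).
  move=> v0; apply/integrableP; split.
    apply/measurable_EFinP; apply: measurable_funTS.
    exact/measurable_indicP/measurable_simple_level.
  under eq_integral => x _ do rewrite gee0_abs ?lee_fin//.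
  rewrite integral_indic//; last exact: measurable_simple_level.
  by rewrite setIAC setIid; exact: (gs v0).2.
have F0 : F 0 = cst 0%E by apply/funext => x; rewrite /F th0 mul0r.
have iF v : mu.-integrable D (F v).
  have [->|v0] := eqVneq v 0; first by rewrite F0; exact: integrable0.
  rewrite /F; under eq_fun do rewrite EFinM.
  by apply: integrableZl => //; exact: i1.
have iS : mu.-integrable D (fun x => \sum_(v <- fset_set (range g)) F v x)%E.
  exact: integrable_sum.
have eS : {in D, (fun x => \sum_(v <- fset_set (range g)) F v x)%E =1 EFin \o (th \o g)}.
  by move=> x /[!inE] Dx; rewrite /= /F sumEFin -simple_decomposition.
split; first exact: eq_integrable eS iS.
rewrite /Rintegral -(eq_integral _ _ eS) integral_sum// -sum_fine => [|v _]; last exact: integrable_fin_num.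
apply: eq_bigr => v _; have [->|v0] := eqVneq v 0.
  by rewrite th0 mulr0 F0 integral0.
rewrite /F; under eq_integral do rewrite EFinM.
rewrite integralZl//; last exact: i1.
rewrite integral_indic//; last exact: measurable_simple_level.
rewrite setIAC setIid fineM//; first exact: mulrC.
by rewrite ge0_fin_numE//; exact: (gs v0).2.
Qed.

Lemma rip_simple_integral w :
  rip w (simple_integral mu D g) = \int[mu]_(x in D) rip w (g x).
Proof.
rewrite (integrable_simple (rip0r ip w)).2 /simple_integral fsbig_finite// rip_sumr.
by apply: eq_bigr => v _; rewrite ripZr.
Qed.

End simple.

(** Measurability of the distance to each point replaces strong measurability: it is easy to check,
    and polarization turns it into measurability of [rip w (f x)]. *)
Definition norm_integrable (f : X -> H) :=
  (forall v, measurable_fun D (fun x => rnorm (f x - v))) /\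
  mu.-integrable D (fun x => (rnorm (f x))%:E).

Lemma norm_integrable_simple (g : {fimfun X >-> H}) : is_simple mu D g ->
  norm_integrable g.
Proof.
move=> gs; split => [v|]; first exact: (measurable_simple gs (fun u => rnorm (u - v))).
exact: (integrable_simple gs (@rnorm0 _ _ H)).1.
Qed.

(** Polarization: 2 <w, f> = |f|^2 + |w|^2 - |f - w|^2. *)
Lemma measurable_rip (f : X -> H) w :
  (forall v, measurable_fun D (fun x => rnorm (f x - v))) ->
  measurable_fun D (fun x => rip w (f x)).
Proof.
move=> mf; apply: (eq_measurable_fun (fun x => 2^-1 * (rnorm (f x - 0) ^+ 2 +
    rnorm w ^+ 2 - rnorm (f x - w) ^+ 2))).
  move=> x _; rewrite subr0 -!(rip_rnorm ip_norm) ripBl !ripBr (ripC ip (f x) w).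
  by field.
apply: measurable_funM => //; apply: measurable_funB; last exact: measurable_funX.
by apply: measurable_funD => //; exact: measurable_funX.
Qed.

Lemma integrable_rip (f : X -> H) w : norm_integrable f ->
  mu.-integrable D (fun x => (rip w (f x))%:E).
Proof.
move=> [mf nf]; apply: (le_integrable mD _ _ (integrableZl mD (rnorm w) nf)).
  exact/measurable_EFinP/measurable_rip.
move=> x Dx /=; rewrite lee_fin.
rewrite [leRHS]ger0_norm ?mulr_ge0 ?rnorm_ge0//; exact: rip_cauchy_schwarz.
Qed.

Lemma measurable_rnormB_simple (f : X -> H) (g : {fimfun X >-> H}) :
  (forall v, measurable_fun D (fun x => rnorm (f x - v))) -> is_simple mu D g ->
  measurable_fun D (fun x => rnorm (f x - g x)).
Proof.
move=> mf gs; apply: (eq_measurable_fun (fun x => \sum_(v <- fset_set (range g))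
    rnorm (f x - v) * \1_(D `&` g @^-1` [set v]) x)).
  by move=> x /[!inE] Dx; rewrite (simple_decomposition g (fun v => rnorm (f x - v))).
apply: measurable_sum => v; apply: measurable_funM => //.
apply: measurable_funTS; exact/measurable_indicP/measurable_simple_level.
Qed.

Lemma norm_rip_integral_le (f g : X -> H) w :
  norm_integrable f -> norm_integrable g ->
  measurable_fun D (fun x => rnorm (f x - g x)) ->
  (`|\int[mu]_(x in D) rip w (f x) - \int[mu]_(x in D) rip w (g x)|%:E <=
   (rnorm w)%:E * \int[mu]_(x in D) (rnorm (f x - g x))%:E)%E.
Proof.
move=> fi gi mfg; rewrite -RintegralB//; try exact: integrable_rip.
have ii : mu.-integrable D (fun x => (rip w (f x) - rip w (g x))%:E).
  under eq_fun do rewrite EFinB; apply: integrableB => //; exact: integrable_rip.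
rewrite EFin_normr_Rintegral//.
apply: le_trans (le_abse_integral mu mD _) _; first exact: measurable_int ii.
rewrite -ge0_integralZl_EFin//; first last.
- exact: rnorm_ge0.
- exact/measurable_EFinP.
- by move=> x _; rewrite lee_fin rnorm_ge0.
apply: ge0_le_integral => //.
- by apply: measurableT_comp => //; exact: measurable_int ii.
- apply/measurable_EFinP; apply: measurable_funM => //.
- by move=> x Dx; rewrite -EFinM lee_fin -ripBr rip_cauchy_schwarz.
Qed.

(** The identity is clear for simple functions and passes to the limit in L1. As [rip] separates
    vectors, the integral is therefore independent of the approximating sequence. *)
Lemma rip_bochner (f : X -> H) I w : norm_integrable f ->
  is_bochner_integral mu D f I -> rip w I = \int[mu]_(x in D) rip w (f x).
Proof.
move=> fi [g [gs _ g1 gI]].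
apply: (@cvg_unique _ _ (rip w (simple_integral mu D (g n)) @[n --> \oo])) => //.
  exact: cvg_rip.
apply/subr_cvg0/norm_cvg0P.
have /fine_cvgP[gfin g0] := g1.
apply: (@squeeze_cvgr _ _ _ _ (cst 0) (fun n => rnorm w *
    fine (\int[mu]_(x in D) (rnorm (f x - g n x))%:E)%E)).
- apply: filterS gfin => n gfin; rewrite normr_ge0 /= -lee_fin EFinM fineK//.
  rewrite (rip_simple_integral (gs _)) distrC.
  apply: norm_rip_integral_le => //; first exact: norm_integrable_simple.
  exact: (measurable_rnormB_simple fi.1 (gs n)).
- exact: cvg_cst.
- by rewrite -(mulr0 (rnorm w)); apply: cvgMr.
Qed.

(** Tested against [w], each simple integral is within |w| times its L1 error of the integral of <w,
    f>. Two of them thus differ in norm by at most the sum of their L1 errors, and completeness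
    gives the limit. *)
Lemma bochner_integrable_approx (f : X -> H) (g : nat -> {fimfun X >-> H}) :
  norm_integrable f -> (forall n, is_simple mu D (g n)) ->
  (forall x, D x -> g n x @[n --> \oo] --> f x) ->
  (\int[mu]_(x in D) (rnorm (f x - g n x))%:E)%E @[n --> \oo] --> 0%E ->
  bochner_integrable mu D f.
Proof.
move=> fi gs gf g1.
have [I gI] : exists I : H, simple_integral mu D (g n) @[n --> \oo] --> I.
  apply: cauchy_rnorm_cvg => e e0.
  have e2 : 0 < e / 2 by rewrite divr_gt0.
  have /fine_cvgP[gfin /cvgr0Pnorm_lt /(_ _ e2) gsmall] := g1.
  have [N _ hN] := filterI gfin gsmall.
  exists N => m n Nm Nn.
  have hle q : (N <= q)%N -> forall w,
      `|rip w (simple_integral mu D (g q)) - \int[mu]_(x in D) rip w (f x)| <=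
      rnorm w * fine (\int[mu]_(x in D) (rnorm (f x - g q x))%:E)%E.
    move=> Nq w; rewrite (rip_simple_integral (gs _)) distrC.
    have [fq _] := hN q Nq; rewrite -lee_fin EFinM fineK//.
    apply: norm_rip_integral_le => //; first exact: norm_integrable_simple.
    exact: (measurable_rnormB_simple fi.1 (gs q)).
  have small q : (N <= q)%N -> fine (\int[mu]_(x in D) (rnorm (f x - g q x))%:E)%E < e / 2.
    by move=> Nq; have [_] := hN q Nq; apply: le_lt_trans; exact: ler_norm.
  apply: (@le_lt_trans _ _ (fine (\int[mu]_(x in D) (rnorm (f x - g m x))%:E)%E +
    fine (\int[mu]_(x in D) (rnorm (f x - g n x))%:E)%E)).
    have p q : 0 <= fine (\int[mu]_(x in D) (rnorm (f x - g q x))%:E)%E.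
      by apply/fine_ge0/integral_ge0 => x _; rewrite lee_fin rnorm_ge0.
    apply: (rnorm_le_rip ip_norm); first exact: addr_ge0.
    move=> w; rewrite ripBr mulrC mulrDr.
    have := hle m Nm w; have := hle n Nn w; rewrite !ler_norml.
    move=> /andP[h1 h2] /andP[h3 h4]; lra.
  by have := small _ Nm; have := small _ Nn; lra.
by exists I, g; split => //; apply: aeW.
Qed.

Lemma rip_bochner_integral (f : X -> H) w : norm_integrable f ->
  bochner_integrable mu D f ->
  rip w (bochner_integral mu D f) = \int[mu]_(x in D) rip w (f x).
Proof.
by move=> fi fb; apply: rip_bochner => //; exact: xgetPex fb.
Qed.

End bochner.

(** * Bochner integrals of continuous functions on the half line *)

Section bochner_half_line.
Context (R : realType) (k : scalar_kind).
Local Notation K := (scalars R k).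
Context (H : completeNormedModType K) (ip : {dot H for @scalar_conj R k}).
Hypothesis ip_norm : forall u : H, ip u u = `|u| ^+ 2.

(** Only nonnegative arguments are compared, because [T w u] is unconstrained for negative [w]. *)
Definition continuous_ge0 (f : R -> H) :=
  forall x : R, 0 <= x -> forall e : R, 0 < e -> exists2 dl : R, 0 < dl &
    forall y : R, 0 <= y -> `|y - x| < dl -> rnorm (f y - f x) < e.

(** Composing with [Num.max x 0] gives a function continuous on the whole line that agrees with the
    original one on [D]. *)
Lemma measurable_continuous_ge0 (D : set R) (f : R -> H) v : measurable D ->
  D `<=` `[0, +oo[ -> continuous_ge0 f ->
  measurable_fun D (fun x => rnorm (f x - v)).
Proof.
move=> mD D0 cf.
apply: (eq_measurable_fun (fun x : R => rnorm (f (Num.max x 0) - v))).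
  move=> x /[!inE] /D0; rewrite /= in_itv /= andbT => x0.
  by rewrite max_l.
apply: measurable_funTS; apply: continuous_measurable_fun => x.
apply/cvgrPdist_lt => e e0.
have m0 : 0 <= Num.max x 0 by rewrite le_max lexx orbT.
have [dl dl0 hdl] := cf _ m0 _ e0.
near=> y; rewrite distrC; apply: le_lt_trans (ler_dist_rnorm _ _) _.
rewrite opprB addrA subrK; apply: hdl; first by rewrite le_max lexx orbT.
apply: (@le_lt_trans _ _ `|y - x|); last first.
  by rewrite distrC; near: y; exact: cvgr_dist_lt.
rewrite /Num.max; case: (ltP y 0) => y0; case: (ltP x 0) => x0; rewrite ?subrr ?normr0 ?normr_ge0//.
- by rewrite sub0r normrN [leLHS]ger0_norm// ler0_norm; lra.
- by rewrite subr0 [leLHS]ger0_norm// ger0_norm; lra.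
Unshelve. all: by end_near. Qed.

Section approximation.
Context (f : R -> H) (n : nat).

(** The argument is rounded down to a multiple of 1 / (n + 1). The value 0 for x >= n + 1 makes the
    range finite. *)
Definition grid_approx (x : R) : H :=
  let m := Num.truncn (x * n.+1%:R) in
  if (m < n.+1 * n.+1)%N then f (m%:R / n.+1%:R) else 0.

Lemma finite_range_grid_approx : finite_set (range grid_approx).
Proof.
apply: (@sub_finite_set _ _
  (0 |` ((fun m : nat => f (m%:R / n.+1%:R)) @` `I_(n.+1 * n.+1)))); last first.
  by rewrite finite_setU; split => //; exact: finite_image.
move=> _ [x _ <-]; rewrite /grid_approx; case: ifPn => h; last by left.
by right; exists (Num.truncn (x * n.+1%:R)).
Qed.

HB.instance Definition _ :=
  FiniteImage.Build R H grid_approx finite_range_grid_approx.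

Lemma truncn_grid_itv (x : R) : 0 <= x ->
  (Num.truncn (x * n.+1%:R))%:R / n.+1%:R <= x <
  (Num.truncn (x * n.+1%:R)).+1%:R / n.+1%:R.
Proof.
move=> x0; rewrite ler_pdivrMr// ltr_pdivlMr//.
by apply: truncn_itv; exact: mulr_ge0.
Qed.

End approximation.

Context (mu : {measure set R -> \bar R}) (D : set R).
Hypotheses (mD : measurable D) (D0 : D `<=` `[0, +oo[).
Context (f : R -> H) (g : R -> R).
Hypotheses (cf : continuous_ge0 f) (fg : forall x : R, 0 <= x -> rnorm (f x) <= g x).
Hypothesis nd_g : forall x y : R, 0 <= x -> x <= y -> g x <= g y.
Hypothesis ig : mu.-integrable D (EFin \o g).

Let D_ge0 x : D x -> 0 <= x.
Proof. by move=> /D0; rewrite /= in_itv /= andbT. Qed.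

Let mg : measurable_fun D g.
Proof. by apply/measurable_EFinP; exact: (measurable_int mu ig). Qed.

Lemma norm_integrable_continuous : norm_integrable mu D f.
Proof.
have mf v : measurable_fun D (fun x => rnorm (f x - v)).
  exact: measurable_continuous_ge0.
split => //; apply: (le_integrable mD _ _ ig) => [|x Dx].
  by apply/measurable_EFinP; have := mf 0; under eq_fun do rewrite subr0.
have x0 := D_ge0 Dx; have := fg x0; rewrite /= lee_fin ger0_norm ?rnorm_ge0//.
by move=> h; rewrite (le_trans h)// ler_norm.
Qed.

(** Rounding goes downwards and [g] is nondecreasing, so one function dominates all the
    approximations. *)
Lemma rnorm_grid_approx n x : 0 <= x -> rnorm (grid_approx f n x) <= g x.
Proof.
move=> x0; rewrite /grid_approx; case: ifPn => _; last first.
  by rewrite rnorm0; apply: le_trans (fg x0); exact: rnorm_ge0.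
have /andP[h _] := truncn_grid_itv n x0.
by apply: le_trans (fg _) (nd_g _ h); exact: divr_ge0.
Qed.

Lemma grid_approx_simple n : is_simple mu D (grid_approx f n).
Proof.
move=> v v0.
have mL : measurable (D `&` grid_approx f n @^-1` [set v]).
  rewrite (_ : _ `&` _ = D `&` \bigcup_(m in `I_(n.+1 * n.+1) `&`
      [set m | f (m%:R / n.+1%:R) = v]) `[m%:R / n.+1%:R, m.+1%:R / n.+1%:R[%classic).
    apply: measurableI => //; apply: fin_bigcup_measurable => //.
    exact: sub_finite_set (@subIsetl _ _ _) _.
  apply/seteqP; split => x /= [Dx].
    rewrite /grid_approx; case: ifPn => h; last by move=> /esym/eqP; rewrite (negbTE v0).
    move=> fv; split => //; exists (Num.truncn (x * n.+1%:R)) => //=.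
    by rewrite in_itv /=; exact: truncn_grid_itv (D_ge0 Dx).
  move=> [m /= [mn fm]]; rewrite in_itv /= ler_pdivrMr// ltr_pdivlMr// => hm.
  split => //; rewrite /grid_approx.
  suff -> : Num.truncn (x * n.+1%:R) = m by rewrite mn.
  exact: truncn_def.
split => //; rewrite ltey; apply/eqP => muL.
(* Markov's inequality: [mu] may be infinite, but a nonzero level has finite measure because the
   dominating [g] is integrable. *)
have : ((rnorm v)%:E * mu (D `&` grid_approx f n @^-1` [set v]) <=
    \int[mu]_(x in D) (g x)%:E)%E.
  have g0 x : D x -> (0 <= (g x)%:E)%E.
    by move=> Dx; rewrite lee_fin (le_trans _ (fg (D_ge0 Dx)))// rnorm_ge0.
  rewrite -integral_cst//.
  apply: (@le_trans _ _ (\int[mu]_(x in D `&` grid_approx f n @^-1` [set v]) (g x)%:E)%E).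
    apply: ge0_le_integral => //.
    - by move=> x _; rewrite lee_fin rnorm_ge0.
    - by apply/measurable_EFinP; apply: (measurable_funS mD _ mg) => ? [].
    - by move=> x [Dx] /= <-; rewrite lee_fin rnorm_grid_approx// D_ge0.
  by apply: ge0_subset_integral => //; exact/measurable_EFinP.
rewrite muL gt0_muley; last by rewrite lte_fin lt_def rnorm_eq0 v0 rnorm_ge0.
by rewrite leye_eq => /eqP h; have := integrable_lty mD ig; rewrite /= h.
Qed.

Lemma cvg_grid_approx x : 0 <= x -> grid_approx f n x @[n --> \oo] --> f x.
Proof.
move=> x0; apply/cvg_rnormP_lt => e /(cf x0)[dl dl0 hdl].
near=> n; rewrite /grid_approx.
have n0 : 0 < n.+1%:R :> R by [].
have /andP[h1 h2] := truncn_grid_itv n x0.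
rewrite ifT.
  apply: hdl; first exact: divr_ge0.
  rewrite ler0_norm ?subr_le0// opprB.
  apply: (@lt_trans _ _ n.+1%:R^-1).
    by move: h2; rewrite -natr1 mulrDl mul1r => h2; rewrite ltrBlDr addrC.
  by near: n; exact: near_infty_natSinv_lt (PosNum dl0).
rewrite -(ltr_nat R) natrM; move: h1; rewrite ler_pdivrMr// => h1.
apply: le_lt_trans h1 _; rewrite ltr_pM2r//.
apply: (@lt_le_trans _ _ n%:R); last by rewrite ler_nat.
by near: n; exact: nbhs_infty_gtr.
Unshelve. all: by end_near. Qed.

Lemma bochner_integrable_continuous : bochner_integrable mu D f.
Proof.
have fi := norm_integrable_continuous.
apply: (bochner_integrable_approx ip_norm mD fi
  (g := fun n => grid_approx f n : {fimfun R >-> H})) => //.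
- exact: grid_approx_simple.
- by move=> x Dx; exact: cvg_grid_approx (D_ge0 Dx).
have -> : (0%E : \bar R) = (\int[mu]_(x in D) (cst 0%E x))%E by rewrite integral0.
apply: (@dominated_cvg _ _ _ mu D mD _ _ (fun x => (2 * g x)%:E)).
- move=> n; apply/measurable_EFinP.
  exact: (measurable_rnormB_simple mD fi.1 (@grid_approx_simple n)).
- move=> x Dx; apply/fine_cvgP; split; first exact: nearW.
  have := cvg_grid_approx (D_ge0 Dx) => /cvg_rnormP.
  by under eq_fun do rewrite rnormB.
- by [].
- by under eq_fun do rewrite EFinM; exact: integrableZl.
- move=> n x Dx; have x0 := D_ge0 Dx.
  rewrite gee0_abs ?lee_fin ?rnorm_ge0//.
  apply: le_trans (ler_rnormB _ _) _.
  by have := fg x0; have := rnorm_grid_approx n x0; lra.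
Qed.

Lemma rip_bochner_continuous w :
  rip ip w (bochner_integral mu D f) = \int[mu]_(x in D) rip ip w (f x).
Proof.
apply: rip_bochner_integral => //; first exact: norm_integrable_continuous.
exact: bochner_integrable_continuous.
Qed.

End bochner_half_line.

Lemma ler_small (R : realType) (x y c : R) : 0 <= c ->
  (forall e, 0 < e -> x <= y + c * e) -> x <= y.
Proof.
move=> c0 h; apply/ler_addgt0Pr => e e0.
have c1 : 0 < c + 1 by lra.
apply: le_trans (h (e / (c + 1)) (divr_gt0 e0 c1)) _.
rewrite lerD2l mulrCA ger_pMr// ler_pdivrMr// mul1r; lra.
Qed.

(** * Contraction semigroups with self-adjoint generator *)

Section semigroup.
Context (R : realType) (k : scalar_kind).
Local Notation K := (scalars R k).
Context (H : completeNormedModType K) (ip : {dot H for @scalar_conj R k}).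
Hypothesis ip_norm : forall u : H, ip u u = `|u| ^+ 2.
Context (T : R -> H -> H) (hT : C0_semigroup T).
Local Notation rip := (rip ip).

Section linear.
Context (t : R) (t0 : 0 <= t).

Let lT : linear (T t). Proof. exact: (C0_bounded hT t0).1. Qed.

Lemma semigroupD u v : T t (u + v) = T t u + T t v.
Proof. by have := lT 1 u v; rewrite !scale1r. Qed.

Lemma semigroup0 : T t 0 = 0.
Proof. by have /eqP := semigroupD 0 0; rewrite addr0 addrC -subr_eq subrr => /eqP. Qed.

Lemma semigroupZ a u : T t (a *: u) = a *: T t u.
Proof. by have := lT a u 0; rewrite semigroup0 !addr0. Qed.

Lemma semigroupN u : T t (- u) = - T t u.
Proof. by rewrite -scaleN1r semigroupZ scaleN1r. Qed.

Lemma semigroupB u v : T t (u - v) = T t u - T t v.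
Proof. by rewrite semigroupD semigroupN. Qed.

Lemma semigroup_rscale a u : T t (rscale a u) = rscale a (T t u).
Proof. exact: semigroupZ. Qed.

End linear.

Lemma semigroupC s t u : 0 <= s -> 0 <= t -> T s (T t u) = T t (T s u).
Proof. by move=> s0 t0; rewrite -!(C0_add hT)// addrC. Qed.

(* If T (t _) takes a unit vector to one of norm more than 2 C / r, then within
   distance r of any x there is a ball on which T (t _) has norm at least C:
   one of x + u, x - u has an image at least as long as that of u. *)
Lemma semigroup_large_ball (t r C : R) x u : 0 <= t -> 0 < r -> 0 <= C ->
    (C + 1) / r * rnorm u < rnorm (T t u) ->
  exists x' r', [/\ 0 < r', r' <= r, rnorm (x' - x) <= r &
    forall y, rnorm (y - x') <= r' -> C <= rnorm (T t y)].
Proof.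
move=> t0 r0 C0 hu.
have u0 : 0 < rnorm u.
  rewrite lt_def rnorm_ge0 rnorm_eq0 andbT; apply: contraTneq hu => ->.
  by rewrite semigroup0// rnorm0 mulr0 ltxx.
pose v := rscale (r / rnorm u) u.
have nv : rnorm v = r.
  by rewrite rnorm_scale ger0_norm ?divr_ge0 ?rnorm_ge0 ?ltW// divfK ?gt_eqF.
have nTv : C + 1 <= rnorm (T t v).
  rewrite semigroup_rscale// rnorm_scale ger0_norm ?divr_ge0 ?rnorm_ge0 ?ltW//.
  by rewrite mulrAC ltr_pdivlMr// -ltr_pdivrMl// mulrCA mulrA.
have [x' [hx' hT']] : exists x', rnorm (x' - x) <= r /\ C + 1 <= rnorm (T t x').
  have [h|h] := leP (C + 1) (rnorm (T t (x + v))).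
    by exists (x + v); rewrite addrAC subrr add0r nv.
  exists (x - v); rewrite addrAC subrr add0r rnormN nv; split=> //.
  have : rnorm (T t v + T t v) <= rnorm (T t (x + v)) + rnorm (T t (x - v)).
    rewrite semigroupD// semigroupB//; apply: le_trans (ler_rnormB _ _).
    by rewrite opprB [_ + (_ - _)]addrC addrA subrK.
  rewrite (_ : T t v + T t v = rscale 2 (T t v)); last first.
    by rewrite /rscale rmorph_nat scaler_nat mulr2n.
  rewrite rnorm_scale ger0_norm//; lra.
have [_ [M hM]] := C0_bounded hT t0.
pose M' := `|M| + 1.
have M'0 : 0 < M' by rewrite ltr_wpDl.
exists x', (Num.min r M'^-1); split => //.
- by rewrite lt_min r0 invr_gt0.
- by rewrite ge_min lexx.
move=> y; rewrite le_min => /andP[_ hy].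
have : rnorm (T t x') <= rnorm (T t y) + rnorm (T t (y - x')).
  rewrite semigroupB// rnormB addrC.
  by have := ler_rnormD (T t x' - T t y) (T t y); rewrite subrK.
suff : rnorm (T t (y - x')) <= 1 by lra.
apply: le_trans (hM _) _; apply: (@le_trans _ _ (M' * rnorm (y - x'))).
  by rewrite ler_wpM2r ?rnorm_ge0// (le_trans (ler_norm M))// lerDl.
by rewrite mulrC -ler_pdivlMr// div1r.
Qed.

(* The uniform boundedness principle, by nested balls. *)
Lemma semigroup_locally_bounded : exists d M : R,
  [/\ 0 < d, 1 <= M & forall t u, 0 <= t <= d -> rnorm (T t u) <= M * rnorm u].
Proof.
apply: contrapT => unb.
(* Without a bound near time 0, the ball [p] contains the ball [q.1], at most half as large, on
   which [T q.2] has norm at least [n] for some time [q.2] <= 1 / (n + 1). The premise [0 < p.2]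
   stands under the quantifier so that [choice] yields a total function. *)
have bad (n : nat) (p : H * R) : exists q : (H * R) * R, 0 < p.2 ->
    [/\ 0 < q.1.2 <= p.2 / 2, rnorm (q.1.1 - p.1) <= p.2 / 2, 0 < q.2 <= n.+1%:R^-1 &
     forall y, rnorm (y - q.1.1) <= q.1.2 -> n%:R <= rnorm (T q.2 y)].
  have [p0|p0] := ltP 0 p.2; last by exists (p, 0).
  apply: contrapT => no; apply: unb.
  (* The second entry is the threshold of [semigroup_large_ball] at radius [p.2 / 2]; the first
     excludes [t = 0], where [T] is the identity. *)
  pose M := Num.max 1 ((n%:R + 1) / (p.2 / 2)).
  exists n.+1%:R^-1, M; split; rewrite ?invr_gt0// ?le_max ?lexx// => t u /andP[t0 tn].
  rewrite leNgt; apply/negP => hu; apply: no.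
  have p2 : 0 < p.2 / 2 by rewrite divr_gt0.
  have tp : 0 < t.
    rewrite lt_def t0 andbT; apply: contraTneq hu => ->.
    rewrite (C0_0 hT) -leNgt ler_peMl ?rnorm_ge0//.
    by rewrite le_max lexx.
  have [|x' [r' [r'0 r'r hx' hy]]] := @semigroup_large_ball t (p.2 / 2) n%:R p.1 u t0 p2 (ler0n _ _).
    by apply: le_lt_trans hu; rewrite ler_wpM2r ?rnorm_ge0// le_max lexx orbT.
  by exists ((x', r'), t); split => //=; rewrite ?r'0 ?tp.
have [F hF] := choice (fun np : nat * (H * R) => bad np.1 np.2).
pose fix s n : H * R := if n is m.+1 then (F (m, s m)).1 else (0, 1).
have s0 n : 0 < (s n).2.
  by elim: n => [|n IH] /=; [exact: ltr01 | have [/andP[]] := hF (n, s n) IH].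
have step n := hF (n, s n) (s0 n).
have shalf n : (s n).2 <= 2^-1 ^+ n.
  elim: n => [|n IH]; first by rewrite expr0.
  have [/andP[_ h] _ _ _] := step n; rewrite exprS mulrC.
  by apply: le_trans h _; rewrite ler_wpM2r.
have nest n m : (n <= m)%N -> rnorm ((s m).1 - (s n).1) + (s m).2 <= (s n).2.
  elim: m => [|m IH]; first by rewrite leqn0 => /eqP ->; rewrite subrr rnorm0 add0r.
  rewrite leq_eqVlt => /predU1P[->|]; first by rewrite subrr rnorm0 add0r.
  rewrite ltnS => /IH; have [/andP[_ h1] h2 _ _] := step m.
  have := ler_rnorm_dist (s m).1 (s m.+1).1 (s n).1; move: h1 h2 => /=; lra.
have [x hx] : exists x : H, (s n).1 @[n --> \oo] --> x.
  apply: cauchy_rnorm_cvg => e e0.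
  have : 2^-1 ^+ n @[n --> \oo] --> (0 : R).
    by apply: cvg_expr; rewrite ger0_norm ?invf_lt1// ltr1n.
  move=> /cvgr0Pnorm_lt /(_ (e / 2) (divr_gt0 e0 (ltr0n _ 2)))[N _ hN].
  exists N => m n Nm Nn.
  have := hN N (leqnn N); rewrite /= ger0_norm ?exprn_ge0// => hN'.
  have := nest _ _ Nm; have := nest _ _ Nn; have := s0 m; have := s0 n.
  have := shalf N; have := ler_rnorm_dist (s N).1 (s m).1 (s n).1.
  rewrite (rnormB (s N).1); lra.
have xin n : rnorm (x - (s n).1) <= (s n).2.
  have : rnorm ((s m).1 - (s n).1) @[m --> \oo] --> rnorm (x - (s n).1).
    by apply: cvg_rnorm; apply: cvgB => //; exact: cvg_cst.
  move=> /cvgr_to_le; apply.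
  exists n => // m /= nm; have := nest _ _ nm; have := s0 m; lra.
(* The common point [x] of the balls gives the contradiction: |T_t x| >= N at the [N]-th chosen
   time, whereas |T_t x| < |x| + 1 for small t > 0. *)
have /cvg_rnormP_lt /(_ 1 ltr01) := @C0_continuous _ _ _ _ hT x.
rewrite near_withinE => /nbhs_ballP[dl /= dl0 hdl].
have [N hN] : exists N : nat, N.+1%:R^-1 < dl /\ rnorm x + 1 < N%:R.
  near (\oo : set_system nat) => N; exists N; split; near: N.
    exact: (near_infty_natSinv_lt (PosNum dl0)).
  exact: nbhs_infty_gtr.
have [_ _ /andP[t0 tN]] := step N; move=> /(_ x (xin N.+1)).
have := hdl (F (N, s N)).2; rewrite /ball /= sub0r normrN ger0_norm ?(ltW t0)//.
move=> /(_ (le_lt_trans tN hN.1) t0).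
have := ler_rnormD (T (F (N, s N)).2 x - x) x; rewrite subrK.
move: hN => [_]; lra.
Unshelve. all: by end_near. Qed.


(** The bound on [[0, dl]] is iterated: [n] factors cover [[0, n * dl]]. *)
Lemma semigroup_bounded_on (t0 : R) : exists2 M : R, 0 <= M &
  forall t u, 0 <= t <= t0 -> rnorm (T t u) <= M * rnorm u.
Proof.
have [dl [M [dl0 M1 hM]]] := semigroup_locally_bounded.
have M0 : 0 <= M by lra.
have hk n t u : 0 <= t <= n%:R * dl -> rnorm (T t u) <= M ^+ n * rnorm u.
  elim: n t u => [|n IH] t u /andP[tge tle].
    have -> : t = 0 by apply: le_anti; rewrite tge andbT; rewrite mul0r in tle.
    by rewrite (C0_0 hT) mul1r.
  have [h|h] := leP t dl.
    apply: le_trans (hM _ _ _) _; first by rewrite tge.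
    by rewrite ler_wpM2r ?rnorm_ge0// exprS ler_peMr// exprn_ege1.
  rewrite (_ : t = dl + (t - dl)); last by ring.
  rewrite (C0_add hT) ?(ltW dl0)//; last by rewrite subr_ge0 ltW.
  apply: le_trans (hM _ _ _) _; first by rewrite ltW/=.
  rewrite exprS -mulrA ler_wpM2l//; apply: IH.
  by rewrite subr_ge0 ltW//= lerBlDr; move: tle; rewrite -natr1 mulrDl mul1r.
have [n hn] : exists n : nat, t0 / dl < n%:R.
  by exists (Num.truncn (t0 / dl)).+1; exact: truncnS_gt.
exists (M ^+ n); first exact: exprn_ge0.
move=> t u /andP[t00 tt]; apply: hk; rewrite t00 /=.
by apply: le_trans tt _; rewrite -ler_pdivrMr// ltW.
Qed.

(** * Contraction, symmetry and the limit at infinity *)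

Section self_adjoint_generator.
Context (D : set H) (A : H -> H).
Hypotheses (hA : self_adjoint ip D A) (hdiss : dissipative ip D A).
Hypothesis hgen : is_generator T D A.

Lemma generator_near u e : D u -> 0 < e -> exists2 dl : R, 0 < dl &
  forall h, 0 < h < dl -> rnorm (rscale h^-1 (T h u - u) - A u) < e.
Proof.
move=> Du e0; have [/(_ (conj Du erefl)) + _] := hgen u (A u).
move=> /cvg_rnormP_lt /(_ e e0); rewrite near_withinE => /nbhs_ballP[dl /= dl0 hdl].
exists dl => // h /andP[h0 hd]; apply: hdl => //.
by rewrite /ball /= sub0r normrN ger0_norm ?ltW.
Qed.

(** [T t] is bounded and commutes with the difference quotients that define [A u]. *)
Lemma generator_semigroup t u : 0 <= t -> D u -> D (T t u) /\ A (T t u) = T t (A u).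
Proof.
move=> t0 Du; apply/hgen; apply/cvg_rnormP_lt => e e0.
have [_ [M hM]] := C0_bounded hT t0.
have M1 : 0 < `|M| + 1 by rewrite ltr_wpDl.
have [dl dl0 hdl] := generator_near Du (divr_gt0 e0 M1).
rewrite near_withinE; apply/nbhs_ballP; exists dl => //= h.
rewrite /ball /= sub0r normrN => hd h0; rewrite ger0_norm ?ltW// in hd.
rewrite -/(rscale _ _) semigroupC ?(ltW h0)// -semigroupB// -semigroup_rscale// -semigroupB//.
apply: le_lt_trans (hM _) _; apply: (@le_lt_trans _ _ ((`|M| + 1) * rnorm (rscale h^-1 (T h u - u) - A u))).
  by rewrite ler_wpM2r ?rnorm_ge0// (le_trans (ler_norm M))// lerDl.
by rewrite -ltr_pdivlMl// mulrC; apply: hdl; rewrite h0.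
Qed.

Lemma generator_sym u v : D u -> D v -> rip (A u) v = rip u (A v).
Proof.
move=> Du Dv; have [_ _ /(_ v (A v))[+ _]] := hA.
by move=> /(_ (conj Dv erefl) u Du); rewrite /rip => ->.
Qed.

Lemma generator_le0 u : D u -> rip (A u) u <= 0.
Proof. by move=> /hdiss h; rewrite -oppr_ge0 -raddfN; apply: re_part_ge0; rewrite oppr_ge0. Qed.

(* One step of size h: T h a = a + h A a + h r' with r' = T (j h) r. *)
Lemma semigroup_step h (s : R) u : 0 < h -> 0 <= s -> D u ->
  T (s + h) u = T s u + rscale h (A (T s u) + T s (rscale h^-1 (T h u - u) - A u)).
Proof.
move=> h0 s0 Du; rewrite (C0_add hT) ?(ltW h0)// (generator_semigroup s0 Du).2.
rewrite -semigroupD// [A u + _]addrC subrK semigroup_rscale// rscaleA divff ?gt_eqF//.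
by rewrite rscale1 semigroupB// addrC subrK.
Qed.

(** With a = T_s u, a step of length h adds 2 h <a, z> + h^2 |z|^2 to |a|^2, where z is A a plus a
    small remainder. As <a, A a> <= 0, the increase is O(h e), and the steps add up to O(t e). *)
Lemma semigroup_contraction_dom t u : 0 <= t -> D u -> rnorm (T t u) <= rnorm u.
Proof.
move=> t0 Du; have [M M0 hM] := semigroup_bounded_on t.
rewrite -ler_sqr ?nnegrE ?rnorm_ge0//.
(* The first term bounds 2 <a, z>, up to the factor [e], through the remainder; the second bounds
   |z|^2, the factor [e] coming there from h < e. *)
pose c := 2 * M ^+ 2 * rnorm u + M ^+ 2 * (rnorm (A u) + 1) ^+ 2.
have c0 : 0 <= c.
  by apply: addr_ge0; apply: mulr_ge0; rewrite ?sqr_ge0 ?rnorm_ge0// mulr_ge0 ?sqr_ge0.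
apply: (@ler_small _ _ _ (t * c)); first exact: mulr_ge0.
move=> e e0; pose e' := Num.min e 1.
have e'0 : 0 < e' by rewrite lt_min e0 ltr01.
have [dl dl0 hdl] := generator_near Du e'0.
have [n hn] : exists n : nat, t / Num.min dl e' < n.+1%:R.
  by exists (Num.truncn (t / Num.min dl e')); exact: truncnS_gt.
have [->|tn0] := eqVneq t 0; first by rewrite (C0_0 hT) !mul0r addr0.
have tp : 0 < t by rewrite lt_def tn0.
pose h := t / n.+1%:R.
have h0 : 0 < h by exact: divr_gt0.
have hsmall : h < Num.min dl e'.
  by rewrite ltr_pdivrMr// mulrC -ltr_pdivrMr// lt_min dl0.
have hh : h < dl by move: hsmall; rewrite lt_min => /andP[].
have he' : h < e' by move: hsmall; rewrite lt_min => /andP[].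
pose r := rscale h^-1 (T h u - u) - A u.
have hr : rnorm r < e' by apply: hdl; rewrite h0.
have e'e : e' <= e by rewrite ge_min lexx.
have e'1 : e' <= 1 by rewrite ge_min lexx orbT.
suff steps j : (j <= n.+1)%N ->
    rnorm (T (j%:R * h) u) ^+ 2 <= rnorm u ^+ 2 + j%:R * h * (c * e).
  have := steps n.+1 (leqnn _); rewrite /h mulrC divfK//.
  by rewrite mulrA.
elim: j => [|j IH] jn; first by rewrite !mul0r (C0_0 hT) addr0.
have jh0 : 0 <= j%:R * h by rewrite mulr_ge0// ltW.
have jht : j%:R * h <= t.
  by rewrite mulrC /h mulrAC ler_pdivrMr// ler_wpM2l ?(ltW tp)// ler_nat ltnW.
rewrite -natr1 mulrDl mul1r semigroup_step//.
have [Da Aa] := generator_semigroup jh0 Du.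
set a := T (j%:R * h) u in IH Da Aa *; rewrite -/r.
set z := A a + _.
rewrite -(rip_rnorm ip_norm) ripDl !ripDr !ripZl !ripZr !(rip_rnorm ip_norm) (ripC ip z a).
have hz : rip a z <= M ^+ 2 * rnorm u * e.
  rewrite /z ripDr; have := generator_le0 Da; rewrite ripC => h1.
  have h2 : rip a (T (j%:R * h) r) <= (M * rnorm u) * (M * rnorm r).
    apply: le_trans (ler_rip ip_norm _ _) _.
    by apply: ler_pM; rewrite ?rnorm_ge0//; apply: hM; rewrite jh0.
  have h3 : (M * rnorm u) * (M * rnorm r) <= (M * rnorm u) * (M * e).
    rewrite ler_wpM2l ?mulr_ge0 ?rnorm_ge0// ler_wpM2l//; lra.
  rewrite expr2; lra.
have hz2 : rnorm z ^+ 2 <= M ^+ 2 * (rnorm (A u) + 1) ^+ 2.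
  rewrite -exprMn ler_sqr ?nnegrE ?rnorm_ge0//; last first.
    by rewrite mulr_ge0// addr_ge0// rnorm_ge0.
  rewrite /z Aa -semigroupD//; apply: le_trans (hM _ _ _) _; first by rewrite jh0.
  rewrite ler_wpM2l//; apply: le_trans (ler_rnormD _ _) _; lra.
rewrite /c in IH *.
have hz3 : h * rip a z <= h * (M ^+ 2 * rnorm u * e) by rewrite ler_pM2l.
have hz4 : h * (h * rnorm z ^+ 2) <= h * (e * (M ^+ 2 * (rnorm (A u) + 1) ^+ 2)).
  rewrite ler_pM2l//; apply: ler_pM => //; rewrite ?(ltW h0) ?sqr_ge0//; lra.
move: (IH (ltnW jn)) hz3 hz4; set q := (rnorm (A u) + 1) ^+ 2; lra.
Qed.

Lemma dense_near (u : H) (e : R) : 0 < e -> exists2 v, D v & rnorm (u - v) < e.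
Proof.
move=> e0; have [_ + _] := hA.
move=> /(_ (ball u (of_real k e)))[].
- exists u; apply: ballxx; by rewrite -(rmorph0 (@of_real R k)) ltr_of_real.
- by apply: ball_open; rewrite -(rmorph0 (@of_real R k)) ltr_of_real.
move=> v [uv Dv]; exists v => //.
by move: uv; rewrite -ball_normE /ball_ /= norm_rnorm ltr_of_real.
Qed.

(** Extension from the dense domain; the provisional constant [M] controls the image of the
    approximation error. *)
Lemma semigroup_contraction t u : 0 <= t -> rnorm (T t u) <= rnorm u.
Proof.
move=> t0; have [M M0 hM] := semigroup_bounded_on t.
apply: (@ler_small _ _ _ (M + 1)); first by rewrite addr_ge0.
move=> e /(dense_near u)[v Dv uv].
have h1 := semigroup_contraction_dom t0 Dv.
have h2 := hM t (u - v); rewrite t0 lexx in h2; have {}h2 := h2 isT.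
have h3 : M * rnorm (u - v) <= M * e by rewrite ler_wpM2l// ltW.
have := ler_rnormD (T t u - T t v) (T t v); rewrite subrK -semigroupB//.
have := ler_rnormD (v - u) u; rewrite subrK rnormB; lra.
Qed.

(** The time [t] is moved from [v] to [u] in steps of length [h]. Symmetry of [A] cancels the
    first-order change in each step, and the remainders add up to O(t e). The bound by 0 is the form
    on which [ler_small] acts. *)
Lemma semigroup_sym_dom t u v : 0 <= t -> D u -> D v ->
  `|rip (T t u) v - rip u (T t v)| <= 0.
Proof.
move=> t0 Du Dv.
apply: (@ler_small _ _ _ (t * (rnorm v + rnorm u))).
  by rewrite mulr_ge0// addr_ge0// rnorm_ge0.
move=> e e0; rewrite add0r.
have [d1 d10 hd1] := generator_near Du e0.
have [d2 d20 hd2] := generator_near Dv e0.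
have [n hn] : exists n : nat, t / Num.min d1 d2 < n.+1%:R.
  by exists (Num.truncn (t / Num.min d1 d2)); exact: truncnS_gt.
have [->|tn0] := eqVneq t 0; first by rewrite !(C0_0 hT) !mul0r subrr normr0.
have tp : 0 < t by rewrite lt_def tn0.
pose h := t / n.+1%:R.
have h0 : 0 < h by exact: divr_gt0.
have : h < Num.min d1 d2.
  by rewrite ltr_pdivrMr// mulrC -ltr_pdivrMr// lt_min d10.
rewrite lt_min => /andP[hh1 hh2].
have th : t = n.+1%:R * h by rewrite /h mulrC divfK.
pose r w := rscale h^-1 (T h w - w) - A w.
have hr1 : rnorm (r u) < e by apply: hd1; rewrite h0.
have hr2 : rnorm (r v) < e by apply: hd2; rewrite h0.
(* After [j] steps, [u] has been evolved for time [j * h] and [v] for the rest. *)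
have steps j : (j <= n.+1)%N ->
    `|rip (T (j%:R * h) u) (T ((n.+1 - j)%:R * h) v) - rip u (T t v)| <=
    j%:R * h * (rnorm v + rnorm u) * e.
  elim: j => [|j IH] jn.
    by rewrite subn0 -th !mul0r (C0_0 hT) subrr normr0.
  have {}IH := IH (ltnW jn).
  rewrite subSn// in IH.
  have -> : (n.+1 - j.+1)%N = (n - j)%N by rewrite subSS.
  have jh0 : 0 <= j%:R * h by rewrite mulr_ge0// ltW.
  have ih0 : 0 <= (n - j)%:R * h by rewrite mulr_ge0// ltW.
  have ej : j.+1%:R * h = j%:R * h + h by rewrite -natr1 mulrDl mul1r.
  rewrite -natr1 mulrDl mul1r semigroup_step// in IH.
  rewrite ej semigroup_step//.
  have [Da Aa] := generator_semigroup jh0 Du.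
  have [Db Ab] := generator_semigroup ih0 Dv.
  set a := T (j%:R * h) u in IH Da Aa *.
  set b := T ((n - j)%:R * h) v in IH Db Ab *.
  have h1 := rip_cauchy_schwarz ip_norm (T (j%:R * h) (r u)) b.
  have h2 := rip_cauchy_schwarz ip_norm a (T ((n - j)%:R * h) (r v)).
  rewrite -/(r u) in IH *; rewrite -/(r v) in IH *.
  move: IH; rewrite !ripDl !ripDr !ripZl !ripZr !ripDl !ripDr (generator_sym Da Db).
  set x := rip a b; set y := rip a (A b).
  set p := rip _ b in h1 *; set q := rip a _ in h2 *.
  have np : `|p| <= e * rnorm v.
    apply: le_trans h1 _; apply: ler_pM; rewrite ?rnorm_ge0 ?semigroup_contraction//.
    by apply: le_trans (semigroup_contraction _ jh0) _; exact: ltW.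
  have nq : `|q| <= rnorm u * e.
    apply: le_trans h2 _; apply: ler_pM; rewrite ?rnorm_ge0 ?semigroup_contraction//.
    by apply: le_trans (semigroup_contraction _ ih0) _; exact: ltW.
  move=> IH.
  have -> : x + h * (y + p) - rip u (T t v) =
     (x + h * (y + q) - rip u (T t v)) + h * (p - q) by ring.
  apply: le_trans (ler_normD _ _) _.
  have : `|h * (p - q)| <= h * (e * rnorm v + rnorm u * e).
    rewrite normrM gtr0_norm// ler_pM2l//.
    by apply: le_trans (ler_normB _ _) _; exact: lerD.
  move: IH; lra.
have := steps n.+1 (leqnn _); rewrite subnn mul0r (C0_0 hT) -th; apply: le_trans.
by rewrite lexx.
Qed.

Lemma semigroup_sym t u v : 0 <= t -> rip (T t u) v = rip u (T t v).
Proof.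
move=> t0; apply/eqP; rewrite -subr_eq0 -normr_le0.
apply: (@ler_small _ _ _ (2 * (rnorm u + rnorm v + 1))).
  by rewrite mulr_ge0// !addr_ge0// rnorm_ge0.
move=> e e0; rewrite add0r; pose e' := Num.min e 1.
have e'0 : 0 < e' by rewrite lt_min e0 ltr01.
have e'e : e' <= e by rewrite ge_min lexx.
have e'1 : e' <= 1 by rewrite ge_min lexx orbT.
have [u' Du uu] := dense_near u e'0.
have [v' Dv vv] := dense_near v e'0.
have := semigroup_sym_dom t0 Du Dv; rewrite normr_le0 subr_eq0 => /eqP hs.
have -> : rip (T t u) v - rip u (T t v) =
    (rip (T t (u - u')) v - rip (u - u') (T t v)) +
    (rip (T t u') (v - v') - rip u' (T t (v - v'))).
  by rewrite !semigroupB// !ripBl !ripBr hs; ring.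
have nu' : rnorm u' <= rnorm u + 1.
  by have := ler_rnormD (u' - u) u; rewrite subrK rnormB; lra.
have cs x y : `|rip (T t x) y - rip x (T t y)| <= 2 * (rnorm x * rnorm y).
  apply: le_trans (ler_normB _ _) _.
  have h1 := rip_cauchy_schwarz ip_norm (T t x) y.
  have h2 := rip_cauchy_schwarz ip_norm x (T t y).
  have h3 : rnorm (T t x) * rnorm y <= rnorm x * rnorm y.
    by rewrite ler_wpM2r ?rnorm_ge0// semigroup_contraction.
  have h4 : rnorm x * rnorm (T t y) <= rnorm x * rnorm y.
    by rewrite ler_wpM2l ?rnorm_ge0// semigroup_contraction.
  lra.
apply: le_trans (ler_normD _ _) _.
have h1 := cs (u - u') v; have h2 := cs u' (v - v').
have h3 : rnorm (u - u') * rnorm v <= e * rnorm v.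
  by rewrite ler_wpM2r ?rnorm_ge0//; lra.
have h4 : rnorm u' * rnorm (v - v') <= (rnorm u + 1) * e.
  by apply: ler_pM; rewrite ?rnorm_ge0//; lra.
lra.
Qed.

(** Telescoping over steps of length h: by contraction each contributes at most |T_h u - u| <= h (|A
    u| + e). *)
Lemma rnorm_semigroupB_le s u : 0 <= s -> D u -> rnorm (T s u - u) <= s * rnorm (A u).
Proof.
move=> s0 Du; apply: (ler_small s0) => e e0; rewrite -mulrDr.
have [dl dl0 hdl] := generator_near Du e0.
have [->|sn0] := eqVneq s 0; first by rewrite (C0_0 hT) subrr rnorm0 mul0r.
have sp : 0 < s by rewrite lt_def sn0.
have [n hn] : exists n : nat, s / dl < n.+1%:R.
  by exists (Num.truncn (s / dl)); exact: truncnS_gt.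
pose h := s / n.+1%:R.
have h0 : 0 < h by exact: divr_gt0.
have hh : h < dl by rewrite ltr_pdivrMr// mulrC -ltr_pdivrMr.
have hu : rnorm (T h u - u) <= h * (rnorm (A u) + e).
  rewrite -ler_pdivrMl// -[h^-1]ger0_norm ?invr_ge0 ?(ltW h0)// -rnorm_scale.
  have hr : rnorm (rscale h^-1 (T h u - u) - A u) < e by apply: hdl; rewrite h0.
  by have := ler_rnormD (rscale h^-1 (T h u - u) - A u) (A u); rewrite subrK; lra.
have steps j : rnorm (T (j%:R * h) u - u) <= j%:R * (h * (rnorm (A u) + e)).
  elim: j => [|j IH]; first by rewrite !mul0r (C0_0 hT) subrr rnorm0.
  rewrite -natr1 !mulrDl !mul1r.
  have jh0 : 0 <= j%:R * h by rewrite mulr_ge0// ltW.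
  rewrite (C0_add hT) ?(ltW h0)//.
  have := ler_rnorm_dist (T (j%:R * h) u) (T (j%:R * h) (T h u)) u.
  by rewrite -semigroupB//; have := semigroup_contraction (T h u - u) jh0; lra.
by have := steps n.+1; rewrite mulrA /h [n.+1%:R * _]mulrC divfK.
Qed.

Lemma rnorm_semigroupB_le2 s u : 0 <= s -> rnorm (T s u - u) <= 2 * rnorm u.
Proof.
by move=> s0; have := ler_rnormB (T s u) u; have := semigroup_contraction u s0; lra.
Qed.

Lemma semigroup_near0 u e : 0 < e -> exists2 dl : R, 0 < dl &
  forall s, 0 <= s < dl -> rnorm (T s u - u) < e.
Proof.
move=> e0; have /cvg_rnormP_lt /(_ e e0) := @C0_continuous _ _ _ _ hT u.
rewrite near_withinE => /nbhs_ballP[dl /= dl0 hdl].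
exists dl => // s /andP[s0 sd]; have [->|sn0] := eqVneq s 0.
  by rewrite (C0_0 hT) subrr rnorm0.
by apply: hdl; rewrite /= ?lt_def ?sn0// /ball /= sub0r normrN ger0_norm.
Qed.

Lemma semigroup_continuous u : continuous_ge0 (T ^~ u).
Proof.
move=> x x0 e /(semigroup_near0 u)[dl dl0 hdl]; exists dl => // y y0 yx.
wlog xy : x y x0 y0 yx / x <= y.
  move=> h; have [|/ltW] := leP x y; first exact: h.
  by rewrite rnormB; apply: h => //; rewrite distrC.
have -> : T y u = T x (T (y - x) u).
  by rewrite -(C0_add hT) ?subr_ge0// addrC subrK.
rewrite -semigroupB//.
apply: le_lt_trans (semigroup_contraction _ x0) _; apply: hdl.
by rewrite subr_ge0 xy /=; rewrite ger0_norm ?subr_ge0 in yx.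
Qed.

(* <T_w u, u> = |T_(w/2) u|^2 is nonincreasing in w, hence T_w u is Cauchy. *)
Lemma semigroup_limit u : exists p : H, forall e : R, 0 < e ->
  exists W : R, forall w, 0 <= w -> W <= w -> rnorm (T w u - p) < e.
Proof.
pose rho := [set rnorm (T w u) ^+ 2 | w in [set w : R | 0 <= w]].
have hinf : has_inf rho.
  split; first by exists (rnorm (T 0 u) ^+ 2), 0 => //=.
  by exists 0 => _ [w _ <-]; exact: sqr_ge0.
have infle w : 0 <= w -> inf rho <= rnorm (T w u) ^+ 2.
  by move=> w0; apply: ge_inf; [exact: hinf.2 | exists w].
have mono (w w' : R) : 0 <= w -> w <= w' -> rnorm (T w' u) ^+ 2 <= rnorm (T w u) ^+ 2.
  move=> w0 ww; rewrite ler_sqr ?nnegrE ?rnorm_ge0//.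
  rewrite -(subrK w w') (C0_add hT) ?subr_ge0//.
  by rewrite semigroup_contraction ?subr_ge0.
have cauchy (e : R) : 0 < e -> exists2 N : R, 0 <= N & forall w, N <= w ->
    rnorm (T w u - T N u) < e.
  move=> e0; have e2 : 0 < e ^+ 2 / 2 by rewrite divr_gt0// exprn_gt0.
  have [_ [N /= N0 <-] hN] := inf_adherent e2 hinf.
  exists N => // w Nw; rewrite -ltr_sqr ?nnegrE ?rnorm_ge0 ?(ltW e0)//.
  (* By symmetry the square is |T_w u|^2 + |T_N u|^2 - 2 |T_{(w+N)/2} u|^2. The first two terms are
     below inf + e^2 / 2 and the last square is at least inf. *)
  rewrite -(rip_rnorm ip_norm) ripBl !ripBr (ripC ip (T N u)) !(rip_rnorm ip_norm).
  have d0 : 0 <= (w - N) / 2 by rewrite divr_ge0// subr_ge0.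
  have s0 : 0 <= (w + N) / 2 by rewrite divr_ge0// addr_ge0//; lra.
  have -> : rip (T w u) (T N u) = rnorm (T ((w + N) / 2) u) ^+ 2.
    rewrite -(rip_rnorm ip_norm).
    have {1}-> : w = (w - N) / 2 + (w + N) / 2 by field.
    rewrite (C0_add hT)// semigroup_sym// -(C0_add hT)//.
    by congr (rip _ (T _ _)); field.
  have := infle _ s0; have := mono _ _ N0 Nw; lra.
have [p hp] : exists p : H, T n%:R u @[n --> \oo] --> p.
  apply: cauchy_rnorm_cvg => e e0.
  have [N N0 hN] := cauchy _ (divr_gt0 e0 (ltr0n _ 2)).
  exists (Num.truncn N).+1 => m n Nm Nn.
  have big l : ((Num.truncn N).+1 <= l)%N -> N <= l%:R.
    by move=> Nl; apply: le_trans (ltW (truncnS_gt N)) _; rewrite ler_nat.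
  have := hN _ (big _ Nm); have := hN _ (big _ Nn).
  have := ler_rnorm_dist (T N u) (T m%:R u) (T n%:R u).
  rewrite (rnormB (T N u)); lra.
exists p => e e0; have e3 : 0 < e / 3 by rewrite divr_gt0.
have [N N0 hN] := cauchy _ e3.
move/cvg_rnormP_lt : hp => /(_ _ e3) hp.
exists N => w w0 Nw.
near (\oo : set_system nat) => n.
have h1 : rnorm (T n%:R u - p) < e / 3 by near: n.
have h2 : N <= n%:R by apply/ltW; near: n; exact: nbhs_infty_gtr.
have h3 := hN _ Nw; have h4 := hN _ h2.
have := ler_rnorm_dist (T N u) (T w u) p.
have := ler_rnorm_dist (T n%:R u) (T N u) p.
rewrite (rnormB (T N u) (T n%:R u)); lra.
Unshelve. all: by end_near. Qed.

End self_adjoint_generator.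

End semigroup.

(** * Bernstein polynomials *)

Section bernstein.
Context (R : realType).

(* The probability that a binomial variable with parameters N and x equals k,
   as a polynomial in x. *)
Fixpoint bernstein (N k : nat) : {poly R} :=
  match N with
  | 0%N => (k == 0%N)%:R
  | M.+1 => 'X * (if k is j.+1 then bernstein M j else 0) + (1 - 'X) * bernstein M k
  end.

Lemma bernstein_gt N k : (N < k)%N -> bernstein N k = 0.
Proof.
elim: N k => [|N IH] [|k] //= Nk; rewrite !IH ?mulr0 ?addr0//.
exact: ltnW.
Qed.

Lemma horner_bernsteinS N k (x : R) : (bernstein N.+1 k).[x] =
  x * (if k is j.+1 then (bernstein N j).[x] else 0) + (1 - x) * (bernstein N k).[x].
Proof. by rewrite /= !hornerE; case: k => [|k]; rewrite ?horner0. Qed.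

Lemma bernstein_ge0 N k (x : R) : 0 <= x <= 1 -> 0 <= (bernstein N k).[x].
Proof.
move=> /andP[x0 x1]; elim: N k => [|N IH] k; first by rewrite /= -polyC_natr hornerC.
rewrite horner_bernsteinS addr_ge0 ?mulr_ge0 ?subr_ge0//.
by case: k.
Qed.

Lemma bernstein1 N k : (k <= N)%N -> (bernstein N k).[1] = (k == N)%:R.
Proof.
elim: N k => [|N IH] k; first by rewrite /= -polyC_natr hornerC.
rewrite horner_bernsteinS subrr mul0r addr0 mul1r.
by case: k => [|k] kN //; rewrite IH.
Qed.

(** Conditioning a binomial variable on one of its trials. *)
Lemma bernstein_mean_rec N (x : R) (f : nat -> R) :
  \sum_(k < N.+2) (bernstein N.+1 k).[x] * f k =
  x * (\sum_(k < N.+1) (bernstein N k).[x] * f k.+1) +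
  (1 - x) * \sum_(k < N.+1) (bernstein N k).[x] * f k.
Proof.
have -> : \sum_(k < N.+1) (bernstein N k).[x] * f k =
    \sum_(k < N.+2) (bernstein N k).[x] * f k.
  by rewrite [RHS]big_ord_recr /= bernstein_gt// horner0 mul0r addr0.
rewrite [in LHS]big_ord_recl [X in _ + (1 - x) * X]big_ord_recl mulrDr.
rewrite horner_bernsteinS mulr0 add0r addrCA -mulrA; congr (_ + _).
rewrite !mulr_sumr -big_split /=.
by apply: eq_bigr => i _; rewrite /bump /= add1n -/(bernstein N.+1 i.+1) horner_bernsteinS; ring.
Qed.

Lemma sum_bernstein N (x : R) : \sum_(k < N.+1) (bernstein N k).[x] = 1.
Proof.
elim: N => [|N IH]; first by rewrite big_ord1 /= -polyC_natr hornerC.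
have := bernstein_mean_rec N x (fun=> 1).
under eq_bigr do rewrite mulr1; move=> ->.
by under eq_bigr do rewrite mulr1; rewrite IH; ring.
Qed.

(** The centre [c] is left free because the recursion shifts it: (k + 1) - c = k - (c - 1). *)
Lemma variance_bernstein N (x c : R) :
  \sum_(k < N.+1) (bernstein N k).[x] * (k%:R - c) ^+ 2 =
  N%:R * (x * (1 - x)) + (N%:R * x - c) ^+ 2.
Proof.
elim: N c => [|N IH] c.
  by rewrite big_ord1 /= -polyC_natr hornerC; ring.
rewrite (bernstein_mean_rec N x (fun k => (k%:R - c) ^+ 2)) IH.
under eq_bigr => k _ do rewrite -natr1 -addrA -[1 - c]opprB.
by rewrite IH -natr1; ring.
Qed.

End bernstein.

(** * Uniform approximation of vector-valued functions *)

Section bernstein_approximation.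
Context (R : realType) (k : scalar_kind).
Local Notation K := (scalars R k).
Context (H : completeNormedModType K).

Section unit_interval.
Context (G : R -> H).
Hypothesis cG : forall x, 0 <= x <= 1 -> forall e : R, 0 < e -> exists2 dl : R, 0 < dl &
  forall y, 0 <= y <= 1 -> `|y - x| < dl -> rnorm (G y - G x) < e.

Let cover : near_covering (`[0, 1]%classic : set R).
Proof. exact/compact_near_coveringP/segment_compact. Qed.

Lemma bounded_unit_interval : exists M : R, forall x, 0 <= x <= 1 -> rnorm (G x) <= M.
Proof.
have : \forall M \near +oo%R, `[0, 1]%classic `<=` [set x | 0 <= x <= 1 -> rnorm (G x) < M].
  apply: cover => x /=; rewrite in_itv /= => x01.
  have [dl dl0 hdl] := cG x01 ltr01.
  near=> y M => /= y01.
  have yx : rnorm (G y - G x) < 1.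
    by apply: hdl => //; rewrite distrC; near: y; exact: nbhsx_ballx.
  have hM : rnorm (G x) + 1 < M by near: M; apply: nbhs_pinfty_gt; exact: num_real.
  by have := ler_rnormD (G y - G x) (G x); rewrite subrK; lra.
move=> /pinfty_ex_gt0[M _ hM]; by exists M => x x01; apply/ltW/hM.
Unshelve. all: by end_near. Qed.

Lemma uniformly_continuous_unit_interval e : 0 < e -> exists2 dl : R, 0 < dl &
  forall x y, 0 <= x <= 1 -> 0 <= y <= 1 -> `|y - x| < dl -> rnorm (G y - G x) < e.
Proof.
move=> e0.
have : \forall dl \near (0 : R)^'+, `[0, 1]%classic `<=` [set x | 0 <= x <= 1 ->
    forall y, 0 <= y <= 1 -> `|y - x| < dl -> rnorm (G y - G x) < e].
  apply: cover => x /=; rewrite in_itv /= => x01.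
  have [dl dl0 hdl] := cG x01 (divr_gt0 e0 (ltr0n _ 2)).
  near=> z d => /= z01 y y01 yz.
  have zx : `|z - x| < dl / 2.
    by rewrite distrC; near: z; apply: nbhsx_ballx; rewrite divr_gt0.
  have d2 : d < dl / 2 by near: d; apply: nbhs_right_lt; rewrite divr_gt0.
  have h1 : rnorm (G z - G x) < e / 2 by apply: hdl => //; lra.
  have h2 : rnorm (G y - G x) < e / 2.
    by apply: hdl => //; have := ler_normD (y - z) (z - x); rewrite addrA subrK; lra.
  by have := ler_rnorm_dist (G x) (G y) (G z); rewrite (rnormB (G x) (G z)); lra.
move=> h; near (0 : R)^'+ => dl; exists dl; first by near: dl; exact: nbhs_right_gt.
have hdl : `[0, 1]%classic `<=` [set x | 0 <= x <= 1 ->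
    forall y, 0 <= y <= 1 -> `|y - x| < dl -> rnorm (G y - G x) < e] by near: dl.
by move=> x y x01; apply: hdl => //=; rewrite in_itv.
Unshelve. all: by end_near. Qed.

(** Bernstein's proof: uniform continuity handles the nodes within [dl] of [x], and Chebyshev's
    inequality those farther away. *)
Lemma bernstein_approx e : 0 < e -> exists2 N : nat, (0 < N)%N & forall x, 0 <= x <= 1 ->
  rnorm (G x - \sum_(j < N.+1) rscale (bernstein R N j).[x] (G (j%:R / N%:R))) <= e.
Proof.
move=> e0; have e2 : 0 < e / 2 by rewrite divr_gt0.
have [M hM] := bounded_unit_interval.
have M0 : 0 <= M by apply: le_trans (hM 0 _); rewrite ?rnorm_ge0// lexx ler01.
have [dl dl0 hdl] := uniformly_continuous_unit_interval e2.
(* The variance N x (1 - x) is at most N, so the far nodes contribute at most 2 M / (dl^2 N). *)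
have [N [N0 hN]] : exists N : nat, (0 < N)%N /\ 2 * M / dl ^+ 2 / (e / 2) < N%:R.
  exists (Num.truncn (2 * M / dl ^+ 2 / (e / 2))).+1; split => //.
  exact: truncnS_gt.
have NR : 0 < N%:R :> R by rewrite ltr0n.
exists N => // x x01.
have -> : G x = \sum_(j < N.+1) rscale (bernstein R N j).[x] (G x).
  rewrite /rscale -scaler_suml -rmorph_sum sum_bernstein rmorph1.
  by rewrite scale1r.
rewrite -sumrB; apply: le_trans (ler_rnorm_sum _ _) _.
have bound (j : 'I_N.+1) : rnorm (rscale (bernstein R N j).[x] (G x) -
      rscale (bernstein R N j).[x] (G (j%:R / N%:R))) <=
    (bernstein R N j).[x] * (e / 2) +
    2 * M / dl ^+ 2 / N%:R ^+ 2 * ((bernstein R N j).[x] * (j%:R - N%:R * x) ^+ 2).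
  rewrite -rscaleBr rnorm_scale ger0_norm ?bernstein_ge0//.
  rewrite (mulrCA _ (bernstein R N j).[x]) -mulrDr ler_wpM2l ?bernstein_ge0//.
  have jN : 0 <= (j%:R / N%:R : R) <= 1.
    by rewrite divr_ge0//= ler_pdivrMr// mul1r ler_nat -ltnS.
  have [h|h] := ltP `|x - j%:R / N%:R| dl.
    have := hdl _ _ jN x01 h => h1; apply: ltW; apply: (lt_le_trans h1).
    by rewrite lerDl mulr_ge0 ?sqr_ge0// !divr_ge0 ?sqr_ge0// mulr_ge0.
  apply: (@le_trans _ _ (2 * M)).
    by have := ler_rnormB (G x) (G (j%:R / N%:R)); have := hM _ x01; have := hM _ jN; lra.
  rewrite -[leLHS]add0r lerD ?(ltW e2)//.
  have -> : j%:R - N%:R * x = - (N%:R * (x - j%:R / N%:R)) by field; rewrite gt_eqF.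
  rewrite sqrrN exprMn mulrA divfK ?expf_neq0 ?gt_eqF// mulrAC ler_pdivlMr ?exprn_gt0//.
  rewrite ler_wpM2l ?mulr_ge0// -[leRHS]real_normK ?num_real//.
  by rewrite ler_sqr ?nnegrE ?normr_ge0 ?(ltW dl0).
apply: le_trans (ler_sum _ (fun j _ => bound j)) _.
rewrite big_split /= -mulr_suml sum_bernstein mul1r -mulr_sumr variance_bernstein.
rewrite subrr expr0n addr0.
suff : 2 * M / dl ^+ 2 / N%:R ^+ 2 * (N%:R * (x * (1 - x))) <= e / 2 by lra.
have -> : 2 * M / dl ^+ 2 / N%:R ^+ 2 * (N%:R * (x * (1 - x))) =
   2 * M / dl ^+ 2 / N%:R * (x * (1 - x)).
  by field; rewrite !gt_eqF.
have c0 : 0 <= 2 * M / dl ^+ 2 / N%:R by rewrite !divr_ge0 ?sqr_ge0// mulr_ge0.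
apply: (@le_trans _ _ (2 * M / dl ^+ 2 / N%:R * 1)).
  by rewrite ler_wpM2l//; move: x01 => /andP[x0 x1]; nra.
rewrite mulr1 ler_pdivrMr// [leRHS]mulrC -ler_pdivrMr//; exact: ltW.
Qed.

End unit_interval.

Section half_line.
Context (F : R -> H) (p : H).
Hypotheses (cF : continuous_ge0 F).
Hypothesis Fp : forall e : R, 0 < e ->
  exists W : R, forall w, 0 <= w -> W <= w -> rnorm (F w - p) < e.

(** The node j = N is x = 1, that is w = 0. Recording its coefficient later separates the drift from
    the jumps. *)
Lemma bernstein_approx_exp e : 0 < e ->
  exists N : nat, exists2 c : nat -> H, c N = F 0 & forall w, 0 <= w ->
    rnorm (F w - \sum_(j < N.+1) rscale (bernstein R N j).[expR (- w)] (c j)) <= e.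
Proof.
(* The limit [p] at infinity is what makes [G] continuous at 0. *)
pose G x := if 0 < x then F (- ln x) else p.
have lnN x : 0 < x <= 1 -> 0 <= - ln x :> R.
  by move=> /andP[x0 x1]; rewrite oppr_ge0 ln_le0.
have cG x : 0 <= x <= 1 -> forall e : R, 0 < e -> exists2 dl : R, 0 < dl &
    forall y, 0 <= y <= 1 -> `|y - x| < dl -> rnorm (G y - G x) < e.
  move=> /andP[x0 x1] {}e e0; rewrite /G; have [xp|] := ltP 0 x; last first.
    move=> xle; have -> : x = 0 by apply: le_anti; rewrite x0 xle.
    have [W hW] := Fp e0; exists (expR (- W)); first exact: expR_gt0.
    move=> y /andP[y0 y1]; rewrite subr0 ger0_norm// => yW.
    have [yp|_] := ltP 0 y; last by rewrite subrr rnorm0.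
    apply: hW; first by apply: lnN; rewrite yp.
    by rewrite lerNr; apply/ltW; rewrite -ltr_expR lnK.
  have [dl dl0 hdl] := cF (lnN x (andb_true_intro (conj xp x1))) e0.
  have /cvgrPdist_lt /(_ dl dl0) := continuous_ln xp.
  move=> /nbhs_ballP[d /= d0 hd].
  exists (Num.min d x); first by rewrite lt_min d0.
  move=> y /andP[y0 y1]; rewrite lt_min => /andP[yd yx].
  have yp : 0 < y by move: yx; rewrite ltr_norml; lra.
  rewrite yp; apply: hdl; first by apply: lnN; rewrite yp.
  rewrite opprK addrC; apply: hd.
  by rewrite /ball /= distrC.
move=> e0; have [N N0 hN] := bernstein_approx cG e0.
exists N, (fun j => G (j%:R / N%:R)).
  by rewrite divff ?pnatr_eq0 ?gt_eqF// /G ltr01 ln1 oppr0.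
move=> w w0; have := hN (expR (- w)).
rewrite /G expR_gt0 expRK opprK; apply.
by rewrite expR_ge0 expR_le1 oppr_le0.
Qed.

End half_line.

End bernstein_approximation.

(** * Exponential moments of Poisson sums *)

Section independence.
Context (R : realType).

(* q ^ x for x in {0, 1, 2, ..., +oo}, with value 0 at +oo. *)
Definition geometric_weight (q : R) (x : \bar R) : \bar R :=
  (\sum_(m <oo) (q ^+ m)%:E * (\1_[set m%:R%:E] x)%:E)%E.

Section geometric_weight.
Context (q : R) (q0 : 0 <= q).

Lemma geometric_weight_nat m : geometric_weight q m%:R%:E = (q ^+ m)%:E.
Proof.
rewrite /geometric_weight (@nneseriesD1 _ _ m xpredT)//; last first.
  by move=> j _; rewrite mule_ge0// lee_fin exprn_ge0.
rewrite eseries0 => [|j _ /= jm].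
  by rewrite adde0 indicE mem_set// mule1.
by rewrite indicE memNset ?mule0// => -[/eqP]; rewrite eqr_nat eq_sym (negbTE jm).
Qed.

Lemma geometric_weight_not_nat x : (forall m : nat, x <> m%:R%:E) ->
  geometric_weight q x = 0%E.
Proof.
move=> xm; apply: eseries0 => j _ _.
by rewrite indicE memNset ?mule0// => /xm.
Qed.

Lemma geometric_weight_ge0 x : (0 <= geometric_weight q x)%E.
Proof.
apply: nneseries_ge0 => m _ _.
by rewrite mule_ge0// lee_fin exprn_ge0.
Qed.

Lemma geometric_weight_le1 x : q <= 1 -> (geometric_weight q x <= 1)%E.
Proof.
move=> q1; have [[m ->]|xm] := pselect (exists m : nat, x = m%:R%:E).
  by rewrite geometric_weight_nat lee_fin exprn_ile1.
rewrite geometric_weight_not_nat ?lee01// => m xE.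
by apply: xm; exists m.
Qed.

Lemma measurable_geometric_weight : measurable_fun [set: \bar R] (geometric_weight q).
Proof.
apply: (@ge0_emeasurable_sum _ _ _ _
    (fun m x => (q ^+ m)%:E * (\1_[set m%:R%:E] x)%:E)%E xpredT) => [m x _ _|m _].
  by rewrite mule_ge0// lee_fin exprn_ge0.
apply: emeasurable_funM => //; apply/measurable_EFinP.
exact/measurable_indicP/emeasurable_set1.
Qed.

End geometric_weight.

Context (d : measure_display) (Omega : measurableType d) (P : probability Omega R).
Context (n : nat) (N : 'I_n -> Omega -> \bar R) (q : 'I_n -> R).
Hypothesis mN : forall i, measurable_fun [set: Omega] (N i).
Hypothesis q01 : forall i, 0 <= q i <= 1.
Hypothesis indep : forall C : 'I_n -> set (\bar R), (forall i, measurable (C i)) ->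
  P [set w | forall i, C i (N i w)] = (\prod_(i < n) P [set w | C i (N i w)])%E.

(** This interpolates between the independence hypothesis, at k = 0, and the claim on weights, at k
    = n. The sets [C] stay arbitrary, since the induction changes them. *)
Let mixed (k : nat) (C : 'I_n -> set (\bar R)) (i : 'I_n) (x : \bar R) : \bar R :=
  if (i < k)%N then geometric_weight (q i) x else (\1_(C i) x)%:E.

Let mixed_ge0 k C i x : (0 <= mixed k C i x)%E.
Proof.
have /andP[q0 _] := q01 i.
by rewrite /mixed; case: ifP => _; [exact: geometric_weight_ge0 | rewrite lee_fin].
Qed.

Let mixed_le1 k C i x : (mixed k C i x <= 1)%E.
Proof.
have /andP[q0 q1] := q01 i.
rewrite /mixed; case: ifP => _; first exact: geometric_weight_le1.
by rewrite lee_fin indicE; case: (_ \in _).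
Qed.

Let measurable_mixed k C i : (forall i, measurable (C i)) ->
  measurable_fun [set: Omega] (fun w => mixed k C i (N i w)).
Proof.
move=> mC; apply: (@measurableT_comp _ _ _ _ _ _ (mixed k C i)) => //.
have /andP[q0 _] := q01 i.
rewrite /mixed; case: (i < k)%N; first exact: measurable_geometric_weight.
exact/measurable_EFinP/measurable_indicP.
Qed.

Let integral_mixed_fin k C i : (forall i, measurable (C i)) ->
  (\int[P]_w mixed k C i (N i w))%E \is a fin_num.
Proof.
move=> mC; rewrite ge0_fin_numE; last by apply: integral_ge0.
apply: (@le_lt_trans _ _ (\int[P]_w (cst 1%E w))%E).
  by apply: ge0_le_integral => //; exact: measurable_mixed.
by rewrite integral_cst//= probability_setT mule1 ltry.
Qed.

(* Replacing the indicators by the weights one coordinate at a time; a weight is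
   a countable sum of indicators. *)
Let expectation_prod_mixed k C : (k <= n)%N -> (forall i, measurable (C i)) ->
  (\int[P]_w \prod_(i < n) mixed k C i (N i w) =
   \prod_(i < n) \int[P]_w mixed k C i (N i w))%E.
Proof.
elim: k C => [|k IH] C kn mC.
  rewrite /mixed /=.
  transitivity (\int[P]_w (\1_[set w | forall i, C i (N i w)] w)%:E)%E.
    apply: eq_integral => w _.
    have [h|h] := pselect (forall i, C i (N i w)).
      rewrite indicE mem_set// big1// => i _.
      by rewrite indicE mem_set//; exact: h.
    rewrite indicE memNset//; move/existsNP : h => [i hi].
    by rewrite (bigD1 i)//= indicE memNset// mul0e.
  rewrite integral_indic//; last first.
    rewrite (_ : [set w | _] = \bigcap_(i in [set: 'I_n]) (N i @^-1` C i)).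
      apply: fin_bigcap_measurable => // i _.
      by rewrite -[X in measurable X]setTI; exact: mN.
    by apply/seteqP; split => w /= h i; [move=> _ | ]; exact: h.
  rewrite setIT; apply: etrans (indep mC) _; apply: eq_bigr => i _.
  transitivity (\int[P]_w (\1_(N i @^-1` C i) w)%:E)%E.
    rewrite integral_indic ?setIT//.
    by rewrite -[X in measurable X]setTI; exact: mN.
  by apply: eq_integral => w _; rewrite !indicE; congr ((_ : bool)%:R%:E);
    apply/idP/idP => /set_mem h; apply/mem_set.
pose i0 : 'I_n := Ordinal kn.
have /andP[q0 q1] := q01 i0.
(* Expanding the weight of coordinate [k] into indicators of singletons leaves products with only
   [k] weights, to which the induction hypothesis applies with these sets. *)
pose Cm m (i : 'I_n) := if i == i0 then [set m%:R%:E] else C i.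
have mCm m i : measurable (Cm m i).
  by rewrite /Cm; case: ifP => _; [exact: emeasurable_set1 | exact: mC].
have mixE m i x : i != i0 -> mixed k.+1 C i x = mixed k (Cm m) i x.
  move=> ii; rewrite /mixed ltnS leq_eqVlt /Cm (negbTE ii).
  by rewrite (_ : (i == k :> nat) = false)//; apply/negbTE.
have mix0 m x : mixed k (Cm m) i0 x = (\1_[set m%:R%:E] x)%:E.
  by rewrite /mixed ltnn /Cm eqxx.
have mix1 x : mixed k.+1 C i0 x =
    (\sum_(m <oo) (q i0 ^+ m)%:E * mixed k (Cm m) i0 x)%E.
  rewrite {1}/mixed ltnSn; apply: eq_eseriesr => m _.
  by rewrite mix0.
pose c := (\prod_(i < n | i != i0) \int[P]_w mixed k.+1 C i (N i w))%E.
have cE m : c = (\prod_(i < n | i != i0) \int[P]_w mixed k (Cm m) i (N i w))%E.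
  apply: eq_bigr => i ii; apply: eq_integral => w _; exact: mixE.
have cfin : c \is a fin_num.
  rewrite /c; elim/big_ind: _ => // [x y|i _]; first exact: fin_numM.
  exact: integral_mixed_fin.
have mprod m : measurable_fun [set: Omega]
    (fun w => \prod_(i < n) mixed k (Cm m) i (N i w))%E.
  have mseq (s : seq 'I_n) : measurable_fun [set: Omega]
      (fun w => \prod_(i <- s) mixed k (Cm m) i (N i w))%E.
    elim: s => [|i s IHs]; first by under eq_fun do rewrite big_nil; exact: measurable_cst.
    under eq_fun do rewrite big_cons.
    by apply: emeasurable_funM => //; exact: measurable_mixed.
  exact: mseq.
transitivity (\int[P]_w \sum_(m <oo) ((q i0 ^+ m)%:E *
    \prod_(i < n) mixed k (Cm m) i (N i w)))%E.
  apply: eq_integral => w _; rewrite (bigD1 i0)//= mix1.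
  set z := (\prod_(i < n | _) _)%E.
  have zE m : (\prod_(i < n) mixed k (Cm m) i (N i w))%E = (mixed k (Cm m) i0 (N i0 w) * z)%E.
    rewrite (bigD1 i0)//=; congr (_ * _)%E; apply: eq_bigr => i ii.
    by rewrite (mixE m).
  have zfin : z \is a fin_num.
    rewrite /z; elim/big_ind: _ => // [x y|i _]; first exact: fin_numM.
    rewrite ge0_fin_numE//; apply: le_lt_trans (mixed_le1 _ _ _ _) _.
    exact: ltry.
  rewrite muleC -(fineK zfin) -nneseriesZl => [|m _].
    by apply: eq_eseriesr => m _; rewrite zE muleCA fineK// [(z * _)%E]muleC.
  by rewrite mule_ge0// lee_fin exprn_ge0.
rewrite integral_nneseries//; first last.
- by move=> m w _; rewrite mule_ge0 ?lee_fin ?exprn_ge0// prode_ge0.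
- by move=> m; apply: emeasurable_funM.
transitivity (\sum_(m <oo) (fine c)%:E * ((q i0 ^+ m)%:E * \int[P]_w mixed k (Cm m) i0 (N i0 w)))%E.
  apply: eq_eseriesr => m _.
  rewrite ge0_integralZl_EFin ?exprn_ge0//; last by move=> w _; exact: prode_ge0.
  rewrite IH//; last exact: ltnW.
  by rewrite (bigD1 i0)//= -cE fineK// [(_ * c)%E]muleC muleCA.
rewrite nneseriesZl; last first.
  by move=> m _; rewrite mule_ge0 ?lee_fin ?exprn_ge0// integral_ge0.
rewrite [RHS](bigD1 i0)//= -/c fineK// muleC; congr (_ * _)%E.
under [RHS]eq_integral do rewrite mix1.
rewrite integral_nneseries//; first last.
- by move=> m w _; rewrite mule_ge0 ?lee_fin ?exprn_ge0.
- by move=> m; apply: emeasurable_funM => //; exact: measurable_mixed.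
apply: eq_eseriesr => m _.
by rewrite ge0_integralZl_EFin ?exprn_ge0//; exact: measurable_mixed.
Qed.

Lemma expectation_prod_geometric_weight :
  (\int[P]_w \prod_(i < n) geometric_weight (q i) (N i w) =
   \prod_(i < n) \int[P]_w geometric_weight (q i) (N i w))%E.
Proof.
have := @expectation_prod_mixed n (fun=> setT) (leqnn n) (fun=> measurableT).
rewrite /mixed; under eq_integral do under eq_bigr do rewrite ltn_ord.
by under [X in _ = X -> _]eq_bigr do under eq_integral do rewrite ltn_ord.
Qed.

End independence.

Section poisson_sum.
Context (R : realType).

(** The generating function of the Poisson law; the series sums to exp(-r) exp(r q). *)
Lemma expectation_geometric_weight_poisson (d : measure_display)
    (Omega : measurableType d) (P : probability Omega R) (X : Omega -> \bar R)
    (q r : R) : measurable_fun [set: Omega] X -> 0 <= q -> 0 <= r ->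
  (forall m : nat, P [set w | X w = m%:R%:E] = poisson_prob r 0 [set m]) ->
  (\int[P]_w geometric_weight q (X w) = (expR (- (r * (1 - q))))%:E)%E.
Proof.
move=> mX q0 r0 hX.
have m1 m : measurable_fun [set: Omega] (fun w => (\1_[set m%:R%:E] (X w))%:E : \bar R).
  apply: (@measurableT_comp _ _ _ _ _ _ (fun x => (\1_[set m%:R%:E] x)%:E)) => //.
  exact/measurable_EFinP/measurable_indicP/emeasurable_set1.
rewrite /geometric_weight integral_nneseries//; first last.
- by move=> m w _; rewrite mule_ge0 ?lee_fin ?exprn_ge0.
- by move=> m; apply: emeasurable_funM.
have term m : (\int[P]_w ((q ^+ m)%:E * (\1_[set m%:R%:E] (X w))%:E) =
    (q ^+ m)%:E * poisson_prob r 0 [set m])%E.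
  rewrite ge0_integralZl_EFin ?exprn_ge0//; congr (_ * _)%E; rewrite -hX.
  transitivity (\int[P]_w (\1_(X @^-1` [set m%:R%:E]) w)%:E)%E.
    by apply: eq_integral => w _; rewrite !indicE; congr ((_ : bool)%:R%:E);
      apply/idP/idP => /set_mem h; apply/mem_set.
  rewrite integral_indic ?setIT//.
  rewrite -[X in measurable X]setTI; apply: mX => //; exact: emeasurable_set1.
under eq_eseriesr do rewrite term.
(* At rate 0 [poisson_prob] is the Dirac mass at its dummy argument, here 0, and only the term m = 0
   survives. *)
move: r0; rewrite le_eqVlt => /predU1P[<-|rp].
  rewrite mul0r oppr0 expR0 (@nneseriesD1 _ _ 0%N xpredT)//; last first.
    by move=> m _; rewrite /poisson_prob ltxx mule_ge0// lee_fin exprn_ge0.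
  rewrite eseries0 => [|m _ /= m0].
    by rewrite adde0 /poisson_prob ltxx diracE mem_set// mule1.
  rewrite /poisson_prob ltxx diracE memNset ?mule0//= => /esym/eqP.
  by rewrite (negbTE m0).
have pE m : ((q ^+ m)%:E * poisson_prob r 0 [set m] =
    (expR (- r))%:E * ((r * q) ^+ m / m`!%:R)%:E)%E.
  rewrite /poisson_prob rp esum_set1 ?lee_fin ?poisson_pmf_ge0//.
  rewrite /poisson_pmf rp -!EFinM exprMn; congr EFin; ring.
under eq_eseriesr do rewrite pE.
rewrite nneseriesZl/=; last first.
  by move=> m _; rewrite lee_fin divr_ge0// exprn_ge0// mulr_ge0// ltW.
rewrite (_ : - (r * (1 - q)) = - r + r * q); last by ring.
rewrite expRD EFinM; congr (_ * _)%E; rewrite expRE -EFin_lim; last first.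
  rewrite /pseries/=; under eq_fun do rewrite mulrC.
  exact: is_cvg_series_exp_coeff.
apply/congr_lim/funext => m/=; rewrite /pseries/= /series/= -sumEFin//.
by under eq_bigr do rewrite mulrC.
Qed.

Lemma counting_esum (T : choiceType) (A : set T) :
  counting A = \esum_(x in A) (1 : \bar R)%E.
Proof.
have sum1 (B : set T) : finite_set B -> \sum_(x \in B) (1 : \bar R)%E = #|` fset_set B|%:R%:E.
  move=> fB; rewrite fsbig_finite//= (eq_bigr (fun=> 1%:E))// sumEFin.
  by rewrite big_const_seq count_predT iter_addr addr0.
have [fA|iA] := pselect (finite_set A).
  by rewrite /counting asboolT// esum_fset// sum1.
rewrite /counting asboolF//; apply/esym/eq_infty => r.
have [B BA cB] := infinite_set_fset (Num.truncn r).+1 iA.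
apply: esum_ge; exists [set` B]; first by split.
rewrite sum1// set_fsetK lee_fin; apply: (@le_trans _ _ (Num.truncn r).+1%:R).
  exact/ltW/truncnS_gt.
by rewrite ler_nat.
Qed.

(** On this box the sign conditions of [point_count] hold by themselves, and a point is determined
    by its time. *)
Lemma point_count_esum (d : measure_display) (Omega : measurableType d)
    (e : R -> Omega -> R) (a a' s t : R) w :
  0 <= s -> 0 < a ->
  point_count e (`[a, a'[%classic `*` `]s, t]%classic) w =
  \esum_(u in `]s, t]) (\1_(`[a, a'[%classic) (e u w))%:E.
Proof.
move=> s0 a0; rewrite /point_count.
rewrite (_ : [set p : R * R | _] =
    (fun u => (e u w, u)) @` (`]s, t] `&` [set u | `[a, a'[%classic (e u w)])).
  rewrite counting_esum esum_image => [|x y _ _ [_ ->]//].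
  rewrite esum_mkcondr; apply: eq_esum => u _; rewrite indicE.
  rewrite (_ : (u \in _) = (e u w \in `[a, a'[%classic)); last first.
    by apply/idP/idP => /set_mem h; apply/mem_set.
  by case: (_ \in _).
apply/seteqP; split => [[x u] [/= u0 -> x0 [h1 h2]]|_ [u [/= h1 h2] <-]].
  by exists u.
split => //=.
  by move: h1; rewrite in_itv /= => /andP[/ltW/(le_trans s0)].
by move: h2; rewrite in_itv /= => /andP[/(lt_le_trans a0)].
Qed.

End poisson_sum.

(** * Laplace transforms of the increments *)

Section grid.
Context (R : realType).

(** The index is shifted by one so that the cells avoid [0, 1 / (n + 1)), near which a Levy measure
    may have infinite mass. *)
Definition grid_cell (n k : nat) : set R :=
  `[k.+1%:R / n.+1%:R, k.+2%:R / n.+1%:R[%classic.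

Definition grid_step (g : R -> R) (n : nat) (x : R) : R :=
  \sum_(k < n.+1 * n.+1) g (k.+1%:R / n.+1%:R) * \1_(grid_cell n k) x.

Lemma measurable_grid_cell n k : measurable (grid_cell n k).
Proof. exact: measurable_itv. Qed.

Lemma trivIset_grid_cell n : trivIset [set: nat] (grid_cell n).
Proof.
apply/trivIsetP => i j _ _ ij; apply/seteqP; split => // x [] /=.
rewrite /grid_cell /= !in_itv /= !ler_pdivrMr// !ltr_pdivlMr//.
move=> /andP[i1 i2] /andP[j1 j2].
have := le_lt_trans i1 j2; have := le_lt_trans j1 i2; rewrite !ltr_nat !ltnS => h1 h2.
by move/eqP: ij; apply; apply/eqP; rewrite eqn_leq h1 h2.
Qed.

Lemma grid_stepE g n (x : R) : 0 <= x ->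
  let j := Num.truncn (x * n.+1%:R) in
  grid_step g n x = if (0 < j <= n.+1 * n.+1)%N then g (j%:R / n.+1%:R) else 0.
Proof.
move=> x0 j; have := truncn_grid_itv n x0; rewrite -/j => xj.
have cell k : grid_cell n k x -> j = k.+1.
  rewrite /grid_cell /= in_itv /= !ler_pdivrMr// !ltr_pdivlMr// => xk.
  exact: truncn_def.
rewrite /grid_step; case: ifPn => [/andP[j0 jK]|jK].
  have pj : (j.-1 < n.+1 * n.+1)%N by rewrite prednK.
  rewrite (bigD1 (Ordinal pj))//= prednK// big1 => [|k kj].
    rewrite addr0 indicE mem_set ?mulr1// /grid_cell /= in_itv /= prednK//.
  rewrite indicE memNset ?mulr0// => /cell jk; move/eqP : kj; apply.
  by apply/val_inj; rewrite /= jk.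
rewrite big1// => k _; rewrite indicE memNset ?mulr0// => /cell jk.
by move: jK; rewrite jk /= ltn_ord.
Qed.

Section monotone.
Context (g : R -> R) (g0 : g 0 = 0).
Hypothesis nd_g : forall x y : R, 0 <= x -> x <= y -> g x <= g y.

Lemma grid_step_ge0 n (x : R) : 0 <= x -> 0 <= grid_step g n x.
Proof.
move=> x0; rewrite grid_stepE//; case: ifP => // _; by rewrite -g0 nd_g.
Qed.

Lemma grid_step_le n (x : R) : 0 <= x -> grid_step g n x <= g x.
Proof.
move=> x0; rewrite grid_stepE//; case: ifP => _; last by rewrite -g0 nd_g.
by apply: nd_g; [exact: divr_ge0 | have /andP[] := truncn_grid_itv n x0].
Qed.

Lemma cvg_grid_step (x : R) : 0 <= x -> continuous g ->
  grid_step g n x @[n --> \oo] --> g x.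
Proof.
move=> x0 cg; have [->|xn0] := eqVneq x 0.
  under eq_fun do rewrite grid_stepE// mul0r truncn0 /=.
  rewrite g0; exact: cvg_cst.
have xp : 0 < x by rewrite lt_def xn0.
have := cg x => /cvgrPdist_lt hg; apply/cvgrPdist_lt => e /hg /nbhs_ballP[dl /= dl0 hdl].
have m0 : 0 < Num.min x dl by rewrite lt_min xp.
near=> n; rewrite grid_stepE//.
have := truncn_grid_itv n x0; set j := Num.truncn _ => /andP[h1 h2].
have n0 : 0 < n.+1%:R :> R by [].
have bign : x < n.+1%:R.
  apply: (@lt_le_trans _ _ n%:R); last by rewrite ler_nat.
  by near: n; exact: nbhs_infty_gtr.
have small : n.+1%:R^-1 < Num.min x dl.
  by near: n; exact: near_infty_natSinv_lt (PosNum m0).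
move: small; rewrite lt_min => /andP[sx sd].
have hj : x - n.+1%:R^-1 < j%:R / n.+1%:R.
  by rewrite ltrBlDr; move: h2; rewrite -[j.+1%:R]natr1 mulrDl mul1r.
rewrite ifT; last first.
  apply/andP; split.
    rewrite -(ltr0n R); move: hj; rewrite ltr_pdivlMr// => hj.
    by apply: le_lt_trans hj; rewrite mulr_ge0// subr_ge0 ltW.
  rewrite -(ler_nat R) natrM; move: h1; rewrite ler_pdivrMr// => h1.
  by apply: le_trans h1 _; rewrite ler_wpM2r// ltW.
apply: hdl; rewrite /ball /= ger0_norm ?subr_ge0// ltrBlDr.
by move: hj; rewrite ltrBlDr addrC => /lt_trans; apply; rewrite ltrD2r.
Unshelve. all: by end_near. Qed.

End monotone.
End grid.

(** * Levy integrals as functions of time *)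

Section levy_family.
Context (R : realType) (nu : R -> {measure set R -> \bar R}).
Local Notation pos := (`]0, +oo[%classic : set R).
Local Notation nneg := (`[0, +oo[%classic : set R).
Hypothesis hc : levy_continuous nu.
Hypothesis hnu : forall t : R, 0 <= t ->
  (\int[nu t]_(x in `]0%R, +oo[) (Num.min x 1)%:E < +oo)%E.

Lemma integrable_min1 (t : R) : 0 <= t ->
  (nu t).-integrable pos (fun x => (Num.min x 1)%:E).
Proof.
move=> t0; apply/integrableP; split.
  apply/measurable_EFinP; apply: measurable_funTS.
  exact: measurable_minr.
apply: le_lt_trans (hnu t0); apply: ge0_le_integral => //.
- apply: measurableT_comp => //; apply/measurable_EFinP; apply: measurable_funTS.
  exact: measurable_minr.
- apply/measurable_EFinP; apply: measurable_funTS; exact: measurable_minr.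
- move=> x; rewrite /= in_itv /= andbT => x0.
  by rewrite lee_fin ger0_norm// le_min ltW// ler01.
Qed.

Lemma integrable_levy (t C : R) (phi : R -> R) : 0 <= t ->
  measurable_fun pos phi ->
  (forall x, 0 < x -> `|phi x| <= C * Num.min x 1) ->
  (nu t).-integrable pos (EFin \o phi).
Proof.
move=> t0 mphi hphi.
apply: (le_integrable _ _ _ (integrableZl _ C (integrable_min1 t0))) => //.
  exact/measurable_EFinP.
move=> x; rewrite /= in_itv /= andbT => x0.
by rewrite lee_fin (le_trans (hphi _ x0))// ler_norm.
Qed.

Definition levy_integral (phi : R -> R) (t : R) : R :=
  \int[nu t]_(x in `]0, +oo[) phi x.

Lemma measurable_levy_integral_continuous (phi : R -> R) C :
  {within `]0, +oo[, continuous phi} ->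
  (forall x, 0 < x -> `|phi x| <= C * Num.min x 1) ->
  measurable_fun nneg (levy_integral phi).
Proof.
move=> cphi hphi; apply: subspace_continuous_measurable_fun => //.
by apply: hc => //; exists C.
Qed.

(** [levy_continuous] only concerns continuous test functions. The indicator is the limit of the
    powers of min(1, x / a), which are continuous and all at most (1 / a + 1) min(x, 1). *)
Lemma measurable_levy_tail (a : R) : 0 < a ->
  measurable_fun nneg (levy_integral \1_(`[a, +oo[%classic)).
Proof.
move=> a0.
pose phi m x : R := Num.min 1 (x / a) ^+ m.+1.
have phi_ge0 m x : 0 < x -> 0 <= phi m x.
  by move=> x0; rewrite exprn_ge0// le_min ler01 divr_ge0// ltW.
have phi_le m x : 0 < x -> `|phi m x| <= (a^-1 + 1) * Num.min x 1.
  move=> x0; rewrite ger0_norm ?phi_ge0//.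
  have h0 : 0 <= Num.min 1 (x / a) by rewrite le_min ler01 divr_ge0// ltW.
  apply: (@le_trans _ _ (Num.min 1 (x / a))).
    by rewrite /phi exprS ler_piMr// exprn_ile1// ge_min lexx.
  have ai : 0 < a^-1 by rewrite invr_gt0.
  have [x1|x1] := leP x 1.
    by rewrite ge_min; apply/orP; right; rewrite mulrDl mul1r mulrC lerDl ltW.
  by rewrite mulr1 ge_min; apply/orP; left; rewrite lerDr ltW.
have cphi m : continuous (phi m).
  move=> x; apply: (@continuous_comp _ _ _ (fun x : R => Num.min 1 (x / a)) (fun x => x ^+ m.+1)).
    apply: continuous_min; first exact: cvg_cst.
    by apply: cvgM => //; exact: cvg_cst.
  exact: exprn_continuous.
have cw m : {within `]0, +oo[, continuous (phi m)} by apply: continuous_subspaceT.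
have mphi m : measurable_fun pos (phi m).
  by apply: measurable_funTS; exact: continuous_measurable_fun.
apply: (@measurable_fun_cvg _ _ _ _ (fun m => levy_integral (phi m))).
- by move=> m; exact: measurable_levy_integral_continuous (cw m) (phi_le m).
move=> t; rewrite /= in_itv /= andbT => t0.
have m1 : measurable_fun pos (\1_(`[a, +oo[%classic) : R -> R).
  by apply: measurable_funTS; exact/measurable_indicP.
have i1 : (nu t).-integrable pos (EFin \o (\1_(`[a, +oo[%classic) : R -> R)).
  apply: (@integrable_levy _ (a^-1 + 1)) => // x x0.
  rewrite indicE; case: (boolP (x \in _)) => [/set_mem|_].
    rewrite /= in_itv /= andbT normr1 => ax.
    have := phi_le 0 x x0; rewrite /phi expr1 min_l ?normr1//.
    by rewrite ler_pdivlMr// mul1r.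
  by rewrite normr0 mulr_ge0// ?le_min ?ler01 ?(ltW x0)// addr_ge0// invr_ge0 ltW.
apply: fine_cvg; rewrite fineK; last exact: integrable_fin_num.
apply: (@dominated_cvg _ _ _ (nu t) _ _ _ _ (fun x => ((a^-1 + 1) * Num.min x 1)%:E)) => //.
- by move=> m; exact/measurable_EFinP.
- move=> x; rewrite /= in_itv /= andbT => x0; apply/fine_cvgP; split; first exact: nearW.
  rewrite /= indicE /phi; have [ax|xa] := leP a x.
    rewrite mem_set /= ?in_itv /= ?andbT// min_l ?ler_pdivlMr ?mul1r//.
    by under eq_fun do rewrite expr1n; exact: cvg_cst.
  rewrite memNset /= ?in_itv /= ?andbT; last by apply/negP; rewrite -ltNge.
  rewrite min_r; last by rewrite ler_pdivrMr// mul1r ltW.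
  have := @cvg_geometric R 1 (x / a); rewrite ger0_norm ?divr_ge0 ?(ltW x0) ?(ltW a0)//.
  rewrite ltr_pdivrMr// mul1r => /(_ xa).
  rewrite -(cvg_shiftS) /geometric /=.
  by under eq_fun do rewrite mul1r.
- exact: (integrableZl (measurable_itv _) (a^-1 + 1) (integrable_min1 t0)).
- move=> m x; rewrite /= in_itv /= andbT => x0.
  by rewrite lee_fin phi_le.
Qed.

Lemma measurable_levy_itv (a a' : R) : 0 < a -> a <= a' ->
  measurable_fun nneg (levy_integral \1_(`[a, a'[%classic)).
Proof.
move=> a0 aa'.
have i1 t (c : R) : 0 <= t -> 0 < c ->
    (nu t).-integrable pos (EFin \o (\1_(`[c, +oo[%classic) : R -> R)).
  move=> t0 c0; apply: (@integrable_levy _ (c^-1 + 1)) => // x x0.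
  have ci : 0 < c^-1 by rewrite invr_gt0.
  rewrite indicE; case: (boolP (x \in _)) => [/set_mem|_].
    rewrite /= in_itv /= andbT normr1 => cx.
    have [x1|x1] := leP x 1; last by rewrite mulr1 lerDr ltW.
    rewrite mulrDl mul1r; apply: (@le_trans _ _ (c^-1 * x)); last by rewrite lerDl ltW.
    by rewrite mulrC ler_pdivlMr// mul1r.
  by rewrite normr0 mulr_ge0// ?le_min ?ler01 ?(ltW x0)// addr_ge0// ltW.
apply: (eq_measurable_fun (fun t => levy_integral \1_(`[a, +oo[%classic) t -
    levy_integral \1_(`[a', +oo[%classic) t)).
  move=> t; rewrite inE /= in_itv /= andbT => t0.
  rewrite /levy_integral -RintegralB//; try by apply: i1 => //; exact: lt_le_trans aa'.
  apply: eq_Rintegral => x _; rewrite !indicE.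
  rewrite (_ : (x \in `[a, +oo[%classic) = (a <= x)); last first.
    by apply/idP/idP => [/set_mem|h]; [|apply/mem_set]; rewrite /= in_itv /= andbT.
  rewrite (_ : (x \in `[a', +oo[%classic) = (a' <= x)); last first.
    by apply/idP/idP => [/set_mem|h]; [|apply/mem_set]; rewrite /= in_itv /= andbT.
  rewrite (_ : (x \in `[a, a'[%classic) = (a <= x < a')); last first.
    by apply/idP/idP => [/set_mem|h]; [|apply/mem_set]; rewrite /= in_itv.
  have [h|h] := leP a' x; last by rewrite subr0 andbT.
  by rewrite (le_trans aa' h) subrr.
by apply: measurable_funB; apply: measurable_levy_tail => //; exact: lt_le_trans aa'.
Qed.

End levy_family.

Section levy_exponent.
Context (R : realType).

(* The integrand of the Bernstein function f. *)
Definition levy_kernel (l x : R) : R := 1 - expR (- (l * x)).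

Lemma levy_kernel0 l : levy_kernel l 0 = 0.
Proof. by rewrite /levy_kernel mulr0 oppr0 expR0 subrr. Qed.

Lemma levy_kernel_nondecreasing l : 0 <= l ->
  forall x y : R, 0 <= x -> x <= y -> levy_kernel l x <= levy_kernel l y.
Proof. by move=> l0 x y _ xy; rewrite lerD2l lerN2 ler_expR lerN2 ler_wpM2l. Qed.

Lemma levy_kernel_ge0 l x : 0 <= l -> 0 <= x -> 0 <= levy_kernel l x.
Proof. by move=> l0 x0; rewrite -(levy_kernel0 l) levy_kernel_nondecreasing. Qed.

Lemma levy_kernel_le1 l x : levy_kernel l x <= 1.
Proof. by rewrite /levy_kernel gerBl expR_ge0. Qed.

Lemma levy_kernel_le l x : levy_kernel l x <= l * x.
Proof. by have := expR_ge1Dx (- (l * x)); rewrite /levy_kernel; lra. Qed.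

Lemma levy_kernel_bound l x : 0 <= l -> 0 < x ->
  `|levy_kernel l x| <= (l + 1) * Num.min x 1.
Proof.
move=> l0 x0; rewrite ger0_norm ?levy_kernel_ge0 ?(ltW x0)//.
have [x1|x1] := leP x 1.
  by apply: le_trans (levy_kernel_le l x) _; rewrite ler_wpM2r// ?lerDl// ltW.
by rewrite mulr1; apply: le_trans (levy_kernel_le1 l x) _; rewrite lerDr.
Qed.

Lemma continuous_levy_kernel l : continuous (levy_kernel l).
Proof.
move=> x; apply: cvgB; first exact: cvg_cst.
apply: (@continuous_comp _ _ _ (fun x : R => - (l * x)) (@expR R)).
  by apply: cvgN; apply: cvgM => //; exact: cvg_cst.
exact: continuous_expR.
Qed.

Lemma measurable_levy_kernel D l : measurable_fun (D : set R) (levy_kernel l).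
Proof.
by apply: measurable_funTS; apply: continuous_measurable_fun; exact: continuous_levy_kernel.
Qed.

Context (nu : R -> {measure set R -> \bar R}).
Local Notation pos := (`]0, +oo[%classic : set R).
Local Notation nneg := (`[0, +oo[%classic : set R).
Local Notation cell := (@grid_cell R).
Local Notation leb := (@lebesgue_measure R).
Hypothesis hc : levy_continuous nu.
Hypothesis hnu : forall t : R, 0 <= t ->
  (\int[nu t]_(x in `]0%R, +oo[) (Num.min x 1)%:E < +oo)%E.

(** The jump part of the Bernstein function; the drift is added in [cumulant_rate]. *)
Definition levy_exponent (l t : R) : R := levy_integral nu (levy_kernel l) t.

Lemma continuous_levy_exponent l : 0 <= l -> {within nneg, continuous (levy_exponent l)}.
Proof.
move=> l0; apply: hc.
  by apply: continuous_subspaceT; exact: continuous_levy_kernel.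
by exists (l + 1) => x; exact: levy_kernel_bound.
Qed.

Lemma integrable_levy_kernel l t : 0 <= l -> 0 <= t ->
  (nu t).-integrable pos (EFin \o levy_kernel l).
Proof.
move=> l0 t0; apply: (integrable_levy hnu t0 (C := l + 1)).
  exact: measurable_levy_kernel.
by move=> x; exact: levy_kernel_bound.
Qed.

Lemma levy_exponent_ge0 l t : 0 <= l -> 0 <= levy_exponent l t.
Proof.
move=> l0; apply: Rintegral_ge0 => x; rewrite /= in_itv /= andbT => x0.
by rewrite levy_kernel_ge0// ltW.
Qed.

Lemma integrable_levy_exponent (l s t : R) : 0 <= l -> 0 <= s ->
  leb.-integrable `]s, t] (EFin \o levy_exponent l).
Proof.
move=> l0 s0; apply: (@integrableS _ _ _ leb `[s, t]) => //.
  by apply: subset_itvr; rewrite bnd_simp.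
apply: continuous_compact_integrable; first exact: segment_compact.
apply: continuous_subspaceW (continuous_levy_exponent l0) => x.
by rewrite /= !in_itv /= andbT => /andP[/(le_trans s0)].
Qed.

(** Markov's inequality for the increasing function [levy_kernel 1]. The bound by [levy_exponent]
    makes the mass of a cell finite and locally integrable in time. *)
Lemma levy_grid_cell n k (t : R) : 0 <= t ->
  nu t (cell n k) = (levy_integral nu \1_(cell n k) t)%:E /\
  (levy_integral nu \1_(cell n k) t <=
   (levy_kernel 1 (k.+1%:R / n.+1%:R))^-1 * levy_exponent 1 t).
Proof.
move=> t0; set c := k.+1%:R / n.+1%:R.
have c0 : 0 < c by exact: divr_gt0.
have kc : 0 < levy_kernel 1 c.
  by rewrite /levy_kernel mul1r subr_gt0 expR_lt1 oppr_lt0.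
have le1 x : pos x -> \1_(cell n k) x <= (levy_kernel 1 c)^-1 * levy_kernel 1 x.
  rewrite /= in_itv /= andbT => x0; rewrite indicE.
  case: (boolP (x \in _)) => [/set_mem|_].
    rewrite /grid_cell /= in_itv /= => /andP[cx _].
    by rewrite -ler_pdivrMl ?invr_gt0// invrK mulr1 levy_kernel_nondecreasing// ltW.
  by rewrite mulr_ge0 ?invr_ge0 ?levy_kernel_ge0 ?(ltW x0) ?(ltW c0).
have ik := integrableZl (measurable_itv `]0%R, +oo[) (levy_kernel 1 c)^-1
  (integrable_levy_kernel ler01 t0).
have i1 : (nu t).-integrable pos (EFin \o \1_(cell n k)).
  apply: le_integrable ik => //.
    apply/measurable_EFinP; apply: measurable_funTS.
    by apply: measurable_indic; exact: measurable_grid_cell.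
  move=> x px; rewrite /= lee_fin ger0_norm//.
  by apply: le_trans (le1 _ px) _; exact: ler_norm.
split; last first.
  rewrite /levy_exponent /levy_integral -RintegralZl//; last exact: integrable_levy_kernel.
  exact: le_Rintegral.
rewrite /levy_integral /Rintegral fineK; last exact: integrable_fin_num i1.
rewrite integral_indic//; last exact: measurable_grid_cell.
congr (nu t _); apply/esym/setIidl => x; rewrite /grid_cell /= !in_itv /= andbT.
by move=> /andP[/(lt_le_trans c0)].
Qed.

Lemma integrable_levy_grid_cell n k (s t : R) : 0 <= s ->
  leb.-integrable `]s, t] (EFin \o levy_integral nu \1_(cell n k)).
Proof.
move=> s0; have st0 x : `]s, t]%classic x -> 0 <= x.
  by rewrite /= in_itv /= => /andP[/ltW/(le_trans s0)].
apply: (@le_integrable _ _ _ leb _ _ _ (fun r => ((levy_kernel 1 (k.+1%:R / n.+1%:R))^-1)%:E *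
    (levy_exponent 1 r)%:E)%E) => //; last by apply: integrableZl => //; exact: integrable_levy_exponent.
  apply/measurable_EFinP; apply: (measurable_funS (measurable_itv `[0%R, +oo[)).
    by move=> x /st0; rewrite /= in_itv /= andbT.
  apply: (measurable_levy_itv hc hnu); first exact: divr_gt0.
  by rewrite ler_pM2r ?invr_gt0// ler_nat.
move=> x /st0 x0; rewrite /= lee_fin; apply: le_trans (ler_norm _).
by rewrite ger0_norm ?(levy_grid_cell n k x0).2// Rintegral_ge0.
Qed.

Lemma intensity_grid_cell n k (s t : R) : 0 <= s ->
  intensity nu (cell n k `*` `]s, t]%classic) =
  (\int[leb]_(r in `]s, t]) levy_integral nu \1_(cell n k) r)%:E.
Proof.
move=> s0; rewrite /Rintegral fineK; last first.
  exact: integrable_fin_num (integrable_levy_grid_cell n k t s0).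
have -> : `]s, t]%classic = nneg `&` `]s, t]%classic.
  apply/esym/setIidr => x; rewrite /= !in_itv /= andbT.
  by move=> /andP[/ltW/(le_trans s0)].
rewrite integral_mkcondr; apply: eq_integral => r; rewrite inE /= in_itv /= andbT => r0.
rewrite patchE; case: ifPn => rst.
  rewrite -(levy_grid_cell n k r0).1; congr (nu r _).
  apply/seteqP; split => x /=; first by move=> [_ []].
  move=> hx; split; last by split => //=; move/set_mem: rst => [].
  move: hx; rewrite /grid_cell /= in_itv /= => /andP[h _].
  by apply: lt_le_trans h; exact: divr_gt0.
rewrite (_ : [set x | _] = set0) ?measure0//; apply/seteqP; split => // x [_ [_ /= h]].
by move/negP: rst; apply; apply/mem_set; case: h.
Qed.

Lemma integrable_grid_cell n k (t : R) : 0 <= t ->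
  (nu t).-integrable pos (EFin \o \1_(cell n k)).
Proof.
move=> t0; apply/integrableP; split.
  apply/measurable_EFinP; apply: measurable_funTS.
  by apply: measurable_indic; exact: measurable_grid_cell.
under eq_integral => x _ do rewrite /= ger0_norm//.
rewrite integral_indic//; last exact: measurable_grid_cell.
apply: le_lt_trans (ltry (levy_integral nu \1_(cell n k) t)).
rewrite -(levy_grid_cell n k t0).1; apply: le_measure; rewrite ?inE//.
- by apply: measurableI => //; exact: measurable_grid_cell.
- exact: measurable_grid_cell.
Qed.

Lemma levy_integral_grid_step (g : R -> R) n (t : R) : 0 <= t ->
  levy_integral nu (grid_step g n) t =
  \sum_(k < n.+1 * n.+1) g (k.+1%:R / n.+1%:R) * levy_integral nu \1_(cell n k) t.
Proof.
move=> t0; rewrite /levy_integral /grid_step.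
have ii k : (nu t).-integrable pos
    (fun x => (g (k.+1%:R / n.+1%:R) * \1_(cell n k) x)%:E).
  exact: (integrableZl (measurable_itv _) _ (integrable_grid_cell n k t0)).
rewrite /Rintegral; under eq_integral do rewrite -sumEFin.
rewrite integral_sum// -sum_fine => [|k _]; last exact: integrable_fin_num (ii k).
apply: eq_bigr => k _.
rewrite -[RHS](@RintegralZl _ _ _ (nu t) pos)//; exact: integrable_grid_cell.
Qed.

(** The sum is the integral of the step function below [levy_kernel l]. Dominated convergence is
    used twice: in the jump size at fixed time, then in time. *)
Lemma cvg_levy_grid (l s t : R) : 0 <= l -> 0 <= s ->
  \sum_(k < n.+1 * n.+1) levy_kernel l (k.+1%:R / n.+1%:R) *
    fine (intensity nu (cell n k `*` `]s, t]%classic)) @[n --> \oo] -->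
  \int[leb]_(r in `]s, t]) levy_exponent l r.
Proof.
move=> l0 s0.
have st0 x : `]s, t]%classic x -> 0 <= x.
  by rewrite /= in_itv /= => /andP[/ltW/(le_trans s0)].
have ic n k := integrable_levy_grid_cell n k t s0.
have sumE n : \sum_(k < n.+1 * n.+1) levy_kernel l (k.+1%:R / n.+1%:R) *
    fine (intensity nu (cell n k `*` `]s, t]%classic)) =
    fine (\int[leb]_(r in `]s, t]) (levy_integral nu (grid_step (levy_kernel l) n) r)%:E)%E.
  transitivity (fine (\int[leb]_(r in `]s, t])
     (\sum_(k < n.+1 * n.+1) (levy_kernel l (k.+1%:R / n.+1%:R) * levy_integral nu \1_(cell n k) r)%:E)%E)%E); last first.
    congr fine; apply: eq_integral => r; rewrite inE => /st0 r0.
    by rewrite sumEFin levy_integral_grid_step.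
  rewrite integral_sum// => [|k]; last first.
    exact: (@integrableZl _ _ _ leb _ _ _ _ (ic n k)).
  rewrite -sum_fine => [|k _]; last first.
    exact: (integrable_fin_num _ (@integrableZl _ _ _ leb _ _ _ _ (ic n k))).
  apply: eq_bigr => k _; rewrite intensity_grid_cell//=.
  by rewrite -RintegralZl.
under eq_fun do rewrite sumE.
apply: fine_cvg; rewrite fineK; last exact: integrable_fin_num (integrable_levy_exponent t l0 s0).
have gb n (r x : R) : 0 <= r -> pos x -> 0 <= grid_step (levy_kernel l) n x <= levy_kernel l x.
  rewrite /= in_itv /= andbT => r0 /ltW x0.
  rewrite grid_step_ge0 ?levy_kernel0//=; last exact: levy_kernel_nondecreasing.
  by rewrite grid_step_le ?levy_kernel0//; exact: levy_kernel_nondecreasing.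
have mg n : measurable_fun pos (grid_step (levy_kernel l) n).
  apply: measurable_funTS; apply: measurable_sum => k.
  by apply: measurable_funM => //; apply: measurable_indic; exact: measurable_grid_cell.
have ig n (r : R) : 0 <= r -> (nu r).-integrable pos (EFin \o grid_step (levy_kernel l) n).
  move=> r0; apply: le_integrable (integrable_levy_kernel l0 r0) => //.
    exact/measurable_EFinP.
  move=> x px; have /andP[h1 h2] := gb n r x r0 px.
  by rewrite /= lee_fin !ger0_norm// (le_trans h1).
apply: (@dominated_cvg _ _ _ leb _ _ _ _ (EFin \o levy_exponent l)) => //.
- move=> n; apply/measurable_EFinP.
  apply: (eq_measurable_fun (fun r => \sum_(k < n.+1 * n.+1)
     levy_kernel l (k.+1%:R / n.+1%:R) * levy_integral nu \1_(cell n k) r)).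
    by move=> r; rewrite inE => /st0 r0; rewrite levy_integral_grid_step.
  apply: measurable_sum => k; apply: measurable_funM => //.
  by apply/measurable_EFinP; exact: (measurable_int leb (ic n k)).
- move=> r /st0 r0; apply/fine_cvgP; split; first exact: nearW.
  rewrite /= /levy_exponent /levy_integral /Rintegral.
  apply: fine_cvg; rewrite fineK; last exact: integrable_fin_num (integrable_levy_kernel l0 r0).
  have finE n : (fine (\int[nu r]_(x in pos) (grid_step (levy_kernel l) n x)%:E))%:E =
      (\int[nu r]_(x in pos) (grid_step (levy_kernel l) n x)%:E)%E.
    by rewrite fineK//; exact: integrable_fin_num (ig n r r0).
  under eq_fun do rewrite finE.
  apply: (@dominated_cvg _ _ _ (nu r) _ _ _ _ (EFin \o levy_kernel l)) => //.
  + by move=> n; exact/measurable_EFinP.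
  + move=> x; rewrite /= in_itv /= andbT => /ltW x0; apply/fine_cvgP; split; first exact: nearW.
    by apply: (cvg_grid_step (levy_kernel0 l)) => //; exact: continuous_levy_kernel.
  + exact: integrable_levy_kernel.
  + move=> n x px; have /andP[h1 h2] := gb n r x r0 px.
    by rewrite /= lee_fin ger0_norm.
- exact: integrable_levy_exponent.
- move=> n r /st0 r0; rewrite /= lee_fin ger0_norm; last first.
    by apply: Rintegral_ge0 => x px; have /andP[] := gb n r x r0 px.
  apply: le_Rintegral => //.
  + exact: ig.
  + exact: integrable_levy_kernel.
  + by move=> x px; have /andP[] := gb n r x r0 px.
Qed.

End levy_exponent.

Section esum_approximation.
Context (R : realType) (T : choiceType).

Lemma esumZ (I : set T) (c : R) (a : T -> R) : 0 < c ->
  \esum_(x in I) (c * a x)%:E = (c%:E * \esum_(x in I) (a x)%:E)%E.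
Proof.
move=> c0.
have le (c' : R) (b : T -> R) : 0 < c' ->
    (\esum_(x in I) (c' * b x)%:E <= c'%:E * \esum_(x in I) (b x)%:E)%E.
  move=> c'0; apply: ge_ereal_sup => _ [X [fX XI] <-].
  rewrite fsbig_finite//= sumEFin -mulr_sumr EFinM lee_pmul2l ?lte_fin//.
  by apply: esum_ge; exists X => //; rewrite fsbig_finite//= sumEFin.
apply/eqP; rewrite eq_le le//=.
rewrite -(@lee_pmul2l _ c^-1%:E) ?lte_fin ?invr_gt0// muleA -EFinM mulVf ?gt_eqF// mul1e.
have := le c^-1 (fun x => c * a x); rewrite invr_gt0 => /(_ c0).
under eq_esum do rewrite mulKf ?gt_eqF//.
by apply.
Qed.

(** Dominated convergence for sums over an arbitrary index set: finitely many terms carry all of the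
    sum of [a] but e / 2. *)
Lemma cvg_esum_approx (I : set T) (a : T -> R) (b : nat -> T -> R) :
  (forall n x, I x -> 0 <= b n x <= a x) ->
  (forall x, I x -> b n x @[n --> \oo] --> a x) ->
  (\esum_(x in I) (a x)%:E < +oo)%E ->
  fine (\esum_(x in I) (b n x)%:E) @[n --> \oo] --> fine (\esum_(x in I) (a x)%:E).
Proof.
move=> ba cba afin.
have a0 x : I x -> 0 <= a x.
  by move=> Ix; have /andP[h1 h2] := ba 0%N x Ix; exact: le_trans h2.
have A0 : (0 <= \esum_(x in I) (a x)%:E)%E by apply: esum_ge0 => x Ix; rewrite lee_fin a0.
have Afin : \esum_(x in I) (a x)%:E \is a fin_num by rewrite ge0_fin_numE.
have B0 n : (0 <= \esum_(x in I) (b n x)%:E)%E.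
  by apply: esum_ge0 => x Ix; rewrite lee_fin; have /andP[] := ba n x Ix.
have BA n : (\esum_(x in I) (b n x)%:E <= \esum_(x in I) (a x)%:E)%E.
  by apply: le_esum => x Ix; rewrite lee_fin; have /andP[] := ba n x Ix.
have Bfin n : \esum_(x in I) (b n x)%:E \is a fin_num.
  by rewrite ge0_fin_numE// (le_lt_trans (BA n)).
apply/cvgrPdist_lt => e e0; have e2 : 0 < e / 2 by rewrite divr_gt0.
have [_ [X [fX XI] <-] hX] := ub_ereal_sup_adherent e2 Afin.
have cX : \sum_(x <- fset_set X) b n x @[n --> \oo] --> \sum_(x <- fset_set X) a x.
  have : {subset (fset_set X : seq T) <= [pred x | `[< I x >]]}.
    by move=> x; rewrite in_fset_set// inE => /XI/asboolP.
  elim: (fset_set X : seq T) => [|x r IH] rI.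
    by rewrite big_nil; under eq_fun do rewrite big_nil; exact: cvg_cst.
  rewrite big_cons; under eq_fun do rewrite big_cons.
  apply: cvgD; first by apply: cba; apply/asboolP/rI; rewrite mem_head.
  by apply: IH => y yr; apply: rI; rewrite in_cons yr orbT.
move/cvgrPdist_lt : cX => /(_ _ e2) cX.
near=> n.
have h1 : `|\sum_(x <- fset_set X) a x - \sum_(x <- fset_set X) b n x| < e / 2 by near: n.
have h2 : \sum_(x <- fset_set X) b n x <= fine (\esum_(x in I) (b n x)%:E).
  rewrite -lee_fin fineK//; apply: esum_ge; exists X => //.
  by rewrite fsbig_finite//= sumEFin.
have h3 : fine (\esum_(x in I) (a x)%:E) - e / 2 < \sum_(x <- fset_set X) a x.
  by rewrite -lte_fin EFinB fineK//; move: hX; rewrite fsbig_finite//= sumEFin.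
rewrite ger0_norm ?subr_ge0 ?fine_le//.
by move: h1; rewrite ltr_norml => /andP[_]; lra.
Unshelve. all: by end_near. Qed.

End esum_approximation.

(** * From the Poisson process to the increments *)

Section laplace_transform.
Context (R : realType) (nu : R -> {measure set R -> \bar R}).
Local Notation cell := (@grid_cell R).
Local Notation leb := (@lebesgue_measure R).
Hypothesis hc : levy_continuous nu.
Hypothesis hnu : forall t : R, 0 <= t ->
  (\int[nu t]_(x in `]0%R, +oo[) (Num.min x 1)%:E < +oo)%E.
Context (d : measure_display) (Omega : measurableType d) (P : probability Omega R).

Section point_process.
Context (e : R -> Omega -> R) (he : poisson_point_process P (intensity nu) e).
Context (l s t : R) (l0 : 0 <= l) (s0 : 0 <= s).

Let box n k := cell n k `*` `]s, t]%classic.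

Let weight n k : R := expR (- (l * (k.+1%:R / n.+1%:R))).

(** This is exp(-l Z), with Z the sum of the jumps in (s, t] rounded down to the grid, written
    through counts so that independence and the Poisson law apply. *)
Let W n w : \bar R :=
  (\prod_(k < n.+1 * n.+1) geometric_weight (weight n k) (point_count e (box n k) w))%E.

Let measurable_box n k : measurable (box n k).
Proof. by apply: measurableX => //; exact: measurable_grid_cell. Qed.

Let weight01 n k : 0 <= weight n k <= 1.
Proof.
by rewrite /weight expR_ge0 expR_le1 oppr_le0 mulr_ge0.
Qed.

(** The boxes are disjoint with finite intensity, so the counts are independent Poisson variables
    and their generating functions multiply. *)
Lemma laplace_grid n : (\int[P]_w W n w =
  (expR (- \sum_(k < n.+1 * n.+1) levy_kernel l (k.+1%:R / n.+1%:R) *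
    fine (intensity nu (box n k))))%:E)%E.
Proof.
have mN k : measurable_fun [set: Omega] (point_count e (box n k)).
  exact: (ppp_measurable he).
rewrite (@expectation_prod_geometric_weight _ _ _ P _
  (fun k : 'I_(n.+1 * n.+1) => point_count e (box n k))
  (fun k : 'I_(n.+1 * n.+1) => weight n k))//; last first.
  move=> C mC; apply: (ppp_independent he) => //.
  apply/trivIsetP => i j _ _ ij; apply/seteqP; split => // -[x u] /= [[ci _] [cj _]].
  have /trivIsetP /(_ i j Logic.I Logic.I) := @trivIset_grid_cell R n.
  have -> : (i : nat) != j by [].
  by move=> /(_ isT)/seteqP[/(_ x) h _]; exact: h (conj ci cj).
have fin k : (intensity nu (box n k) < +oo)%E.
  by rewrite /box (intensity_grid_cell hc hnu)// ltry.
have ge0 k : 0 <= fine (intensity nu (box n k)).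
  by apply: fine_ge0; apply: integral_ge0.
transitivity (\prod_(k < n.+1 * n.+1)
    (expR (- (fine (intensity nu (box n k)) * (1 - weight n k))))%:E)%E.
  apply: eq_bigr => k _; apply: expectation_geometric_weight_poisson => //.
    by have /andP[] := weight01 n k.
  by move=> m; exact: (ppp_poisson he).
rewrite -sumrN; elim/big_rec2: _ => [|k x y _ ->]; first by rewrite expR0.
by rewrite -EFinM expRD; congr (expR (- _) * _)%:E; rewrite mulrC.
Qed.

(** A finite sum of jumps forces each cell, bounded away from 0, to hold finitely many; then the
    weights are genuine powers. *)
Lemma geometric_weights_esum n w : (\esum_(u in `]s, t]) (e u w)%:E < +oo)%E ->
  W n w = (expR (- (l * fine (\esum_(u in `]s, t]) (grid_step id n (e u w))%:E))))%:E.
Proof.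
move=> Yfin; pose c k : R := k.+1%:R / n.+1%:R.
have c0 k : 0 < c k by exact: divr_gt0.
have e0 u : `]s, t]%classic u -> 0 <= e u w.
  by rewrite /= in_itv /= => /andP[/ltW/(le_trans s0) u0 _]; exact: (ppp_ge0 he).
have sumE : \esum_(u in `]s, t]) (grid_step id n (e u w))%:E =
    (\sum_(k < n.+1 * n.+1) (c k)%:E * point_count e (box n k) w)%E.
  rewrite /grid_step; under eq_esum do rewrite -sumEFin.
  rewrite esum_sum => [|u k _ _]; last first.
    by rewrite lee_fin mulr_ge0// ltW// c0.
  apply: eq_bigr => k _; rewrite esumZ ?c0//; congr (_ * _)%E.
  by rewrite /box /grid_cell point_count_esum//; exact: c0.
have le k : ((c k)%:E * point_count e (box n k) w <= \esum_(u in `]s, t]) (e u w)%:E)%E.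
  rewrite /box /grid_cell point_count_esum ?c0// -esumZ ?c0//.
  apply: le_esum => u /e0 eu; rewrite lee_fin indicE.
  case: (boolP (_ \in _)) => [/set_mem|_]; last by rewrite mulr0.
  by rewrite /= in_itv /= mulr1 => /andP[].
have hm k : exists m : nat, point_count e (box n k) w = m%:R%:E.
  move: (le k); rewrite /point_count /counting; case: ifP => _; first by eexists.
  rewrite gt0_muley ?lte_fin ?c0// leye_eq => /eqP h.
  by rewrite h in Yfin.
have [m hm'] := choice hm.
rewrite sumE /W.
under eq_bigr do rewrite hm' geometric_weight_nat ?expR_ge0//.
under [X in fine X]eq_bigr do rewrite hm' -EFinM.
rewrite sumEFin /= mulr_sumr -sumrN.
elim/big_rec2: _ => [|k x y _ ->]; first by rewrite expR0.
rewrite -EFinM expRD; congr (_ * _)%:E.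
by rewrite -expRM_natl; congr expR; rewrite /c; ring.
Qed.

Lemma geometric_weights01 n w : (0 <= W n w <= 1)%E.
Proof.
rewrite /W; elim/big_ind: _ => [|x y /andP[x0 x1] /andP[y0 y1]|k _].
- by rewrite lee01 lexx.
- by rewrite mule_ge0//= -[leRHS]mule1 lee_pmul.
- have /andP[h0 h1] := weight01 n k.
  by rewrite geometric_weight_ge0//= geometric_weight_le1.
Qed.

Lemma measurable_geometric_weights n : measurable_fun [set: Omega] (W n).
Proof.
have mseq (r : seq 'I_(n.+1 * n.+1)) : measurable_fun [set: Omega]
    (fun w => \prod_(k <- r) geometric_weight (weight n k) (point_count e (box n k) w))%E.
  elim: r => [|k r IH]; first by under eq_fun do rewrite big_nil; exact: measurable_cst.
  under eq_fun do rewrite big_cons.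
  apply: emeasurable_funM => //.
  apply: (@measurableT_comp _ _ _ _ _ _ (geometric_weight (weight n k))).
    by apply: measurable_geometric_weight; have /andP[] := weight01 n k.
  exact: (ppp_measurable he).
exact: mseq.
Qed.

(** Refining the grid, the bounded variables [W n] converge almost surely, because the sum of jumps
    equals the real number [Y w]; their means are known exactly. *)
Lemma laplace_point_process (Y : Omega -> R) : measurable_fun [set: Omega] Y ->
  (\forall w \ae P, (Y w)%:E = \esum_(u in `]s, t]) (e u w)%:E) ->
  (\int[P]_w (expR (- (l * Y w)))%:E =
   (expR (- \int[leb]_(r in `]s, t]) levy_exponent nu l r))%:E)%E.
Proof.
move=> mY hY.
have mf : measurable_fun [set: Omega] (fun w => (expR (- (l * Y w)))%:E).
  apply/measurable_EFinP; apply: measurableT_comp => //; apply: measurable_funN.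
  exact: measurable_funM.
have cW : \forall w \ae P, [set: Omega] w ->
    W n w @[n --> \oo] --> (expR (- (l * Y w)))%:E.
  apply: filterS hY => w hYw _.
  have Yfin : (\esum_(u in `]s, t]) (e u w)%:E < +oo)%E by rewrite -hYw ltry.
  have e0 u : `]s, t]%classic u -> 0 <= e u w.
    by rewrite /= in_itv /= => /andP[/ltW/(le_trans s0) u0 _]; exact: (ppp_ge0 he).
  under eq_fun do rewrite geometric_weights_esum//.
  apply/fine_cvgP; split; first exact: nearW.
  apply: continuous_cvg; first exact: continuous_expR.
  apply: cvgN; apply: cvgMr; rewrite -[Y w]/(fine (Y w)%:E) hYw.
  apply: cvg_esum_approx => // [n u /e0 eu|u /e0 eu].
    by rewrite grid_step_ge0// grid_step_le.
  by apply: (@cvg_grid_step _ id) => // x; exact: cvg_id.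
have i1 : P.-integrable [set: Omega] (cst 1%E) by exact: finite_measure_integrable_cst.
have dW : \forall w \ae P, forall n, [set: Omega] w -> (`|W n w| <= cst 1 w)%E.
  by apply: aeW => w n _; have /andP[h1 h2] := geometric_weights01 n w; rewrite gee0_abs.
have [_ _ cI] := dominated_convergence measurableT measurable_geometric_weights mf cW i1 dW.
apply: (cvg_unique _ cI); first exact: ereal_hausdorff.
have -> : [sequence (\int[P]_x W n x)%E]_n = fun n => (expR (- \sum_(k < n.+1 * n.+1)
    levy_kernel l (k.+1%:R / n.+1%:R) * fine (intensity nu (box n k))))%:E.
  by apply/funext => n; rewrite /= laplace_grid.
apply/fine_cvgP; split; first exact: nearW.
apply: continuous_cvg; first exact: continuous_expR.
by apply: cvgN; exact: cvg_levy_grid.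
Qed.

End point_process.

Lemma laplace_increment (b db : R -> R) (sigma : R -> {RV P >-> R}) (l s t : R) :
  nonhomogeneous_subordinator nu b db sigma -> 0 <= l -> 0 <= s -> s <= t ->
  (\int[P]_w (expR (- (l * (sigma t w - sigma s w))))%:E =
   (expR (- (l * (b t - b s) + \int[leb]_(r in `]s, t]) levy_exponent nu l r)))%:E)%E.
Proof.
move=> hs l0 s0 st; have t0 : 0 <= t by exact: le_trans st.
have [e [he hsig]] := path_representation hs.
pose Y w := sigma t w - sigma s w - (b t - b s).
have mY : measurable_fun [set: Omega] Y.
  by apply: measurable_funB => //; apply: measurable_funB.
have hY : \forall w \ae P, (Y w)%:E = \esum_(u in `]s, t]) (e u w)%:E.
  apply: filterS hsig => w hw; have ht := hw t t0; have hs' := hw s s0.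
  have e0 u : `[0, t]%classic u -> (0 <= (e u w)%:E)%E.
    by rewrite /= in_itv /= => /andP[u0 _]; rewrite lee_fin (ppp_ge0 he).
  rewrite (esumID `[0, s]%classic) // in ht.
  have E1 : `[0, t]%classic `&` `[0, s]%classic = `[0, s]%classic.
    apply/setIidr => x; rewrite /= !in_itv /= => /andP[-> xs] /=.
    exact: le_trans st.
  have E2 : `[0, t]%classic `&` ~` `[0, s]%classic = `]s, t]%classic.
    apply/seteqP; split => x /=; rewrite !in_itv /=.
      by move=> [/andP[x0 ->]]; rewrite x0 /= => /negP; rewrite -ltNge => ->.
    move=> /andP[sx ->]; rewrite (le_trans s0 (ltW sx)); split => //=.
    by apply/negP; rewrite -ltNge.
  rewrite E1 E2 in ht.
  have fs : \esum_(i in `[0, s]) (e i w)%:E \is a fin_num.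
    by move: hs'; case: (\esum_(_ in _) _).
  have ft : \esum_(i in `]s, t]) (e i w)%:E \is a fin_num.
    by move: ht; rewrite -(fineK fs); case: (\esum_(_ in `]s, t]) _).
  move: ht hs'; rewrite -(fineK fs) -(fineK ft) -!EFinD => -[ht] [hs'].
  by congr EFin; rewrite /Y ht hs'; ring.
have := laplace_point_process he l0 s0 mY hY => h.
transitivity ((expR (- (l * (b t - b s))))%:E * \int[P]_w (expR (- (l * Y w)))%:E)%E.
  rewrite -ge0_integralZl_EFin ?expR_ge0//; last first.
    apply/measurable_EFinP; apply: measurableT_comp => //; apply: measurable_funN.
    exact: measurable_funM.
  apply: eq_integral => w _; rewrite -EFinM -expRD; congr (expR _)%:E.
  by rewrite /Y; ring.
by rewrite h -EFinM -expRD; congr (expR _)%:E; ring.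
Qed.

End laplace_transform.

(** * Averages of the semigroup over a probability measure *)

Section Rintegral_sum.
Context (d : measure_display) (X : measurableType d) (R : realType).
Context (mu : {measure set X -> \bar R}) (D : set X) (mD : measurable D).

Lemma Rintegral_sum (I : Type) (r : seq I) (F : I -> X -> R) :
  (forall i, mu.-integrable D (EFin \o F i)) ->
  mu.-integrable D (fun x => (\sum_(i <- r) F i x)%:E) /\
  \int[mu]_(x in D) (\sum_(i <- r) F i x) = \sum_(i <- r) \int[mu]_(x in D) F i x.
Proof.
move=> iF; elim: r => [|i r [IH1 IH2]].
  rewrite big_nil; split; first by under eq_fun do rewrite big_nil; exact: integrable0.
  by under eq_Rintegral do rewrite big_nil; rewrite /Rintegral integral0.
split.
  under eq_fun do rewrite big_cons EFinD; exact: (integrableD mD (iF i) IH1).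
under eq_Rintegral do rewrite big_cons.
by rewrite RintegralD// big_cons IH2.
Qed.

Lemma Rintegral_le_cst_mul (f g : X -> R) (c : R) : 
  mu.-integrable D (EFin \o f) -> mu.-integrable D (EFin \o g) ->
  (forall x, D x -> f x <= c * g x) ->
  \int[mu]_(x in D) f x <= c * \int[mu]_(x in D) g x.
Proof.
move=> fi gi fg; rewrite -RintegralZl//; apply: le_Rintegral => //.
exact: (integrableZl mD c gi).
Qed.

End Rintegral_sum.

Section weak_integral.
Context (R : realType) (k : scalar_kind).
Local Notation K := (scalars R k).
Context (H : completeNormedModType K) (ip : {dot H for @scalar_conj R k}).
Hypothesis ip_norm : forall u : H, ip u u = `|u| ^+ 2.
Local Notation rip := (rip ip).
Context (d : measure_display) (X : measurableType d).
Context (mu : {measure set X -> \bar R}) (D : set X) (mD : measurable D).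

(** By duality, a pointwise approximation by finite sums passes to the integral. This reduces
    statements about vector averages to the scalar integrals of the [p j]. *)
Lemma rnorm_weak_integral_approx (f : X -> H) (I : H) (n : nat) (p : nat -> X -> R)
    (c : nat -> H) (eta : X -> R) :
  (forall v, mu.-integrable D (fun x => (rip v (f x))%:E)) ->
  (forall v, rip v I = \int[mu]_(x in D) rip v (f x)) ->
  (forall j, mu.-integrable D (EFin \o p j)) ->
  mu.-integrable D (EFin \o eta) ->
  (forall x, D x -> rnorm (f x - \sum_(j < n) rscale (p j x) (c j)) <= eta x) ->
  rnorm (I - \sum_(j < n) rscale (\int[mu]_(x in D) p j x) (c j)) <=
    \int[mu]_(x in D) eta x.
Proof.
move=> fi hI pi etai h; apply: (rnorm_le_rip ip_norm).
  by apply: Rintegral_ge0 => x Dx; apply: le_trans (h x Dx); exact: rnorm_ge0.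
move=> v; rewrite ripBr rip_sumr hI.
have pc (j : 'I_n) : mu.-integrable D (fun x => (rip v (c j) * p j x)%:E).
  exact: (integrableZl mD _ (pi j)).
have [si sE] := Rintegral_sum mD (index_enum 'I_n) pc.
have -> : \sum_(j < n) rip v (rscale (\int[mu]_(x in D) p j x) (c j)) =
    \int[mu]_(x in D) \sum_(j < n) (rip v (c j) * p j x).
  by rewrite sE; apply: eq_bigr => j _; rewrite ripZr RintegralZl// mulrC.
rewrite [leRHS]mulrC -(RintegralB mD (fi v) si); apply: Rintegral_le_cst_mul => //.
  exact: (integrableB mD (fi v) si).
move=> x Dx; apply: le_trans (ler_wpM2l (rnorm_ge0 v) (h x Dx)).
rewrite (_ : _ - _ = rip v (f x - \sum_(j < n) rscale (p j x) (c j))).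
  exact: ler_rip.
rewrite ripBr rip_sumr; congr (_ - _).
by apply: eq_bigr => j _; rewrite ripZr mulrC.
Qed.

End weak_integral.

Section laplace_functional.
Context (R : realType).
Local Notation nneg := (`[0, +oo[%classic : set R).

Definition laplace (m : {measure set R -> \bar R}) (l : R) : R :=
  \int[m]_(w in nneg) expR (- (l * w)).

Context (m : {measure set R -> \bar R}) (m1 : m nneg = 1%E).

Lemma integrable_bounded (f : R -> R) (M : R) : measurable_fun nneg f ->
  (forall x, 0 <= x -> `|f x| <= M) -> m.-integrable nneg (EFin \o f).
Proof.
move=> mf fM; apply/integrableP; split; first exact/measurable_EFinP.
apply: (@le_lt_trans _ _ (\int[m]_(x in nneg) (cst M%:E x))%E).
  apply: ge0_le_integral => //.
  - by apply: measurableT_comp => //; exact/measurable_EFinP.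
  - by move=> x; rewrite /= in_itv /= andbT => /fM; rewrite lee_fin.
by rewrite integral_cst//= m1 mule1 ltry.
Qed.

Lemma measurable_expRNM (l : R) : measurable_fun nneg (fun w : R => expR (- (l * w))).
Proof.
by apply: measurableT_comp => //; apply: measurable_funN; exact: measurable_funM.
Qed.

Lemma integrable_expRNM (l : R) : 0 <= l ->
  m.-integrable nneg (fun w => (expR (- (l * w)))%:E).
Proof.
move=> l0; apply: (@integrable_bounded _ 1); first exact: measurable_expRNM.
by move=> x x0; rewrite ger0_norm ?expR_ge0// expR_le1 oppr_le0 mulr_ge0.
Qed.

Lemma horner_expRN (p : {poly R}) (w : R) :
  p.[expR (- w)] = \sum_(i < size p) p`_i * expR (- (i%:R * w)).
Proof.
by rewrite horner_coef; apply: eq_bigr => i _; rewrite -expRM_natl mulrN.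
Qed.

Lemma integral_exp_sum (n : nat) (a : nat -> R) :
  m.-integrable nneg (fun w => (\sum_(i < n) a i * expR (- (i%:R * w)))%:E) /\
  \int[m]_(w in nneg) (\sum_(i < n) a i * expR (- (i%:R * w))) =
  \sum_(i < n) a i * laplace m i%:R.
Proof.
have iF (i : 'I_n) : m.-integrable nneg (fun w => (a i * expR (- (i%:R * w)))%:E).
  exact: (integrableZl (measurable_itv _) _ (integrable_expRNM (ler0n R i))).
have [h1 h2] := Rintegral_sum (measurable_itv `[0%R, +oo[) (index_enum _) iF.
split=> //; rewrite h2; apply: eq_bigr => i _; rewrite RintegralZl//.
exact: integrable_expRNM.
Qed.

(** On polynomials in exp(-w) the measure enters only through its Laplace transform at natural
    numbers. *)
Lemma integral_horner_expRN (p : {poly R}) :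
  m.-integrable nneg (fun w => (p.[expR (- w)])%:E) /\
  \int[m]_(w in nneg) p.[expR (- w)] = \sum_(i < size p) p`_i * laplace m i%:R.
Proof.
have [h1 h2] := integral_exp_sum (size p) (nth 0 p).
have pE : (fun w : R => p.[expR (- w)]) = fun w => \sum_(i < size p) p`_i * expR (- (i%:R * w)).
  by apply/funext => w; rewrite horner_expRN.
split; first by rewrite -[X in integrable _ _ X]/(EFin \o (fun w : R => p.[expR (- w)])) pE.
by rewrite -[X in Rintegral _ _ X]/(fun w : R => p.[expR (- w)]) pE.
Qed.

Lemma laplace0 : laplace m 0 = 1.
Proof.
rewrite /laplace; under eq_Rintegral do rewrite mul0r oppr0 expR0.
by rewrite Rintegral_cst// m1 mulr1.
Qed.

Lemma integrable_levy_kernel_finite (l : R) : 0 <= l ->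
  m.-integrable nneg (fun w => (levy_kernel l w)%:E).
Proof.
move=> l0; apply: (@integrable_bounded _ 1); first exact: measurable_levy_kernel.
by move=> x x0; rewrite ger0_norm ?levy_kernel_ge0// levy_kernel_le1.
Qed.

Lemma integral_levy_kernel (l : R) : 0 <= l ->
  \int[m]_(w in nneg) levy_kernel l w = 1 - laplace m l.
Proof.
move=> l0; rewrite -laplace0 -RintegralB//; try exact: integrable_expRNM.
by apply: eq_Rintegral => w _; rewrite /levy_kernel mul0r oppr0 expR0.
Qed.

End laplace_functional.

(** * Operators obtained by averaging the semigroup *)

Section subordination.
Context (R : realType) (k : scalar_kind).
Local Notation K := (scalars R k).
Context (H : completeNormedModType K) (ip : {dot H for @scalar_conj R k}).
Hypothesis ip_norm : forall u : H, ip u u = `|u| ^+ 2.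
Local Notation rip := (rip ip).
Context (D : set H) (A : H -> H) (T : R -> H -> H).
Hypotheses (hA : self_adjoint ip D A) (hdiss : dissipative ip D A).
Hypotheses (hT : C0_semigroup T) (hgen : is_generator T D A).
Local Notation nneg := (`[0, +oo[%classic : set R).

Let nneg_ge0 (w : R) : nneg w -> 0 <= w.
Proof. by rewrite /= in_itv /= andbT. Qed.

Let contraction := semigroup_contraction ip_norm hT hA hdiss hgen.
Let symmetric := semigroup_sym ip_norm hT hA hdiss hgen.
Let Tcont := semigroup_continuous ip_norm hT hA hdiss hgen.

(* Testing against [D] suffices, as [A] is its own adjoint. *)
Lemma self_adjoint_graph v w : (forall z, D z -> rip (A z) v = rip z w) ->
  D v /\ A v = w.
Proof.
move=> h; have [[D0 lA] _ ad] := hA; apply/ad => z Dz; apply: eq_of_re_part => c.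
have [Dcz Acz] := lA c z 0 Dz D0.
have [_ A0] := lA 1 0 0 D0 D0.
have A00 : A 0 = 0.
  by move: A0; rewrite !scale1r addr0 => /eqP; rewrite -subr_eq subrr eq_sym => /eqP.
rewrite addr0 A00 addr0 in Dcz Acz.
by rewrite !ip_scale_re -Acz h.
Qed.

Section one_measure.
Context (m : {measure set R -> \bar R}) (m1 : m nneg = 1%E).

(** [subordinate] is this operator for the increment law; nothing specific to subordinators enters
    its algebraic properties. *)
Definition subord (u : H) : H := bochner_integral m nneg (T ^~ u).

Let int_cst (c : R) : m.-integrable nneg (EFin \o cst c).
Proof. by apply: (integrable_bounded m1 (M := `|c|)). Qed.

Let contraction_cst (u : H) (x : R) : 0 <= x -> rnorm (T x u) <= cst (rnorm u) x.
Proof. exact: contraction. Qed.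

Lemma subord_integrable u : bochner_integrable m nneg (T ^~ u).
Proof.
apply: (bochner_integrable_continuous ip_norm (measurable_itv _) (@subset_refl _ _)
  (Tcont u) (contraction_cst u) _ (int_cst _)) => //.
Qed.

Lemma norm_integrable_semigroup u : norm_integrable m nneg (T ^~ u).
Proof.
exact: (norm_integrable_continuous (measurable_itv _) (@subset_refl _ _)
  (Tcont u) (contraction_cst u) (int_cst _)).
Qed.

Lemma rip_subord v u : rip v (subord u) = \int[m]_(w in nneg) rip v (T w u).
Proof.
apply: (rip_bochner_continuous ip_norm (measurable_itv _) (@subset_refl _ _)
  (Tcont u) (contraction_cst u) _ (int_cst _)) => //.
Qed.

Let int_rip v u : m.-integrable nneg (fun w => (rip v (T w u))%:E).
Proof. exact: (integrable_rip ip_norm (measurable_itv _) _ (norm_integrable_semigroup u)). Qed.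

Lemma subord_linear : linear subord.
Proof.
move=> a u v; apply: (rip_inj ip_norm) => w.
have E z : rip w (a *: z) = rip (scalar_conj a *: w) z.
  by rewrite -ip_scale_re -[LHS]/(re_part (ip w (a *: z))) linearZr_LR.
rewrite ripDr E !rip_subord -RintegralD//; try exact: int_rip.
apply: eq_Rintegral => x; rewrite inE => /nneg_ge0 x0.
by rewrite (semigroupD hT)// (semigroupZ hT)// ripDr E.
Qed.

Lemma subord_sym u v : rip (subord u) v = rip u (subord v).
Proof.
rewrite ripC !rip_subord; apply: eq_Rintegral => x; rewrite inE => /nneg_ge0 x0.
by rewrite ripC symmetric.
Qed.

Lemma subord_contraction u : rnorm (subord u) <= rnorm u.
Proof.
apply: (rnorm_le_rip ip_norm); first exact: rnorm_ge0.
move=> v; rewrite rip_subord.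
apply: (@le_trans _ _ (\int[m]_(w in nneg) (rnorm u * rnorm v))).
  apply: le_Rintegral => //; [exact: int_rip|exact: int_cst|].
  move=> w /nneg_ge0 w0; rewrite mulrC; apply: le_trans (ler_rip ip_norm _ _) _.
  by rewrite ler_wpM2l ?rnorm_ge0// contraction.
by rewrite Rintegral_cst// m1 mulr1.
Qed.

Lemma subord_semigroupC t u : 0 <= t -> T t (subord u) = subord (T t u).
Proof.
move=> t0; apply: (rip_inj ip_norm) => v; rewrite -symmetric// !rip_subord.
apply: eq_Rintegral => x; rewrite inE => /nneg_ge0 x0.
by rewrite symmetric// (semigroupC hT).
Qed.

(** Under the integral <A z, T_w u> = <z, T_w A u>; self-adjointness turns this weak identity into
    membership in the domain. *)
Lemma subord_domain u : D u -> D (subord u) /\ A (subord u) = subord (A u).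
Proof.
move=> Du; apply: self_adjoint_graph => z Dz; rewrite !rip_subord.
apply: eq_Rintegral => x; rewrite inE => /nneg_ge0 x0.
have [DT <-] := generator_semigroup hT hgen x0 Du.
exact: (generator_sym hA).
Qed.

End one_measure.

(** For w < dl the difference T_w u - u is below [e]; beyond, it is at most 2 |u|, hence at most a
    multiple of 1 - exp(-w). The constant does not depend on the measure. *)
Lemma subord_near_id u e : 0 < e -> exists2 C : R, 0 <= C &
  forall m : {measure set R -> \bar R}, m nneg = 1%E ->
    rnorm (subord m u - u) <= e + C * (1 - laplace m 1).
Proof.
move=> e0; have [dl dl0 hdl] := semigroup_near0 hT u e0.
have k0 : 0 < levy_kernel 1 dl.
  by rewrite /levy_kernel mul1r subr_gt0 expR_lt1 oppr_lt0.
have C0 : 0 <= 2 * rnorm u / levy_kernel 1 dl.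
  by rewrite divr_ge0 ?mulr_ge0 ?rnorm_ge0// ltW.
exists (2 * rnorm u / levy_kernel 1 dl) => // m m1.
set C := _ / _ in C0 *.
pose eta w := e + C * levy_kernel 1 w.
have ie : m.-integrable nneg (EFin \o cst e) by apply: (integrable_bounded m1 (M := `|e|)).
have iC : m.-integrable nneg (fun w => (C * levy_kernel 1 w)%:E).
  exact: (integrableZl (measurable_itv _) C (integrable_levy_kernel_finite m1 ler01)).
have i_eta : m.-integrable nneg (EFin \o eta).
  have := integrableD (measurable_itv _) ie iC; apply: eq_integrable => //.
have -> : e + C * (1 - laplace m 1) = \int[m]_(w in nneg) eta w.
  rewrite RintegralD// RintegralZl//; last exact: integrable_levy_kernel_finite.
  by rewrite integral_levy_kernel// Rintegral_cst// m1 mulr1.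
have := @rnorm_weak_integral_approx _ _ _ _ ip_norm _ _ m nneg (measurable_itv _)
  (T ^~ u) (subord m u) 1%N (fun _ => cst 1) (fun _ => u) eta.
rewrite !big_ord1 Rintegral_cst// m1 mulr1 rscale1; apply => //.
- by move=> v; apply: (integrable_rip ip_norm) => //; exact: norm_integrable_semigroup.
- by move=> v; exact: rip_subord.
- by move=> _; apply: (integrable_bounded m1 (M := 1)) => // x _; rewrite normr1.
move=> w /nneg_ge0 w0; rewrite big_ord1 ?rscale1.
have [wd|dw] := ltP w dl.
  apply: le_trans (ltW (hdl w _)) _; first by rewrite w0.
  by rewrite lerDl mulr_ge0// levy_kernel_ge0.
apply: le_trans (rnorm_semigroupB_le2 ip_norm hT hA hdiss hgen u w0) _.
apply: (@le_trans _ _ (C * levy_kernel 1 dl)); first by rewrite divfK ?gt_eqF.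
apply: (@le_trans _ _ (C * levy_kernel 1 w)); last by rewrite lerDr ltW.
by rewrite ler_wpM2l// levy_kernel_nondecreasing// ltW.
Qed.

(* Both sides are approximated on the exponential sums which approximate
   T w u uniformly in w. *)
Lemma subord_comp (m1 m2 m3 : {measure set R -> \bar R}) u :
  m1 nneg = 1%E -> m2 nneg = 1%E -> m3 nneg = 1%E ->
  (forall n : nat, laplace m1 n%:R * laplace m2 n%:R = laplace m3 n%:R) ->
  subord m1 (subord m2 u) = subord m3 u.
Proof.
move=> h1 h2 h3 hL.
have [p hp] := semigroup_limit ip_norm hT hA hdiss hgen u.
apply/eqP; rewrite -subr_eq0 -rnorm_eq0; apply/eqP/le_anti; rewrite rnorm_ge0 andbT.
apply: (@ler_small _ _ _ 2) => // e e0; rewrite add0r.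
have [N [c _ hc]] := bernstein_approx_exp (Tcont u) hp e0.
pose B j := bernstein R N j.
(* The mean of B_j(exp(-(x + y))) over y under [m2]. It is again an exponential sum in x, so
   integrating it against [m1] produces the products of transforms in [hL]. *)
pose q j x := \sum_(i < size (B j)) (B j)`_i * laplace m2 i%:R * expR (- (i%:R * x)).
have ie (m : {measure set R -> \bar R}) (mm : m nneg = 1%E) : m.-integrable nneg (EFin \o cst e).
  by apply: (integrable_bounded mm (M := `|e|)).
have Ie (m : {measure set R -> \bar R}) : m nneg = 1%E -> \int[m]_(w in nneg) cst e w = e.
  by move=> mm; rewrite Rintegral_cst// mm mulr1.
have iT (m : {measure set R -> \bar R}) (mm : m nneg = 1%E) (v z : H) :
    m.-integrable nneg (fun w => (rip v (T w z))%:E).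
  by apply: (integrable_rip ip_norm) => //; exact: norm_integrable_semigroup.
(* T_x (subord m2 u) is the [m2]-mean of T_{x+y} u, so the approximation of the orbit of [u] at x +
   y yields one that is uniform in x. *)
have s2 x : nneg x ->
    rnorm (T x (subord m2 u) - \sum_(j < N.+1) rscale (q j x) (c j)) <= e.
  move=> /nneg_ge0 x0.
  have := @rnorm_weak_integral_approx _ _ _ _ ip_norm _ _ m2 nneg (measurable_itv _)
    (fun y => T (x + y) u) (T x (subord m2 u)) N.+1
    (fun j y => (B j).[expR (- (x + y))]) c (cst e).
  have qE j : \int[m2]_(y in nneg) (B j).[expR (- (x + y))] = q j x /\
      m2.-integrable nneg (fun y => ((B j).[expR (- (x + y))])%:E).
    have [i1 i2] := integral_exp_sum h2 (size (B j)) (fun i => (B j)`_i * expR (- (i%:R * x))).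
    have E y : (B j).[expR (- (x + y))] =
        \sum_(i < size (B j)) (B j)`_i * expR (- (i%:R * x)) * expR (- (i%:R * y)).
      rewrite horner_expRN; apply: eq_bigr => i _.
      by rewrite mulrDr opprD expRD mulrA.
    split; last by apply: eq_integrable i1 => // y _; rewrite E.
    under eq_Rintegral => y _ do rewrite E.
    by rewrite i2; apply: eq_bigr => i _; rewrite mulrAC.
  under eq_bigr do rewrite (qE _).1.
  rewrite Ie//; apply => //.
  - move=> v; apply: eq_integrable (iT m2 h2 (T x v) u) => // y; rewrite inE => /nneg_ge0 y0.
    by rewrite symmetric// (C0_add hT).
  - move=> v; rewrite -symmetric// rip_subord//; apply: eq_Rintegral => y.
    by rewrite inE => /nneg_ge0 y0; rewrite symmetric// (C0_add hT).
  - by move=> j; exact: (qE j).2.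
  - exact: ie.
  - by move=> y /nneg_ge0 y0; apply: hc; exact: addr_ge0.
have h_1 := @rnorm_weak_integral_approx _ _ _ _ ip_norm _ _ m1 nneg (measurable_itv _)
  (T ^~ (subord m2 u)) (subord m1 (subord m2 u)) N.+1 q c (cst e)
  (fun v => iT m1 h1 v _) (fun v => rip_subord h1 v _)
  (fun j => (integral_exp_sum h1 (size (B j)) (fun i => (B j)`_i * laplace m2 i%:R)).1) (ie m1 h1) s2.
have h_3 := @rnorm_weak_integral_approx _ _ _ _ ip_norm _ _ m3 nneg (measurable_itv _)
  (T ^~ u) (subord m3 u) N.+1 (fun j w => (B j).[expR (- w)]) c (cst e)
  (fun v => iT m3 h3 v _) (fun v => rip_subord h3 v _)
  (fun j => (integral_horner_expRN h3 (B j)).1) (ie m3 h3) (fun w w0 => hc w (nneg_ge0 w0)).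
rewrite Ie// in h_1; rewrite Ie// in h_3.
have E : \sum_(j < N.+1) rscale (\int[m1]_(x in nneg) q j x) (c j) =
    \sum_(j < N.+1) rscale (\int[m3]_(x in nneg) (B j).[expR (- x)]) (c j).
  apply: eq_bigr => j _; congr rscale.
  rewrite (integral_horner_expRN h3 (B j)).2.
  rewrite (integral_exp_sum h1 (size (B j)) (fun i => (B j)`_i * laplace m2 i%:R)).2.
  by apply: eq_bigr => i _; rewrite -hL mulrA mulrAC.
rewrite E in h_1; rewrite rnormB in h_3.
by apply: le_trans (ler_rnorm_dist _ _ _) (le_trans (lerD h_1 h_3) _); lra.
Qed.

End subordination.

(** * The generator as a limit of averages *)

(** Thus 1 / (1 - exp(-w)) exceeds 1 / w by at most 1, which serves as w -> 0, and exceeds 1 by at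
    most 1 / w, which serves as w -> +oo. *)
Lemma inv_levy_kernel (R : realType) (w : R) : 0 < w ->
  [/\ 0 < levy_kernel 1 w, Num.max w^-1 1 <= (levy_kernel 1 w)^-1 &
      (levy_kernel 1 w)^-1 <= w^-1 + 1].
Proof.
move=> w0; have k0 : 0 < levy_kernel 1 w.
  by rewrite /levy_kernel mul1r subr_gt0 expR_lt1 oppr_lt0.
split=> //.
  rewrite ge_max lef_pV2 ?posrE// -{2}[w]mul1r levy_kernel_le/=.
  by rewrite -[leLHS]invr1 lef_pV2 ?posrE// levy_kernel_le1.
rewrite -[leLHS]div1r ler_pdivrMr// /levy_kernel mul1r expRN.
have h : (expR w)^-1 <= (1 + w)^-1.
  by rewrite lef_pV2 ?posrE ?expR_gt0 ?expR_ge1Dx//; lra.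
apply: (@le_trans _ _ ((w^-1 + 1) * (1 - (1 + w)^-1))).
  by rewrite le_eqVlt; apply/orP; left; apply/eqP; field; lra.
by rewrite ler_wpM2l ?lerD2l ?lerN2// addr_ge0// invr_ge0 ltW.
Qed.

Lemma horner1_deriv (R : realType) (p : {poly R}) :
  p^`().[1] = \sum_(i < size p) p`_i * i%:R.
Proof.
rewrite /deriv horner_poly; case: (size p) => [|n] /=; first by rewrite !big_ord0.
rewrite big_ord_recl mulr0 add0r; apply: eq_bigr => i _.
by rewrite expr1n mulr1 mulr_natr.
Qed.

(** The coefficients sum to 0, so each exponential may be lowered by 1; the resulting terms are
    integrable even against an infinite Levy measure. *)
Lemma horner_levy_kernel (R : realType) (p : {poly R}) (w : R) : p.[1] = 0 ->
  p.[expR (- w)] = \sum_(i < size p) - p`_i * levy_kernel i%:R w.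
Proof.
move=> p1; rewrite horner_expRN; apply/eqP; rewrite -subr_eq0 -sumrB; apply/eqP.
rewrite -[RHS]p1 horner_coef; apply: eq_bigr => i _.
by rewrite expr1n /levy_kernel; ring.
Qed.

Section rscale_dist.
Context (R : realType) (k : scalar_kind).
Context (H : completeNormedModType (scalars R k)).

Lemma rscale_sumr (I : Type) (r : seq I) a (F : I -> H) :
  rscale a (\sum_(i <- r) F i) = \sum_(i <- r) rscale a (F i).
Proof. exact: scaler_sumr. Qed.

Lemma rnorm_rscaleB a a' (u u' : H) :
  rnorm (rscale a' u' - rscale a u) <= `|a'| * rnorm (u' - u) + `|a' - a| * rnorm u.
Proof.
rewrite -!rnorm_scale rscaleBr rscaleBl; apply: le_trans (ler_rnormD _ _).
by rewrite addrA subrK.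
Qed.

End rscale_dist.

Section levy_generator.
Context (R : realType) (k : scalar_kind).
Local Notation K := (scalars R k).
Context (H : completeNormedModType K) (ip : {dot H for @scalar_conj R k}).
Hypothesis ip_norm : forall u : H, ip u u = `|u| ^+ 2.
Local Notation rip := (rip ip).
Context (D : set H) (A : H -> H) (T : R -> H -> H).
Hypotheses (hA : self_adjoint ip D A) (hdiss : dissipative ip D A).
Hypotheses (hT : C0_semigroup T) (hgen : is_generator T D A).
Local Notation nneg := (`[0, +oo[%classic : set R).
Local Notation pos := (`]0, +oo[%classic : set R).
Local Notation subord := (subord T).

Let nneg_ge0 (w : R) : nneg w -> 0 <= w.
Proof. by rewrite /= in_itv /= andbT. Qed.

Let pos_gt0 (w : R) : pos w -> 0 < w.
Proof. by rewrite /= in_itv /= andbT. Qed.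

Let Tcont := semigroup_continuous ip_norm hT hA hdiss hgen.

Section levy_measure.
Context (n : {measure set R -> \bar R}).
Hypothesis in1 : n.-integrable pos (fun x => (Num.min x 1)%:E).

Let pos_nneg : pos `<=` nneg.
Proof. by move=> x /pos_gt0/ltW x0; rewrite /= in_itv /= x0. Qed.

Definition levy_generator (q : H) : H := bochner_integral n pos (fun s => T s q - q).

(** For q in the domain, x |A q| bounds the difference for x <= 1 and 2 |q| for x > 1. *)
Let dominator q x : R := (rnorm (A q) + 2 * rnorm q) * Num.min x 1.

Let continuous_difference q : continuous_ge0 (fun s => T s q - q).
Proof.
move=> x x0 e /(Tcont q x0)[dl dl0 hdl]; exists dl => // y y0 yx.
by rewrite opprB addrA subrK; exact: hdl.
Qed.

Let dominator_ge q : D q -> forall x, 0 <= x -> rnorm (T x q - q) <= dominator q x.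
Proof.
move=> Dq x x0; rewrite /dominator; have [x1|x1] := leP x 1.
  apply: le_trans (rnorm_semigroupB_le ip_norm hT hA hdiss hgen x0 Dq) _.
  by rewrite mulrC ler_wpM2r// lerDl mulr_ge0// rnorm_ge0.
apply: le_trans (rnorm_semigroupB_le2 ip_norm hT hA hdiss hgen q x0) _.
by rewrite mulr1 lerDr rnorm_ge0.
Qed.

Let dominator_nondecreasing q (x y : R) : 0 <= x -> x <= y -> dominator q x <= dominator q y.
Proof.
move=> x0 xy; rewrite ler_wpM2l ?addr_ge0 ?mulr_ge0 ?rnorm_ge0//.
by rewrite le_min2.
Qed.

Let integrable_dominator q : n.-integrable pos (EFin \o dominator q).
Proof. exact: (integrableZl (measurable_itv _) _ in1). Qed.

Lemma levy_generator_integrable q : D q ->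
  bochner_integrable n pos (fun s => T s q - q).
Proof.
move=> Dq; exact: (bochner_integrable_continuous ip_norm (measurable_itv _) pos_nneg
  (continuous_difference q) (dominator_ge Dq) (@dominator_nondecreasing q)
  (integrable_dominator q)).
Qed.

Lemma rip_levy_generator q v : D q ->
  rip v (levy_generator q) = \int[n]_(s in pos) rip v (T s q - q).
Proof.
move=> Dq; exact: (rip_bochner_continuous ip_norm (measurable_itv _) pos_nneg
  (continuous_difference q) (dominator_ge Dq) (@dominator_nondecreasing q)
  (integrable_dominator q)).
Qed.

Let norm_integrable_difference q : D q -> norm_integrable n pos (fun s => T s q - q).
Proof.
move=> Dq; exact: (norm_integrable_continuous (measurable_itv _) pos_nneg
  (continuous_difference q) (dominator_ge Dq) (integrable_dominator q)).
Qed.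

(** Symmetry moves [subord m] onto the test vector and back under the integral, so that no
    interchange of two integrals is needed. *)
Lemma levy_generator_subord (m : {measure set R -> \bar R}) q : m nneg = 1%E -> D q ->
  subord m (levy_generator q) = levy_generator (subord m q).
Proof.
move=> m1 Dq; apply: (rip_inj ip_norm) => v.
have [Dm _] := subord_domain ip_norm hA hdiss hT hgen m1 Dq.
rewrite -(subord_sym ip_norm hA hdiss hT hgen m1) !rip_levy_generator//.
apply: eq_Rintegral => s; rewrite inE => /pos_gt0/ltW s0.
rewrite (subord_sym ip_norm hA hdiss hT hgen m1) addrC -[- q]scaleN1r.
rewrite (subord_linear ip_norm hA hdiss hT hgen m1) scaleN1r addrC.
by rewrite (subord_semigroupC ip_norm hA hdiss hT hgen m1).
Qed.

Section difference_quotient.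
Context (q : H) (Dq : D q).

(* T w q - q divided by 1 - exp (- w), with its limit A q at w = 0. *)
Let F (w : R) : H :=
  if w == 0 then A q else rscale (levy_kernel 1 w)^-1 (T w q - q).

Let F_kernel w : 0 <= w -> T w q - q = rscale (levy_kernel 1 w) (F w).
Proof.
rewrite /F; have [-> _|w0 wge0] := eqVneq w 0.
  by rewrite (C0_0 hT) levy_kernel0 subrr /rscale rmorph0 scale0r.
by rewrite rscaleA divff ?rscale1// gt_eqF//; have [] := @inv_levy_kernel R w; rewrite ?lt_def ?w0.
Qed.

Let F_gt0 w : 0 < w -> F w = rscale (levy_kernel 1 w)^-1 (T w q - q).
Proof. by move=> w0; rewrite /F gt_eqF. Qed.

(** [F w] differs from the quotient (T_w q - q) / w, which tends to A q, by a factor in [0, 1] times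
    T_w q - q, of norm at most w |A q|. *)
Let continuous_F0 (e : R) : 0 < e -> exists2 dl : R, 0 < dl &
  forall w, 0 < w -> w < dl -> rnorm (F w - A q) < e.
Proof.
move=> e0; have e2 : 0 < e / 2 by rewrite divr_gt0.
have [dl dl0 hdl] := generator_near hgen Dq e2.
have A1 : 0 < rnorm (A q) + 1 by rewrite ltr_wpDl ?rnorm_ge0.
exists (Num.min dl (e / 2 / (rnorm (A q) + 1))) => [|w w0].
  by rewrite lt_min dl0 divr_gt0.
rewrite lt_min => /andP[wdl we]; rewrite F_gt0//.
have [_ k1 k2] := inv_levy_kernel w0; rewrite ge_max in k1; case/andP: k1 => k1 _.
apply: le_lt_trans (ler_rnorm_dist (rscale w^-1 (T w q - q)) _ _) _.
have h : rnorm (rscale w^-1 (T w q - q) - A q) < e / 2 by apply: hdl; rewrite w0.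
rewrite -rscaleBl rnorm_scale.
suff : `|(levy_kernel 1 w)^-1 - w^-1| * rnorm (T w q - q) <= e / 2 by lra.
rewrite ger0_norm ?subr_ge0//; apply: (@le_trans _ _ (1 * (w * rnorm (A q)))).
  apply: ler_pM; rewrite ?subr_ge0 ?rnorm_ge0//; first by lra.
  exact: (rnorm_semigroupB_le ip_norm hT hA hdiss hgen (ltW w0) Dq).
rewrite mul1r (_ : e / 2 = e / 2 / (rnorm (A q) + 1) * (rnorm (A q) + 1)); last first.
  by rewrite divfK// gt_eqF.
by apply: ler_pM; rewrite ?(ltW w0) ?rnorm_ge0 ?(ltW we)// lerDl.
Qed.

Let continuous_F : continuous_ge0 F.
Proof.
move=> x x0 e e0; have [->|xn0] := eqVneq x 0.
  have [dl dl0 hdl] := continuous_F0 e0; exists dl => // y y0.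
  rewrite subr0 ger0_norm// => yd; rewrite {2}/F eqxx.
  have [->|yn0] := eqVneq y 0; first by rewrite /F eqxx subrr rnorm0.
  by apply: hdl; rewrite // lt_def yn0.
have xp : 0 < x by rewrite lt_def xn0.
have e3 : 0 < e / 3 by rewrite divr_gt0.
set a := (levy_kernel 1 x)^-1; set u := T x q - q.
have [kx _ _] := inv_levy_kernel xp.
have a1 : 0 < a + 1 by rewrite ltr_wpDl// invr_ge0 ltW.
have u1 : 0 < rnorm u + 1 by rewrite ltr_wpDl ?rnorm_ge0.
have [d1 d10 h1] := continuous_difference q x0 (divr_gt0 e3 a1).
have ca : (levy_kernel 1 y)^-1 @[y --> x] --> a.
  by apply: cvgV; [rewrite gt_eqF|exact: continuous_levy_kernel].
have m0 : 0 < Num.min 1 (e / 3 / (rnorm u + 1)) by rewrite lt_min ltr01 divr_gt0.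
have /cvgrPdist_lt/(_ _ m0)/nbhs_ballP[d2 /= d20 h2] := ca.
exists (Num.min x (Num.min d1 d2)) => [|y y0]; first by rewrite !lt_min xp d10.
rewrite !lt_min => /and3P[yx yd1 yd2].
have yp : 0 < y by move: yx; rewrite ltr_distl => /andP[]; lra.
rewrite !F_gt0//; apply: le_lt_trans (rnorm_rscaleB _ _ _ _) _; rewrite -/a -/u.
have := h2 y; rewrite /ball /= distrC => /(_ yd2).
rewrite distrC lt_min => /andP[l1 l2].
have l3 := h1 y y0 yd1; rewrite -/u in l3.
have ka : `|(levy_kernel 1 y)^-1| <= a + 1.
  rewrite -[X in `|X|](subrK a); apply: le_trans (ler_normD _ _) _.
  have : `|a| = a by rewrite ger0_norm// invr_ge0 ltW.
  lra.
have p1 : `|(levy_kernel 1 y)^-1| * rnorm (T y q - q - u) <= e / 3.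
  rewrite (_ : e / 3 = (a + 1) * (e / 3 / (a + 1))); last by rewrite [RHS]mulrC divfK// gt_eqF.
  by apply: ler_pM => //; [exact: rnorm_ge0|exact: ltW].
have p2 : `|(levy_kernel 1 y)^-1 - a| * rnorm u <= e / 3.
  rewrite (_ : e / 3 = e / 3 / (rnorm u + 1) * (rnorm u + 1)); last by rewrite divfK// gt_eqF.
  by apply: ler_pM; rewrite ?rnorm_ge0 ?(ltW l2)// lerDl.
lra.
Qed.

Let limit_F : exists p : H, forall e : R, 0 < e ->
  exists W : R, forall w, 0 <= w -> W <= w -> rnorm (F w - p) < e.
Proof.
have [p hp] := semigroup_limit ip_norm hT hA hdiss hgen q.
exists (p - q) => e e0; have e2 : 0 < e / 2 by rewrite divr_gt0.
(* From there on, replacing 1 / (1 - exp(-w)) by 1 costs at most 2 |q| / w <= e / 2; the added 1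
   keeps w positive. *)
have [W hW] := hp _ e2; exists (Num.max W (4 * rnorm q / e + 1)) => w w0.
rewrite ge_max => /andP[wW wq].
have q0 : 0 <= 4 * rnorm q / e by rewrite divr_ge0 ?mulr_ge0 ?rnorm_ge0// ltW.
have wp : 0 < w by lra.
have [_ k1 k2] := inv_levy_kernel wp; rewrite ge_max in k1; case/andP: k1 => _ k1.
rewrite F_gt0// -[p - q]rscale1; apply: le_lt_trans (ler_rnorm_dist (T w q - q) _ _) _.
have h1 := hW w w0 wW; rewrite rscale1.
rewrite (_ : T w q - q - (p - q) = T w q - p); last by rewrite opprB addrA subrK.
rewrite -{2}[T w q - q]rscale1 -rscaleBl rnorm_scale ger0_norm ?subr_ge0//.
suff : ((levy_kernel 1 w)^-1 - 1) * rnorm (T w q - q) <= e / 2 by lra.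
apply: (@le_trans _ _ (w^-1 * (2 * rnorm q))).
  apply: ler_pM; rewrite ?subr_ge0 ?rnorm_ge0//; first by lra.
  exact: (rnorm_semigroupB_le2 ip_norm hT hA hdiss hgen q w0).
rewrite mulrC ler_pdivrMr//.
have : 4 * rnorm q <= e * w by rewrite [leRHS]mulrC -ler_pdivrMr//; lra.
lra.
Qed.

(** The uniform approximation of [F], multiplied by 1 - exp(-w). The relative error is what survives
    both division by a small time and integration against [n]. *)
Lemma semigroup_difference_approx e : 0 < e ->
  exists N : nat, exists2 c : nat -> H, c N = A q & forall w, 0 <= w ->
    rnorm (T w q - q - \sum_(j < N.+1) rscale ((1 - 'X) * bernstein R N j).[expR (- w)] (c j))
    <= e * levy_kernel 1 w.
Proof.
move=> e0; have [p hp] := limit_F.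
have [N [c cN hc]] := bernstein_approx_exp continuous_F hp e0.
exists N, c; first by rewrite cN /F eqxx.
move=> w w0; rewrite F_kernel// mulrC.
have k0 : 0 <= levy_kernel 1 w by exact: levy_kernel_ge0.
rewrite (_ : _ - _ = rscale (levy_kernel 1 w) (F w -
    \sum_(j < N.+1) rscale (bernstein R N j).[expR (- w)] (c j))).
  by rewrite rnorm_scale ger0_norm// ler_wpM2l// hc.
rewrite rscaleBr rscale_sumr; congr (_ - _); apply: eq_bigr => j _.
by rewrite rscaleA hornerM !hornerE /levy_kernel mul1r.
Qed.

Let P (N j : nat) : {poly R} := (1 - 'X) * bernstein R N j.

Let P1 N j : (P N j).[1] = 0.
Proof. by rewrite hornerM !hornerE subrr mul0r. Qed.

(** The factor 1 - x vanishes at 1, so the derivative there is minus the value of the Bernstein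
    polynomial. *)
Let P_deriv N j : (j <= N)%N -> (P N j)^`().[1] = - (j == N)%:R.
Proof.
move=> jN; rewrite /P derivM hornerD !hornerM derivB -polyC1 derivC derivX.
by rewrite !hornerE bernstein1// subrr mul0r addr0 mulN1r.
Qed.

Let integrable_kernel (l : nat) : n.-integrable pos (EFin \o levy_kernel l%:R).
Proof.
apply: (le_integrable _ _ _ (integrableZl (measurable_itv _) (l%:R + 1) in1)) => //.
  apply/measurable_EFinP; exact: measurable_levy_kernel.
move=> x /pos_gt0 x0; rewrite /= lee_fin; apply: le_trans (levy_kernel_bound _ _ ) _ => //.
exact: ler_norm.
Qed.

Let L l := \int[n]_(x in pos) levy_kernel l x.

Let integral_P N j : n.-integrable pos (fun w => ((P N j).[expR (- w)])%:E) /\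
  \int[n]_(w in pos) (P N j).[expR (- w)] = \sum_(i < size (P N j)) - (P N j)`_i * L i%:R.
Proof.
have iF (i : 'I_(size (P N j))) :
    n.-integrable pos (fun w => (- (P N j)`_i * levy_kernel i%:R w)%:E).
  exact: (integrableZl (measurable_itv _) _ (integrable_kernel i)).
have [h1 h2] := Rintegral_sum (measurable_itv `]0%R, +oo[) (index_enum _) iF.
split; first by apply: eq_integrable h1 => // w _; rewrite -horner_levy_kernel.
under eq_Rintegral do rewrite horner_levy_kernel//.
rewrite h2; apply: eq_bigr => i _; rewrite RintegralZl//; exact: integrable_kernel.
Qed.

(** Writing P_j as a combination of the 1 - exp(-l w) makes the limit that of the hypotheses on
    integers l. The parts linear in l assemble to -beta P_j'(1), the others to the integral against
    [n]. *)
Let cvg_integral_P (I : Type) (Fl : set_system I) (FF : Filter Fl)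
    (m : I -> {measure set R -> \bar R}) (c : I -> R) (beta : R) N j : (j <= N)%N ->
  (\forall i \near Fl, m i nneg = 1%E) ->
  (forall l : nat, c i * (1 - laplace (m i) l%:R) @[i --> Fl] --> l%:R * beta + L l%:R) ->
  c i * \int[m i]_(w in nneg) (P N j).[expR (- w)] @[i --> Fl] -->
  beta * (j == N)%:R + \int[n]_(w in pos) (P N j).[expR (- w)].
Proof.
move=> jN m1 hlim; rewrite (integral_P N j).2.
have -> : beta * (j == N)%:R = \sum_(i < size (P N j)) - (P N j)`_i * (i%:R * beta).
  rewrite -[_%:R]opprK -P_deriv// horner1_deriv mulrN mulr_sumr -sumrN.
  by apply: eq_bigr => i _; ring.
rewrite -big_split /=.
under eq_bigr do rewrite -mulrDr.
apply: (@cvg_trans _ ((\sum_(l < size (P N j)) - (P N j)`_l *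
    (c i * (1 - laplace (m i) l%:R))) @[i --> Fl])).
  apply: near_eq_cvg; near=> i.
  have mi : m i nneg = 1%E by near: i.
  rewrite (integral_horner_expRN mi (P N j)).2.
  have E : \sum_(l < size (P N j)) (P N j)`_l = 0.
    by rewrite -[RHS](P1 N j) horner_coef; apply: eq_bigr => l _; rewrite expr1n mulr1.
  transitivity (c i * (\sum_(l < size (P N j)) (P N j)`_l * laplace (m i) l%:R -
      \sum_(l < size (P N j)) (P N j)`_l)); last by rewrite E subr0.
  by rewrite -sumrB mulr_sumr; apply: eq_bigr => l _; ring.
by apply: cvg_big => [|l _]; [exact: add_continuous|apply: cvgMr; exact: hlim].
Unshelve. all: end_near. Qed.

Lemma cvg_subord_quotient (I : Type) (Fl : set_system I) (FF : Filter Fl)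
    (m : I -> {measure set R -> \bar R}) (c : I -> R) (beta : R) :
  (\forall i \near Fl, m i nneg = 1%E /\ 0 <= c i) ->
  (forall l : nat, c i * (1 - laplace (m i) l%:R) @[i --> Fl] -->
     l%:R * beta + \int[n]_(x in pos) levy_kernel l%:R x) ->
  rscale (c i) (subord (m i) q - q) @[i --> Fl] --> rscale beta (A q) + levy_generator q.
Proof.
move=> m1c0 hlim.
have m1 : \forall i \near Fl, m i nneg = 1%E by apply: filterS m1c0 => i [].
have c0 : \forall i \near Fl, 0 <= c i by apply: filterS m1c0 => i [].
have L0 : 0 <= L 1.
  by apply: Rintegral_ge0 => x /pos_gt0/ltW x0; exact: levy_kernel_ge0.
apply/cvg_rnormP_lt => e e0.
(* Eventually c_i (1 - laplace (m_i) 1) is below |beta + L 1| + 1, so the errors of both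
   approximations together stay below e' M = e / 2. *)
pose M := `|1 * beta + L 1| + 1 + L 1.
have M0 : 0 < M by rewrite ltr_wpDr// ltr_wpDl.
have e'0 : 0 < e / 2 / M by rewrite !divr_gt0.
set e' := _ / M in e'0.
have [N [y yN hy]] := semigroup_difference_approx e'0.
pose p j (w : R) := (P N j).[expR (- w)].
pose b j := \int[n]_(w in pos) p j w.
pose a i j := \int[m i]_(w in nneg) p j w.
have near1 : \forall i \near Fl, c i * (1 - laplace (m i) 1) < `|1 * beta + L 1| + 1.
  have /cvgrPdist_lt/(_ _ ltr01) := hlim 1%N; apply: filterS => i.
  rewrite ltr_distlC => /andP[_ h]; apply: lt_le_trans h _.
  by rewrite lerD2r; exact: ler_norm.
have near2 : \forall i \near Fl,
    \sum_(j < N.+1) `|c i * a i j - (beta * (j == N :> nat)%:R + b j)| * rnorm (y j) < e / 2.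
  have : \sum_(j < N.+1) `|c i * a i j - (beta * (j == N :> nat)%:R + b j)| * rnorm (y j)
      @[i --> Fl] --> \sum_(j < N.+1) 0 * rnorm (y j).
    apply: cvg_big => [|j _]; first exact: add_continuous.
    apply: cvgMl; apply/norm_cvg0P/subr_cvg0.
    by apply: cvg_integral_P => //; rewrite -ltnS.
  rewrite big1 => [|j _]; last by rewrite mul0r.
  move=> /cvgr0Pnorm_lt/(_ (e / 2)); rewrite divr_gt0// => /(_ isT); apply: filterS => i.
  exact: le_lt_trans (ler_norm _).
have hG : rnorm (levy_generator q - \sum_(j < N.+1) rscale (b j) (y j)) <= e' * L 1.
  rewrite -RintegralZl//; last exact: (integrable_kernel 1).
  apply: (@rnorm_weak_integral_approx _ _ _ _ ip_norm _ _ n pos (measurable_itv _)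
    (fun s => T s q - q)) => //.
  - by move=> v; apply: (integrable_rip ip_norm) => //; exact: norm_integrable_difference.
  - by move=> v; exact: rip_levy_generator.
  - by move=> j; exact: (integral_P N j).1.
  - exact: (integrableZl (measurable_itv _) _ (integrable_kernel 1)).
  - by move=> x /pos_gt0/ltW; exact: hy.
near=> i.
have mi : m i nneg = 1%E by near: i.
have ci : 0 <= c i by near: i.
have iT v : (m i).-integrable nneg (fun w => (rip v (T w q))%:E).
  apply: (integrable_rip ip_norm) => //.
  exact: (norm_integrable_semigroup ip_norm hA hdiss hT hgen).
have icst v : (m i).-integrable nneg (EFin \o cst (rip v q)).
  by apply: (integrable_bounded mi (M := `|rip v q|)).
have hI : rnorm (subord (m i) q - q - \sum_(j < N.+1) rscale (a i j) (y j)) <=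
    e' * (1 - laplace (m i) 1).
  rewrite -(integral_levy_kernel mi)// -RintegralZl//; last first.
    exact: integrable_levy_kernel_finite.
  apply: (@rnorm_weak_integral_approx _ _ _ _ ip_norm _ _ (m i) nneg (measurable_itv _)
    (fun s => T s q - q)) => //.
  - move=> v; have := integrableB (measurable_itv _) (iT v) (icst v).
    by apply: eq_integrable => // x _; rewrite ripBr.
  - move=> v; rewrite ripBr (rip_subord ip_norm hA hdiss hT hgen mi).
    rewrite -[X in _ - X]mulr1 -[X in _ - _ * X]/(fine 1%E) -mi.
    rewrite -Rintegral_cst// -RintegralB//.
    by apply: eq_Rintegral => x _; rewrite ripBr.
      exact: iT.
    exact: icst.
  - by move=> j; exact: (integral_horner_expRN mi (P N j)).1.
  - exact: (integrableZl (measurable_itv _) _ (integrable_levy_kernel_finite mi ler01)).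
  - by move=> x /nneg_ge0; exact: hy.
have h1 : rnorm (rscale (c i) (subord (m i) q - q) -
    \sum_(j < N.+1) rscale (c i * a i j) (y j)) <= c i * (e' * (1 - laplace (m i) 1)).
  rewrite (_ : _ - _ = rscale (c i) (subord (m i) q - q -
      \sum_(j < N.+1) rscale (a i j) (y j))).
    by rewrite rnorm_scale ger0_norm// ler_wpM2l.
  rewrite [RHS]rscaleBr rscale_sumr; congr (_ - _).
  by apply: eq_bigr => j _; rewrite rscaleA.
have h2' : \sum_(j < N.+1) `|c i * a i j - (beta * (j == N :> nat)%:R + b j)| * rnorm (y j) < e / 2.
  by near: i; exact: near2.
have h2 : rnorm (\sum_(j < N.+1) rscale (c i * a i j) (y j) -
    (rscale beta (A q) + \sum_(j < N.+1) rscale (b j) (y j))) < e / 2.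
  apply: le_lt_trans h2'.
  have -> : rscale beta (A q) = \sum_(j < N.+1) rscale (beta * (j == N :> nat)%:R) (y j).
    rewrite big_ord_recr /= eqxx mulr1 yN big1 ?add0r// => j _.
    by rewrite ltn_eqF// mulr0 /rscale rmorph0 scale0r.
  have -> : \sum_(j < N.+1) rscale (beta * (j == N :> nat)%:R) (y j) +
      \sum_(j < N.+1) rscale (b j) (y j) =
      \sum_(j < N.+1) rscale (beta * (j == N :> nat)%:R + b j) (y j).
    by rewrite -big_split; apply: eq_bigr => j _; rewrite /rscale rmorphD scalerDl.
  rewrite -sumrB; apply: le_trans (ler_rnorm_sum _ _) _.
  by apply: ler_sum => j _; rewrite -rscaleBl rnorm_scale.
have h3 : c i * (1 - laplace (m i) 1) < `|1 * beta + L 1| + 1 by near: i; exact: near1.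
apply: le_lt_trans (ler_rnorm_dist (\sum_(j < N.+1) rscale (c i * a i j) (y j)) _ _) _.
have h4 := ler_rnorm_dist (rscale beta (A q) + \sum_(j < N.+1) rscale (b j) (y j))
  (\sum_(j < N.+1) rscale (c i * a i j) (y j)) (rscale beta (A q) + levy_generator q).
have h5 : rnorm (rscale beta (A q) + \sum_(j < N.+1) rscale (b j) (y j) -
    (rscale beta (A q) + levy_generator q)) <= e' * L 1.
  by rewrite opprD addrACA subrr add0r rnormB.
have h6 : e' * (c i * (1 - laplace (m i) 1)) <= e' * (`|1 * beta + L 1| + 1).
  by rewrite ler_wpM2l ?ltW.
have h7 : e' * (`|1 * beta + L 1| + 1) + e' * L 1 = e / 2.
  by rewrite -mulrDr -/M divfK// gt_eqF.
rewrite mulrCA in h1; lra.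
Unshelve. all: end_near. Qed.

End difference_quotient.

End levy_measure.

End levy_generator.

(** * The propagator *)

Section increments.
Context (R : realType) (d : measure_display) (Omega : measurableType d).
Context (P : probability Omega R) (b db : R -> R) (nu : R -> {measure set R -> \bar R}).
Context (sigma : R -> {RV P >-> R}).
Hypothesis hsigma : nonhomogeneous_subordinator nu b db sigma.
Hypothesis hnu : forall t : R, 0 <= t ->
  (\int[nu t]_(x in `]0%R, +oo[) (Num.min x 1)%:E < +oo)%E.
Local Notation nneg := (`[0, +oo[%classic : set R).
Local Notation leb := (@lebesgue_measure R).

Let hc := levy_family_continuous hsigma.

(* The integral of f(l, _) over (s, t], and f itself. *)
Definition cumulant (l s t : R) : R :=
  l * (b t - b s) + \int[leb]_(r in `]s, t]) levy_exponent nu l r.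

Definition cumulant_rate (l t : R) : R := l * db t + levy_exponent nu l t.

Lemma increment_law_nneg (s t : R) : 0 <= s -> s <= t ->
  increment_law sigma s t nneg = 1%E.
Proof.
move=> s0 st; transitivity (P ((sigma t - sigma s : Omega -> R) @^-1` nneg)) => //.
rewrite (_ : _ @^-1` _ = setT) ?probability_setT//.
apply/seteqP; split => // w _ /=.
by rewrite in_itv /= andbT subr_ge0; exact: (path_nondecreasing hsigma).
Qed.

Lemma laplace_increment_law (l s t : R) : 0 <= l -> 0 <= s -> s <= t ->
  laplace (increment_law sigma s t) l = expR (- cumulant l s t).
Proof.
move=> l0 s0 st; rewrite /laplace /Rintegral.
rewrite -[RHS]/(fine (expR (- cumulant l s t))%:E); congr fine.
rewrite -(laplace_increment hc hnu hsigma l0 s0 st).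
rewrite /increment_law /distribution ge0_integral_pushforward//=; last first.
  by first [apply/measurable_EFinP; exact: measurable_expRNM|move=> y _; rewrite lee_fin expR_ge0].
rewrite (_ : _ @^-1` _ = setT)//.
apply/seteqP; split => // w _ /=.
by rewrite in_itv /= andbT subr_ge0; exact: (path_nondecreasing hsigma).
Qed.

Lemma cumulantD (l r s t : R) : 0 <= l -> 0 <= r -> r <= s -> s <= t ->
  cumulant l r s + cumulant l s t = cumulant l r t.
Proof.
move=> l0 r0 rs st; rewrite /cumulant.
rewrite -(@Rintegral_itvB _ _ (BRight r) (BRight t) s) ?bnd_simp//; first by ring.
exact: integrable_levy_exponent.
Qed.

Lemma cumulant_ge0 (l s t : R) : 0 <= l -> 0 <= s -> s <= t -> 0 <= cumulant l s t.
Proof.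
move=> l0 s0 st; rewrite addr_ge0//.
  by rewrite mulr_ge0// subr_ge0; exact: (drift_nondecreasing hsigma).
by apply: Rintegral_ge0 => x _; exact: levy_exponent_ge0.
Qed.

Lemma cumulantxx (l t : R) : cumulant l t t = 0.
Proof.
rewrite /cumulant subrr mulr0 add0r.
by rewrite (_ : `]t, t]%classic = set0) ?Rintegral_set0// set_itvoc0.
Qed.

(* One of a, c is t: the derivative of the cumulant at t from either side. *)
Lemma cumulant_derivative (l t e : R) : 0 <= l -> 0 <= t -> 0 < e ->
  exists2 dl : R, 0 < dl & forall a c : R, 0 <= a -> a <= c -> a = t \/ c = t ->
    c - a < dl ->
    `|cumulant l a c - (c - a) * cumulant_rate l t| <= e * (c - a).
Proof.
move=> l0 t0 e0; have e2 : 0 < e / 2 by rewrite divr_gt0.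
have l1 : 0 < l + 1 by rewrite ltr_wpDl.
have [d1 d10 h1] : exists2 d1 : R, 0 < d1 & forall a c : R, 0 <= a -> a <= c ->
    a = t \/ c = t -> c - a < d1 ->
    `|l * (b c - b a) - (c - a) * (l * db t)| <= e / 2 * (c - a).
  have /cvgrPdist_lt/(_ _ (divr_gt0 e2 l1)) := drift_derivative hsigma t0.
  rewrite !near_withinE => /nbhs_ballP[d1 /= d10 hd1]; exists d1 => // a c a0 ac act acd.
  have [->|cna] := eqVneq c a; first by rewrite !subrr mulr0 !mul0r subrr normr0 mulr0.
  have ca : 0 < c - a by rewrite subr_gt0 lt_def cna.
  have hq : `|db t - (b c - b a) / (c - a)| < e / 2 / (l + 1).
    case: act => E; subst t.
      apply: (hd1 c) => //; first by rewrite /ball /= distrC gtr0_norm.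
      by rewrite in_itv /= andbT (le_trans a0).
    (* Here c = t, so the quotient based at t is taken at the point a on its left. *)
    have -> : (b c - b a) / (c - a) = (b a - b c) / (a - c).
      by rewrite -(opprB (b c)) -(opprB c) invrN mulrNN.
    apply: (hd1 a) => /=; first by rewrite /ball /= gtr0_norm.
      by rewrite eq_sym.
    by rewrite in_itv /= andbT.
  rewrite (_ : _ - _ = - (l * (c - a) * (db t - (b c - b a) / (c - a)))); last first.
    by field; rewrite gt_eqF.
  rewrite normrN !normrM (ger0_norm l0) (gtr0_norm ca) -mulrA mulrCA [leRHS]mulrC ler_pM2l//.
  apply: (@le_trans _ _ ((l + 1) * (e / 2 / (l + 1)))).
    by apply: ler_pM => //; [rewrite lerDl|exact: ltW].
  by rewrite mulrC divfK// gt_eqF.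
have [d2 d20 h2] : exists2 d2 : R, 0 < d2 & forall x : R, 0 <= x -> `|x - t| < d2 ->
    `|levy_exponent nu l x - levy_exponent nu l t| <= e / 2.
  have /subspace_continuousP /(_ t) := continuous_levy_exponent hc l0.
  rewrite /= in_itv /= andbT => /(_ t0) /cvgrPdist_lt /(_ _ e2).
  rewrite near_withinE => /nbhs_ballP[d2 /= d20 hd2]; exists d2 => // x x0 xt.
  by rewrite distrC ltW//; apply: (hd2 x); rewrite /ball /= ?in_itv /= ?andbT// distrC.
exists (Num.min d1 d2) => [|a c a0 ac act]; first by rewrite lt_min d10.
rewrite lt_min => /andP[cd1 cd2].
have c0 : 0 <= c by exact: le_trans ac.
have := h1 a c a0 ac act cd1; rewrite /cumulant /cumulant_rate.
set g := levy_exponent nu l.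
have mac : leb `]a, c]%classic = (c - a)%:E.
  rewrite lebesgue_measure_itv /= lte_fin; case: ltP => // ca.
  by rewrite (le_anti (introT andP (conj ac ca))) subrr.
have ig : leb.-integrable `]a, c] (EFin \o g) by exact: integrable_levy_exponent.
have icst (r : R) : leb.-integrable `]a, c] (EFin \o cst r).
  apply/integrableP; split; first exact/measurable_EFinP.
  rewrite /= (integral_cst leb (measurable_itv `]a, c]) `|r|%:E).
  by rewrite [X in (_ * X)%E]mac -EFinM ltry.
have cstE r : \int[leb]_(x in `]a, c]) cst r x = r * (c - a).
  by rewrite Rintegral_cst// [X in fine X]mac.
have -> : (c - a) * (l * db t + g t) =
    (c - a) * (l * db t) + \int[leb]_(x in `]a, c]) cst (g t) x.
  by rewrite cstE; ring.
have : `|\int[leb]_(x in `]a, c]) g x - \int[leb]_(x in `]a, c]) cst (g t) x| <=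
    e / 2 * (c - a).
  rewrite -RintegralB//.
  apply: le_trans (le_normr_Rintegral _ _) _ => //.
    exact: (integrableB _ ig (icst _)).
  have -> : e / 2 * (c - a) = \int[leb]_(x in `]a, c]) cst (e / 2) x.
    by rewrite cstE.
  apply: le_Rintegral => //.
    by apply: integrable_norm; exact: (integrableB _ ig (icst _)).
  move=> x; rewrite /= in_itv /= => /andP[ax xc]; apply: h2; first lra.
  by rewrite ltr_distl; case: act => E; lra.
set I1 := \int[_]_(_ in _) _; set I2 := \int[_]_(_ in _) _.
rewrite !ler_norml => /andP[? ?] /andP[? ?]; apply/andP; split; lra.
Qed.

End increments.

Lemma rscaleNB (R : realType) (k : scalar_kind) (H : completeNormedModType (scalars R k))
    a (u v : H) : rscale (- a) (u - v) = rscale a (v - u).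
Proof. by rewrite -[u - v]opprB /rscale rmorphN scaleNr scalerN opprK. Qed.

Section propagator.
Context (R : realType) (k : scalar_kind).
Local Notation K := (scalars R k).
Context (H : completeNormedModType K) (ip : {dot H for @scalar_conj R k}).
Hypothesis ip_norm : forall u : H, ip u u = `|u| ^+ 2.
Context (d : measure_display) (Omega : measurableType d).
Context (P : probability Omega R) (b db : R -> R) (nu : R -> {measure set R -> \bar R}).
Context (sigma : R -> {RV P >-> R}).
Hypothesis hsigma : nonhomogeneous_subordinator nu b db sigma.
Hypothesis hnu : forall t : R, 0 <= t ->
  (\int[nu t]_(x in `]0%R, +oo[) (Num.min x 1)%:E < +oo)%E.
Context (D : set H) (A : H -> H) (T : R -> H -> H).
Hypotheses (hA : self_adjoint ip D A) (hdiss : dissipative ip D A).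
Hypotheses (hT : C0_semigroup T) (hgen : is_generator T D A).
Local Notation S := (subordinate sigma T).
Local Notation cumulant := (cumulant b nu).
Local Notation rate := (cumulant_rate db nu).

Let law_nneg := increment_law_nneg hsigma.

Let laplace_law := laplace_increment_law hsigma hnu.

Lemma subordinate_linear s t : 0 <= s -> s <= t -> linear (S s t).
Proof. by move=> s0 st; exact: (subord_linear ip_norm hA hdiss hT hgen (law_nneg s0 st)). Qed.

Lemma subordinate_rscale s t c u : 0 <= s -> s <= t -> S s t (rscale c u) = rscale c (S s t u).
Proof.
move=> s0 st; have l := subordinate_linear s0 st.
have z0 : S s t 0 = 0.
  by have := l 1 0 0; rewrite !scale1r addr0 => /eqP; rewrite -subr_eq subrr eq_sym => /eqP.
by have := l (of_real k c) u 0; rewrite addr0 z0 addr0.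
Qed.

Lemma subordinateB s t u v : 0 <= s -> s <= t -> S s t (u - v) = S s t u - S s t v.
Proof.
by move=> s0 st; rewrite addrC -scaleN1r subordinate_linear// scaleN1r addrC.
Qed.

Lemma subordinate_contraction s t u : 0 <= s -> s <= t -> rnorm (S s t u) <= rnorm u.
Proof. by move=> s0 st; exact: (subord_contraction ip_norm hA hdiss hT hgen (law_nneg s0 st)). Qed.

(** The cumulant is additive over intervals, so the transforms multiply. The second order of
    composition lets the earlier operator be factored out when the upper time varies. *)
Lemma subordinate_comp r s t u : 0 <= r -> r <= s -> s <= t ->
  S s t (S r s u) = S r t u /\ S r s (S s t u) = S r t u.
Proof.
move=> r0 rs st; have s0 := le_trans r0 rs; have rt := le_trans rs st.
have E (n : nat) : laplace (increment_law sigma r s) n%:R *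
    laplace (increment_law sigma s t) n%:R = laplace (increment_law sigma r t) n%:R.
  by rewrite !laplace_law// -expRD -opprD (cumulantD hsigma).
split; apply: (subord_comp ip_norm hA hdiss hT hgen); try exact: law_nneg => n.
- by move=> n; rewrite mulrC.
- exact: E.
Qed.

(** The elementary bounds y - y^2 <= 1 - exp(-y) <= y for y >= 0, the left one through exp(-y) <= 1
    / (1 + y). *)
Lemma laplace_law_cumulant (s t l : R) : 0 <= l -> 0 <= s -> s <= t ->
  0 <= 1 - laplace (increment_law sigma s t) l <= cumulant l s t /\
  cumulant l s t - (1 - laplace (increment_law sigma s t) l) <= cumulant l s t ^+ 2.
Proof.
move=> l0 s0 st; rewrite laplace_law//.
have := cumulant_ge0 hsigma l0 s0 st; set y := cumulant _ _ _ => y0.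
have y1 : 0 < 1 + y by lra.
have h1 : 1 - y <= expR (- y) by rewrite -[leLHS]/(1 + - y) expR_ge1Dx.
have h2 : expR (- y) <= (1 + y)^-1.
  by rewrite expRN lef_pV2 ?posrE ?expR_gt0// expR_ge1Dx.
have h3 : (1 + y)^-1 <= 1 - y + y ^+ 2.
  rewrite -[leLHS]div1r ler_pdivrMr//.
  have -> : (1 - y + y ^+ 2) * (1 + y) = 1 + y ^+ 3 by ring.
  by rewrite lerDl exprn_ge0.
have h4 : expR (- y) <= 1 by rewrite expR_le1 oppr_le0.
by split; [apply/andP; split|]; lra.
Qed.

Lemma subordinate_id t u : 0 <= t -> S t t u = u.
Proof.
move=> t0; apply/eqP; rewrite -subr_eq0 -rnorm_eq0; apply/eqP/le_anti.
rewrite rnorm_ge0 andbT; apply/ler_addgt0Pr => e e0; rewrite add0r.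
have [C C0] := subord_near_id ip_norm hA hdiss hT hgen u e0.
move=> /(_ (increment_law sigma t t) (law_nneg t0 (lexx t))).
by rewrite laplace_law// cumulantxx oppr0 expR0 subrr mulr0 addr0.
Qed.

Lemma subordinate_near_id t u e : 0 <= t -> 0 < e ->
  exists2 dl : R, 0 < dl & forall a c : R, 0 <= a -> a <= c -> a = t \/ c = t ->
    c - a < dl -> rnorm (S a c u - u) < e.
Proof.
move=> t0 e0; have e2 : 0 < e / 2 by rewrite divr_gt0.
have [C C0 hC] := subord_near_id ip_norm hA hdiss hT hgen u e2.
have [d1 d10 hd1] := cumulant_derivative hsigma ler01 t0 ltr01.
(* Close to [t] the cumulant is at most (c - a) (|rate| + 1), so the second term of [hC] is at most
   (c - a) M; the final 1 makes M positive. *)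
pose M := C * (`|rate 1 t| + 1) + 1.
have M0 : 0 < M by rewrite ltr_wpDl// mulr_ge0// addr_ge0.
exists (Num.min d1 (e / 2 / M)) => [|a c a0 ac act]; first by rewrite lt_min d10 divr_gt0.
rewrite lt_min => /andP[cd1 cd2].
have h1 := hC _ (law_nneg a0 ac).
have [/andP[_ h2] _] := laplace_law_cumulant ler01 a0 ac.
have := hd1 a c a0 ac act cd1; rewrite mul1r ler_norml => /andP[_ h3].
have ca : 0 <= c - a by rewrite subr_ge0.
have h4 : (c - a) * rate 1 t <= (c - a) * `|rate 1 t| by rewrite ler_wpM2l// ler_norm.
have h5 : C * (1 - laplace (increment_law sigma a c) 1) <=
    C * ((c - a) * (`|rate 1 t| + 1)) by rewrite ler_wpM2l//; lra.
have h6 : C * ((c - a) * (`|rate 1 t| + 1)) <= (c - a) * M.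
  by rewrite mulrCA ler_wpM2l// lerDl.
have h7 : (c - a) * M < e / 2 by rewrite -ltr_pdivlMr.
apply: le_lt_trans h1 _; lra.
Qed.

Lemma subordinate_dist_r s a c u : 0 <= s -> s <= a -> a <= c ->
  rnorm (S s c u - S s a u) <= rnorm (S a c u - u).
Proof.
move=> s0 sa ac; rewrite -(subordinate_comp u s0 sa ac).2 -subordinateB//.
exact: subordinate_contraction.
Qed.

Lemma subordinate_dist_l a c t u : 0 <= a -> a <= c -> c <= t ->
  rnorm (S a t u - S c t u) <= rnorm (S a c u - u).
Proof.
move=> a0 ac ct; have c0 := le_trans a0 ac.
rewrite -(subordinate_comp u a0 ac ct).1 -subordinateB//.
exact: subordinate_contraction.
Qed.

Lemma subordinate_propagator : propagator S.
Proof.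
split=> [t u t0|r s t u r0 rs st|s t u s0 st|s t u s0 st].
- exact: subordinate_id.
- exact: (subordinate_comp u r0 rs st).1.
- apply/cvgr0Pnorm_lt => e e0; have [dl dl0 hdl] := subordinate_near_id u s0 e0.
  rewrite !near_withinE; apply/nbhs_ballP; exists dl => //= x.
  rewrite /ball /= sub0r normrN => xd _ /andP[sx xt].
  rewrite ger0_norm ?rnorm_ge0//; have [x0|x0] := leP 0 x.
    rewrite rnormB; apply: le_lt_trans (subordinate_dist_l u s0 _ xt) _; first lra.
    by apply: hdl; [| lra | left |rewrite addrC addKr -(ger0_norm x0)].
  apply: le_lt_trans (subordinate_dist_l u sx _ st) _; first lra.
  by apply: hdl; [| lra | right |rewrite ltr0_norm// in xd; lra].
- have t0 := le_trans s0 st.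
  apply/cvgr0Pnorm_lt => e e0; have [dl dl0 hdl] := subordinate_near_id u t0 e0.
  rewrite !near_withinE; apply/nbhs_ballP; exists dl => //= x.
  rewrite /ball /= sub0r normrN => xd _ sx.
  rewrite ger0_norm ?rnorm_ge0//; have [x0|x0] := leP 0 x.
    apply: le_lt_trans (subordinate_dist_r u s0 st _) _; first lra.
    by apply: hdl; [| lra | left |rewrite addrC addKr -(ger0_norm x0)].
  rewrite rnormB; apply: le_lt_trans (subordinate_dist_r u s0 sx _) _; first lra.
  by apply: hdl; [lra | lra | right |rewrite ltr0_norm// in xd; lra].
Qed.

Let in1 t (t0 : 0 <= t) := integrable_min1 hnu t0.

(** [Num.min] and [Num.max] order the endpoints, so one limit covers both sides of [t]. *)
Lemma cvg_laplace_quotient (s t l : R) : 0 <= l -> 0 <= s -> s <= t ->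
  (Num.max r t - Num.min r t)^-1 *
    (1 - laplace (increment_law sigma (Num.min r t) (Num.max r t)) l)
    @[r --> within `[s, +oo[ t^'] --> rate l t.
Proof.
move=> l0 s0 st; have t0 := le_trans s0 st.
apply/cvgrPdist_le => e e0; have e2 : 0 < e / 2 by rewrite divr_gt0.
have [d1 d10 hd1] := cumulant_derivative hsigma l0 t0 e2.
have [d2 d20 hd2] := cumulant_derivative hsigma l0 t0 ltr01.
(* The squared cumulant is at most M h^2 on an interval of length h, which h < e / 2 / M turns into
   h e / 2. *)
pose M := (`|rate l t| + 1) ^+ 2.
have M0 : 0 < M by rewrite exprn_gt0// ltr_wpDl.
rewrite !near_withinE; apply/nbhs_ballP.
exists (Num.min d1 (Num.min d2 (e / 2 / M))) => [|r].
  by rewrite /= !lt_min d10 d20 divr_gt0.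
rewrite /ball /= distrC !lt_min => /and3P[rd1 rd2 rd3] rt; rewrite in_itv /= andbT => sr.
have r0 := le_trans s0 sr.
set a := Num.min r t; set c := Num.max r t.
have a0 : 0 <= a by rewrite le_min r0.
have act : a = t \/ c = t by rewrite /a /c; case: leP; [right|left].
have ac : a <= c by rewrite ge_min !le_max lexx.
have rtE : `|r - t| = c - a.
  by rewrite /a /c; case: (leP r t) => h; [rewrite distrC ger0_norm ?subr_ge0|
    rewrite gtr0_norm ?subr_gt0].
have ca : 0 < c - a by rewrite -rtE normr_gt0 subr_eq0.
rewrite rtE in rd1 rd2 rd3.
have h1 := hd1 a c a0 ac act rd1; have h2 := hd2 a c a0 ac act rd2.
have [/andP[h3 h4] h5] := laplace_law_cumulant l0 a0 ac.
move: h1 h2 h3 h4 h5.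
set y := cumulant _ _ _; set x := 1 - laplace _ _; set h := c - a => h1 h2 h3 h4 h5.
have h6 : y <= h * (`|rate l t| + 1).
  have : h * rate l t <= h * `|rate l t| by rewrite ler_wpM2l ?ler_norm// ltW.
  by move: h2; rewrite ler_norml => /andP[]; lra.
have h7 : y ^+ 2 <= h * (e / 2).
  apply: (@le_trans _ _ ((h * (`|rate l t| + 1)) ^+ 2)).
    by rewrite ler_sqr ?nnegrE//; lra.
  rewrite exprMn expr2 -mulrA -/M ler_pM2l//.
  by rewrite ltW// -ltr_pdivlMr.
have -> : rate l t - h^-1 * x = h^-1 * (h * rate l t - x) by field; rewrite gt_eqF.
rewrite normrM [X in X * _]gtr0_norm ?invr_gt0// ler_pdivrMl//.
by move: h1; rewrite !ler_norml => /andP[? ?]; apply/andP; split; lra.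
Qed.

Lemma subordinate_generatorE t q : 
  subordinate_generator db nu A T t q = rscale (db t) (A q) + levy_generator T (nu t) q.
Proof. by []. Qed.

Lemma subordinate_generatorC s t t' q : 0 <= s -> s <= t -> 0 <= t' -> D q ->
  D (S s t q) /\ S s t (subordinate_generator db nu A T t' q) =
    subordinate_generator db nu A T t' (S s t q).
Proof.
move=> s0 st t'0 Dq.
have [DS AS] := subord_domain ip_norm hA hdiss hT hgen (law_nneg s0 st) Dq.
split=> //; rewrite !subordinate_generatorE addrC -[X in _ + X]/(of_real k (db t') *: A q).
rewrite addrC subordinate_linear//.
rewrite [X in _ + X](levy_generator_subord ip_norm hA hdiss hT hgen (in1 t'0) (law_nneg s0 st) Dq).
by rewrite /rscale AS.
Qed.

Lemma subordinate_derivative s t u : 0 <= s -> s <= t -> D u ->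
  is_derivative_within `[s, +oo[ (fun r => S s r u) t
    (subordinate_generator db nu A T t (S s t u)).
Proof.
move=> s0 st Du; have t0 := le_trans s0 st.
rewrite -(subordinate_generatorC s0 st t0 Du).2.
set L := subordinate_generator _ _ _ _ _ _.
pose Y r := rscale (Num.max r t - Num.min r t)^-1
  (S (Num.min r t) (Num.max r t) u - u).
have cY : Y r @[r --> within `[s, +oo[ t^'] --> L.
  apply: (cvg_subord_quotient ip_norm hA hdiss hT hgen (in1 t0) Du).
    rewrite !near_withinE; apply: nearW => r _ /=; rewrite in_itv /= andbT => sr.
    have r0 := le_trans s0 sr.
    split; first by apply: law_nneg; rewrite ?le_min ?r0// ge_min !le_max lexx.
    by rewrite invr_ge0 subr_ge0 ge_min !le_max lexx.
  by move=> l; exact: (cvg_laplace_quotient (ler0n R l) s0 st).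
apply/cvg_rnormP_lt => e e0; have e2 : 0 < e / 2 by rewrite divr_gt0.
have /cvg_rnormP_lt/(_ _ e2) := cY.
have [dl dl0 hdl] := subordinate_near_id L t0 e2.
rewrite !near_withinE => /nbhs_ballP[d1 /= d10 hY]; apply/nbhs_ballP.
exists (Num.min d1 dl) => [|r]; first by rewrite /= lt_min d10.
rewrite /ball /= lt_min => /andP[rd1 rd2] rt rs; have := hY r rd1 rt rs.
move: rs; rewrite in_itv /= andbT /Y => sr; have r0 := le_trans s0 sr.
rewrite -/(rscale _ _); have [rlt|tler] := ltP r t.
  (* To the left of [t] the factor S_{s,r} varies with r: contraction controls its action on the
     quotient, and strong continuity compares S_{s,r} L with S_{s,t} L. *)
  have rler := ltW rlt => h1.
  rewrite (_ : rscale _ (_ - _) = S s r (rscale (t - r)^-1 (S r t u - u))); last first.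
    rewrite [RHS](subordinate_rscale _ _ s0 sr) (subordinateB _ _ s0 sr).
    rewrite (subordinate_comp u s0 sr rler).2 -[r - t]opprB invrN.
    exact: rscaleNB.
  apply: le_lt_trans (ler_rnorm_dist (S s r L) _ _) _; rewrite -(subordinateB _ _ s0 sr).
  have h2 := le_lt_trans (subordinate_contraction _ s0 sr) h1.
  have h3 : rnorm (S s r L - S s t L) < e / 2.
    rewrite rnormB; apply: le_lt_trans (subordinate_dist_r _ s0 sr rler) _.
    by apply: hdl => //; [right|rewrite -(gtr0_norm (x := t - r)) ?subr_gt0].
  lra.
(* To the right of [t] the factor S_{s,t} is fixed and contraction alone suffices. *)
move=> h1.
rewrite (_ : rscale _ (_ - _) = S s t (rscale (r - t)^-1 (S t r u - u))); last first.
  by rewrite [RHS](subordinate_rscale _ _ s0 st) (subordinateB _ _ s0 st) (subordinate_comp u s0 st tler).2.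
rewrite -(subordinateB _ _ s0 st); apply: le_lt_trans (subordinate_contraction _ s0 st) _; lra.
Qed.

End propagator.

Theorem theorem4p1 (R : realType) (k : scalar_kind)
    (H : completeNormedModType (scalars R k))
    (ip : {dot H for @scalar_conj R k})
    (ip_norm : forall u : H, ip u u = `|u| ^+ 2)
    (d : measure_display) (Omega : measurableType d) (P : probability Omega R)
    (b db : R -> R) (nu : R -> {measure set R -> \bar R})
    (sigma : R -> {RV P >-> R})
    (hsigma : nonhomogeneous_subordinator nu b db sigma)
    (hnu : forall t : R, 0 <= t ->
      (\int[nu t]_(x in `]0%R, +oo[) (Num.min x 1)%:E < +oo)%E)
    (D : set H) (A : H -> H) (T : R -> H -> H)
    (hA : self_adjoint ip D A) (hdiss : dissipative ip D A)
    (hT : C0_semigroup T) (hgen : is_generator T D A) :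
  let S := subordinate sigma T in
  [/\ (* the Bochner integrals defining S converge *)
      forall (s t : R) (u : H), 0 <= s -> s <= t ->
        bochner_integrable (increment_law sigma s t) `[0, +oo[
          (fun w => T w u),
      bounded_propagator S,
      (* the Bochner integrals defining - f(- A, t) on D converge *)
      forall (t : R) (q : H), 0 <= t -> D q ->
        bochner_integrable (nu t) `]0, +oo[ (fun s => T s q - q)
    & forall (s : R) (u : H), 0 <= s -> D u ->
        S s s u = u /\
        forall t : R, s <= t ->
          D (S s t u) /\
          is_derivative_within `[s, +oo[ (fun r => S s r u) t
            (subordinate_generator db nu A T t (S s t u))].
Proof.
split.
- move=> s t u s0 st.
  exact: (subord_integrable ip_norm hA hdiss hT hgen (increment_law_nneg hsigma s0 st)).
- split.
  + exact: (subordinate_propagator ip_norm hsigma hnu hA hdiss hT hgen).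
  + move=> s t s0 st; exact: (subordinate_linear ip_norm hsigma hA hdiss hT hgen).
  + exists 1 => s t u s0 st; rewrite mul1r.
    exact: (subordinate_contraction ip_norm hsigma hA hdiss hT hgen).
- move=> t q t0 Dq.
  exact: (levy_generator_integrable ip_norm hA hdiss hT hgen (integrable_min1 hnu t0) Dq).
- move=> s u s0 Du; split.
    exact: (subordinate_id ip_norm hsigma hnu hA hdiss hT hgen).
  move=> t st; split.
    exact: (subord_domain ip_norm hA hdiss hT hgen (increment_law_nneg hsigma s0 st) Du).1.
  exact: (subordinate_derivative ip_norm hsigma hnu hA hdiss hT hgen s0 st Du).
Qed.
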